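(* Let $0<\beta<2$ be fixed and $a=\frac2\beta-2$. For $b>-1$ and an integer $m\ge1$ let $\lambda$ denote the smallest eigenvalue of the $\beta$-Jacobi ensemble with parameters $a,b$ and size $m$. Then as $m\to\infty$ and $b+m\to\infty$ (where $b=b(m)>-1$ may vary in any way), the limiting distribution of the scaled smallest eigenvalue $\frac{\beta m(b+m)}{2}\lambda$ is the distribution on $(0,\infty)$ with probability density $$f(y)=\frac{4\sin\left(\frac\beta2\pi\right)}{\beta\pi}\left(\frac\beta2\right)^{\frac12-\frac\beta4}\Gamma\!\left(1+\tfrac\beta2\right)\,y^{\frac12-\frac\beta4}\,e^{-y}\,K_{1+\frac\beta2}\!\left(\sqrt{2\beta y}\right),\qquad y>0.$$
   Context: $\beta$-Jacobi ensemble: for $\beta>0$, $a,b>-1$ and an integer $m\ge1$, the numbers $\lambda_1,\dots,\lambda_m\in[0,1]$ (the eigenvalues) form the $\beta$-Jacobi ensemble with parameters $a,b$ and size $m$ if their joint density on $[0,1]^m$ is proportional to $$\prod_{i=1}^m\lambda_i^{\frac{\beta}{2}(a+1)-1}(1-\lambda_i)^{\frac{\beta}{2}(b+1)-1}\prod_{i<j}|\lambda_i-\lambda_j|^{\beta};$$ the smallest eigenvalue is $\min_i\lambda_i$. ''Limiting distribution'' means the limit in the sense of convergence in distribution. $K_\nu$ is the modified Bessel function of the second kind. *)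

(* Defs.v *)
From HB Require Import structures.
From mathcomp Require Import all_boot all_order all_algebra.
From mathcomp Require Import all_classical all_reals all_analysis.
From mathcomp Require Import measurable_realfun.

Set Implicit Arguments.
Unset Strict Implicit.
Unset Printing Implicit Defensive.

Import Order.TTheory GRing.Theory Num.Theory.
Import numFieldNormedType.Exports.

Local Open Scope classical_set_scope.
Local Open Scope ring_scope.

(* [cons_measure nu mu] is the product of nu and mu, transported from
   T * n.-tuple T to n.+1.-tuple T. *)
Section cons_measure.
Context d (T : measurableType d) (R : realType).
Variable nu : {sigma_finite_measure set T -> \bar R}.
Variable n : nat.
Variable mu : {sigma_finite_measure set (n.-tuple T) -> \bar R}.

Definition cons_pair (p : T * n.-tuple T) : n.+1.-tuple T := [tuple of p.1 :: p.2].

Lemma measurable_cons_pair : measurable_fun setT cons_pair.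
Proof. exact: measurable_cons. Qed.

Definition cons_measure : set (n.+1.-tuple T) -> \bar R :=
  fun A => (nu \x mu)%E (cons_pair @^-1` A).

Let cons_measure0 : cons_measure set0 = 0%E.
Proof. exact: measure0. Qed.

Let cons_measure_ge0 A : (0 <= cons_measure A)%E.
Proof. exact: measure_ge0. Qed.

Let mcons A : measurable A -> measurable (cons_pair @^-1` A).
Proof. by move=> mA; rewrite -[X in measurable X]setTI; exact: measurable_cons_pair. Qed.

Let cons_measure_sigma_additive : semi_sigma_additive cons_measure.
Proof.
move=> F mF tF mUF; rewrite /cons_measure preimage_bigcup.
apply: measure_semi_sigma_additive.
- by move=> k; exact: mcons.
- apply/trivIsetP => i j _ _ ij; rewrite -preimage_setI.
  by rewrite (trivIsetP.1 tF)// preimage_set0.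
- by rewrite -preimage_bigcup; exact: mcons.
Qed.

HB.instance Definition _ := isMeasure.Build _ _ _ cons_measure
  cons_measure0 cons_measure_ge0 cons_measure_sigma_additive.

Let cons_measure_sigma_finite : sigma_finite setT cons_measure.
Proof.
have /sigma_finiteP[F [TF ndF Foo]] := sigma_finiteT nu.
have /sigma_finiteP[G [TG ndG Goo]] := sigma_finiteT mu.
pose uncons (t : n.+1.-tuple T) : T * n.-tuple T := (thead t, [tuple of behead t]).
have consK : cancel cons_pair uncons.
  by move=> [x t]; rewrite /uncons/= theadE; congr pair; exact/val_inj.
have muncons : measurable_fun setT uncons.
  by apply: measurable_fun_pair; [exact: measurable_tnth|exact: measurable_behead].
exists (fun k => uncons @^-1` (F k `*` G k)).
  apply/esym; rewrite -subTset => t _.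
  have [k _ Fk] : (\bigcup_k F k) (uncons t).1 by rewrite -TF.
  have [l _ Gl] : (\bigcup_k G k) (uncons t).2 by rewrite -TG.
  exists (maxn k l) => //; split.
  - by move: Fk; exact/subsetPset/ndF/leq_maxl.
  - by move: Gl; exact/subsetPset/ndG/leq_maxr.
move=> k; have [mF Fk] := Foo k; have [mG Gk] := Goo k; split.
  by rewrite -[X in measurable X]setTI; apply: muncons => //; exact: measurableX.
have -> : cons_measure (uncons @^-1` (F k `*` G k)) = (nu \x mu)%E (F k `*` G k).
  rewrite /cons_measure; congr product_measure1.
  by rewrite -comp_preimage (_ : uncons \o cons_pair = id)//; exact/funext.
by rewrite product_measure1E// lte_mul_pinfty// ge0_fin_numE.
Qed.

HB.instance Definition _ := Measure_isSigmaFinite.Build _ _ _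
  cons_measure cons_measure_sigma_finite.

End cons_measure.

Fixpoint lebesgue_tuple (R : realType) n :
    {sigma_finite_measure set (n.-tuple (measurableTypeR R)) -> \bar R} :=
  if n is n'.+1 then cons_measure (@lebesgue_measure R) (lebesgue_tuple R n')
  else \d_([tuple] : 0.-tuple (measurableTypeR R)).

(* [lebesgue_tuple R n] gives boxes the product of the measures of their
   sides, which is what characterizes the Lebesgue measure on R^n. *)
Lemma lebesgue_tuple_box (R : realType) n (A : 'I_n -> set (measurableTypeR R)) :
  (forall i, measurable (A i)) ->
  lebesgue_tuple R n [set t | forall i, A i (tnth t i)] =
  (\prod_(i < n) lebesgue_measure (A i))%E.
Proof.
elim: n A => [|n IHn] A mA.
  rewrite big_ord0 /= diracE mem_set//= => -[].
  by case.
rewrite big_ord_recl -IHn//= /cons_measure.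
pose B : set (n.-tuple (measurableTypeR R)) := [set t | forall i, A (lift ord0 i) (tnth t i)].
rewrite (_ : _ @^-1` _ = A ord0 `*` B); last first.
  apply/seteqP; split => -[x t]; rewrite /preimage/= /B/=.
    by move=> H; split=> [|i]; [have := H ord0|have := H (lift ord0 i)];
      rewrite /cons_pair/= ?tnth0 ?tnthS.
  move=> [Ax Bt] i; rewrite /cons_pair/=.
  by case: (unliftP ord0 i) => [j|] ->; rewrite ?tnth0 ?tnthS.
rewrite product_measure1E//.
rewrite (_ : B = \big[setI/setT]_(i < n) ((@tnth _ (measurableTypeR R) ^~ i) @^-1` A (lift ord0 i))).
  apply: bigsetI_measurable => i _; rewrite -[X in measurable X]setTI.
  exact: measurable_tnth.
rewrite -bigcap_seq; apply/seteqP; split => t; rewrite /B/=.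
  by move=> H i _; exact: H.
by move=> H i; apply: (H i); rewrite /= mem_index_enum.
Qed.

(* [P] has density [f] on [D] with respect to [mu], with no mass off [D];
   the values of [f] off [D] are irrelevant. *)
Definition has_density d (T : measurableType d) (R : realType)
    (mu : {measure set T -> \bar R}) (P : probability T R) (D : set T)
    (f : T -> R) : Prop :=
  [/\ measurable D, measurable_fun D f, (forall x, D x -> 0 <= f x) &
      forall A, measurable A -> P A = (\int[mu]_(x in D `&` A) (f x)%:E)%E].

(* Pointwise convergence of the distribution functions at the continuity
   points of the limiting one. *)
Definition cvg_in_distribution (R : realType) (d : nat -> measure_display)
    (T : forall n, measurableType (d n)) (P : forall n, probability (T n) R)
    (X : forall n, {RV (P n) >-> R}) (Q : probability (measurableTypeR R) R) :
    Prop :=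
  forall y : R, {for y, continuous (fun z : R => Q `]-oo, z]%classic)} ->
    cdf (X n) y @[n --> \oo] --> Q `]-oo, y]%classic.

Definition jacobi_weight (R : realType) (beta a b : R) (m : nat)
    (l : m.-tuple (measurableTypeR R)) : R :=
  (\prod_(i < m) (tnth l i `^ (beta / 2 * (a + 1) - 1) *
                  (1 - tnth l i) `^ (beta / 2 * (b + 1) - 1))) *
  \prod_(i < m) \prod_(j < m | (i < j)%N) `|tnth l i - tnth l j| `^ beta.

Definition jacobi_ensemble (R : realType) (beta a b : R) (m : nat)
    d (T : measurableType d) (P : probability T R)
    (X : {RV P >-> m.-tuple (measurableTypeR R)}) : Prop :=
  exists2 c : R, 0 < c &
    has_density (lebesgue_tuple R m) (distribution P X)
      [set l | forall i, 0 <= tnth l i <= 1]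
      (fun l => c * jacobi_weight beta a b l).

(* For m > 0, the default value [head 0 l] is an entry of [l]. *)
Definition smallest_eigenvalue (R : realType) (m : nat) (l : m.-tuple (measurableTypeR R)) : R :=
  \big[Num.min/head 0 l]_(x <- l) x.

Section smallest_eigenvalue.
Context {R : realType} {m : nat}.

Lemma measurable_smallest_eigenvalue : measurable_fun setT (@smallest_eigenvalue R m).
Proof.
have mh : measurable_fun setT (fun l : m.-tuple (measurableTypeR R) => head 0 l).
  case: m => [|n].
    rewrite (_ : (fun l => _) = cst 0)//.
    by apply/funext => l; rewrite [l]tuple0.
  rewrite (_ : (fun l => _) = (@tnth _ (measurableTypeR R) ^~ (@ord0 n))).
    exact: measurable_tnth.
  by apply/funext => l; rewrite (tnth_nth 0) nth0.
have -> : @smallest_eigenvalue R m = (fun l => \big[Num.min/head 0 l]_(i < m) tnth l i).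
  by apply/funext => l; rewrite /smallest_eigenvalue big_tuple.
elim: (index_enum _) => [|i r IHr].
  by under eq_fun do rewrite big_nil.
under eq_fun do rewrite big_cons.
by apply: measurable_minr => //; exact: measurable_tnth.
Qed.

HB.instance Definition _ := isMeasurableFun.Build _ _ _ _ (@smallest_eigenvalue R m)
  measurable_smallest_eigenvalue.

End smallest_eigenvalue.

(* Euler's integral, for s > 0. *)
Definition Gamma (R : realType) (s : R) : R :=
  \int[lebesgue_measure]_(t in `]0, +oo[) (t `^ (s - 1) * expR (- t)).

Definition cosh (R : realType) (t : R) : R := (expR t + expR (- t)) / 2.

(* Modified Bessel function of the second kind, for x > 0: the integral
   representation K_nu(x) = int_0^oo exp(-x cosh t) cosh(nu t) dt. *)
Definition besselK (R : realType) (nu x : R) : R :=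
  \int[lebesgue_measure]_(t in `[0, +oo[) (expR (- x * cosh t) * cosh (nu * t)).

Definition limit_density (R : realType) (beta y : R) : R :=
  4 * sin (beta / 2 * pi) / (beta * pi) *
  (beta / 2) `^ (1 / 2 - beta / 4) * Gamma (1 + beta / 2) *
  y `^ (1 / 2 - beta / 4) * expR (- y) *
  besselK (1 + beta / 2) (Num.sqrt (2 * beta * y)).

(* Main.v *)
Require Import Defs.
From HB Require Import structures.
From mathcomp Require Import all_boot all_order all_algebra.
From mathcomp Require Import all_classical all_reals all_analysis.
From mathcomp Require Import measurable_realfun ring lra.

(** Write [k = beta / 2], [q = k (b + 1)] and [N = k (b + m)]. The value
    [a = 2 / beta - 2] gives the eigenvalues the weight [l `^ - k] at 0, whose
    exponent is exactly tuned to the exponent [2 k] of the interaction.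

    All eigenvalues exceed [x] with a probability proportional to
    [(1 - x) `^ (m (N - k))] times
    [J s = \int \prod_i (t_i + s) `^ - k * (1 - t_i) `^ (q - 1)
          * \prod_(i < j) |t_i - t_j| `^ (2 k)]
    over the unit cube, where [s = x / (1 - x)]; this is the affine substitution
    of [jacobi_survival]. The function [J] solves a second-order hypergeometric
    equation. Indeed, moving all [t_i] along the vector field
    [t (1 - t) / (t + s)] preserves the cube, and the vanishing of the first-order
    variation of the integral ([loop_equation]) is a linear relation between the
    averages of [1], [P_1] and [P_2 + k P_1^2], with [P_j = \sum_i (t_i + s)^-j]:
    because the exponent of the shifted product is [- k], these averages are, up to
    factors, [J], [J'] and [J'']. The one-dimensional integral
    [\int w `^ - k * (1 - w) `^ (N - 1) * (w / (w + s)) `^ (m k)] over [[0, 1]]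
    solves the same equation. Both functions decay at infinity like
    [s `^ - (m k)], and a solution with this decay is unique up to a factor
    ([decaying_solutions_proportional]). Letting [x] tend to 0 identifies the
    constants, so the tail of the smallest eigenvalue is an explicit ratio of
    one-dimensional integrals ([jacobi_survival_ratio]).

    Since [beta m (b + m) / 2 = m N], take [x = y / (m N)] and substitute
    [w = u / N]. Dominated convergence ([scaled_beta_integral_cvg]) gives the limit
    [S y = exp (- y) / Gamma (1 - k) * \int u `^ - k * exp (- u - k y / u) du]
    over the half line as soon as [m] and [N] tend to infinity.

    It remains to recognize [S] as the tail of the law with density [f]. In the
    integral representation of [f] obtained from the substitution [u = s exp t] in
    the integral defining the Bessel function and one integration by parts
    ([limit_densityE]), the variable [y] occurs only in
    [exp (- (1 + k / u) y)], and Tonelli's theorem integrates it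
    ([limit_kernel_tail]). The constants agree by the reflection formula for Gamma
    ([Gamma_reflection]). It is proved along the lines of Euler's product: the
    quotient [Gamma (n + x) Gamma (n - x) / Gamma n ^ 2] is multiplied by
    [(n^2 - x^2) / n^2] from [n] to [n + 1], the moments
    [\int cos (2 x t) * cos t ^ (2 n)] over [[0, pi / 2]], relative to those with
    [x = 0], are divided by the same factor, and both quotients tend to 1. *)

Set Implicit Arguments.
Unset Strict Implicit.
Unset Printing Implicit Defensive.

Import Order.TTheory GRing.Theory Num.Theory.
Import numFieldNormedType.Exports.

Local Open Scope classical_set_scope.
Local Open Scope ring_scope.

(** * First-order expansions, uniform in the integration variable *)

Section elementary_bounds.
Context {R : realType}.
Implicit Types x y e : R.

Lemma ln1D_ge x : - (1 / 2) <= x -> x - 2 * x ^+ 2 <= ln (1 + x).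
Proof.
move=> x2; have x1 : 0 < 1 + x by lra.
have xE : (1 + x)^-1 = 1 + (- x / (1 + x)) by field; rewrite gt_eqF.
have : ln (1 + (- x / (1 + x))) <= - x / (1 + x).
  by apply: le_ln1Dx; rewrite ltr_pdivlMr//; lra.
rewrite -xE lnV ?posrE//; move=> H.
have : x - 2 * x ^+ 2 <= x / (1 + x).
  by rewrite ler_pdivlMr//; nra.
by move: H; rewrite mulNr; lra.
Qed.

Lemma expR_sub_le x : `|x| <= 1 / 2 -> `|expR x - 1 - x| <= 2 * x ^+ 2.
Proof.
rewrite ler_norml => /andP[xl xu].
have := expR_ge1Dx x; have := expR_ge1Dx (- x).
rewrite expRN => H1 H2.
have e0 := expR_gt0 x.
have : expR x <= (1 - x)^-1.
  by rewrite -[leLHS]invrK lef_pV2 ?posrE ?invr_gt0//; lra.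
have : (1 - x)^-1 <= 1 + x + 2 * x ^+ 2.
  rewrite -[leLHS]mul1r ler_pdivrMr; last lra.
  have -> : (1 + x + 2 * x ^+ 2) * (1 - x) = 1 + x ^+ 2 * (1 - 2 * x) by ring.
  by rewrite lerDl mulr_ge0 ?sqr_ge0//; lra.
by rewrite ler_norml; nra.
Qed.

(** The error term is explicit in [e], so that it is uniform over the points where
    the expansion is used. *)
Lemma powR1D_expansion x e : `|x| <= 1 / 2 -> 2 * `|e| * `|x| <= 1 / 2 ->
  `|(1 + x) `^ e - 1 - e * x| <= (2 * `|e| + 8 * `|e| ^+ 2) * x ^+ 2.
Proof.
move=> x2 ex.
have x0 : 0 < 1 + x by move: x2; rewrite ler_norml; lra.
rewrite /powR gt_eqF//; set L := ln _.
have L1 : `|L - x| <= 2 * x ^+ 2.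
  move: x2; rewrite ler_norml => /andP[xl xu].
  have := @ln1D_ge x; have := @le_ln1Dx _ x; rewrite -/L ler_norml; nra.
have L2 : `|L| <= 2 * `|x|.
  have := ler_normD (L - x) x; rewrite subrK => /le_trans; apply.
  have := normr_ge0 x; rewrite -(real_normK (num_real x)) in L1; nra.
have eL : `|e * L| <= 1 / 2 by rewrite normrM; have := normr_ge0 e; nra.
have := expR_sub_le eL.
rewrite exprMn -(real_normK (num_real e)) -(real_normK (num_real L)) => H.
have -> : expR (e * L) - 1 - e * x = (expR (e * L) - 1 - e * L) + e * (L - x) by ring.
apply: le_trans (ler_normD _ _) _; rewrite normrM.
have e0 := normr_ge0 e.
have : `|L| ^+ 2 <= 4 * x ^+ 2.
  rewrite -(real_normK (num_real x)); have := normr_ge0 L; have := normr_ge0 x; nra.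
have : `|e| * `|L - x| <= `|e| * (2 * x ^+ 2) by rewrite ler_wpM2l.
have := sqr_ge0 `|e|; nra.
Qed.

End elementary_bounds.

Section first_order.
Context {R : realType} {T : Type} (D : set T).
Implicit Types (f g : R -> T -> R) (u v : T -> R).

(** [f h = u + h v + O(h^2)] with all constants uniform over [D]: the form of
    differentiability at [h = 0] that survives integration over [D] and is stable
    under sums and products. *)
Definition first_order f u v := exists C d : R, [/\ 0 <= C, 0 < d <= 1 &
  forall h t, `|h| <= d -> D t ->
    [/\ `|f h t - u t - h * v t| <= C * h ^+ 2, `|u t| <= C & `|v t| <= C]].

Lemma first_order2 f u v g u' v' : first_order f u v -> first_order g u' v' ->
  exists C d : R, [/\ 0 <= C, 0 < d <= 1 &
  forall h t, `|h| <= d -> D t ->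
    [/\ `|f h t - u t - h * v t| <= C * h ^+ 2, `|u t| <= C & `|v t| <= C] /\
    [/\ `|g h t - u' t - h * v' t| <= C * h ^+ 2, `|u' t| <= C & `|v' t| <= C]].
Proof.
move=> [C [d [C0 d0 H]]] [C' [d' [C0' d0' H']]].
exists (C + C'), (Num.min d d'); split; first lra.
  by rewrite lt_min ge_min; lra.
move=> h t; rewrite le_min => /andP[hd hd'] Dt.
have [H1 H2 H3] := H h t hd Dt; have [H1' H2' H3'] := H' h t hd' Dt.
have h0 := sqr_ge0 h.
by split; split; nra.
Qed.

Lemma first_order_cst u B : (forall t, D t -> `|u t| <= B) ->
  first_order (fun _ => u) u (fun _ => 0).
Proof.
move=> uB; exists `|B|, 1; split => //; first by rewrite ltr01 lexx.
move=> h t _ /uB ut; rewrite mulr0 subr0 subrr normr0.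
by rewrite mulr_ge0 ?sqr_ge0//; split => //; rewrite (le_trans ut)// ler_norm.
Qed.

Lemma first_orderD f u v g u' v' : first_order f u v -> first_order g u' v' ->
  first_order (fun h t => f h t + g h t) (fun t => u t + u' t)
    (fun t => v t + v' t).
Proof.
move=> /first_order2 /[apply] -[C [d [C0 d0 H]]].
exists (2 * C), d; split => //; first lra.
move=> h t hd Dt; have [[H1 H2 H3] [H1' H2' H3']] := H h t hd Dt; split.
- have -> : f h t + g h t - (u t + u' t) - h * (v t + v' t) =
    (f h t - u t - h * v t) + (g h t - u' t - h * v' t) by ring.
  by apply: le_trans (ler_normD _ _) _; lra.
- by apply: le_trans (ler_normD _ _) _; lra.
- by apply: le_trans (ler_normD _ _) _; lra.
Qed.

Lemma first_orderM f u v g u' v' : first_order f u v -> first_order g u' v' ->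
  first_order (fun h t => f h t * g h t) (fun t => u t * u' t)
    (fun t => v t * u' t + u t * v' t).
Proof.
move=> /first_order2 /[apply] -[C [d [C0 d0 H]]].
exists (6 * C ^+ 2), d; split => //; first nra.
move=> h t hd Dt; have [[H1 H2 H3] [H1' H2' H3']] := H h t hd Dt.
have C2 : 0 <= C ^+ 2 by rewrite exprn_ge0.
have b2 (x y c c' : R) : `|x| <= c -> `|y| <= c' -> `|x * y| <= c * c'.
  by move=> xc yc; rewrite normrM ler_pM.
have h1 : h ^+ 2 <= 1.
  by rewrite -(real_normK (num_real h)) expr_le1//; lra.
have h0 := sqr_ge0 h.
split.
- set r := (X in `|X| <= _) in H1; set s := (X in `|X| <= _) in H1'.
  have -> : f h t * g h t - u t * u' t - h * (v t * u' t + u t * v' t) =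
    h ^+ 2 * (v t * v' t) + u t * s + (h * v t) * s + r * u' t + r * (h * v' t) + r * s.
    by rewrite /r /s; ring.
  have hn : `|h| <= 1 by lra.
  have e1 : `|h ^+ 2 * (v t * v' t)| <= h ^+ 2 * (C * C).
    by apply/b2; [rewrite ger0_norm|exact: b2].
  have e2 := b2 _ _ _ _ H2 H1'.
  have e3 := b2 _ _ _ _ (b2 _ _ _ _ hn H3) H1'.
  have e4 := b2 _ _ _ _ H1 H2'.
  have e5 := b2 _ _ _ _ H1 (b2 _ _ _ _ hn H3').
  have e6 := b2 _ _ _ _ H1 H1'.
  do 5 (apply: le_trans (ler_normD _ _) _; rewrite -lerBrDr).
  nra.
- by have := b2 _ _ _ _ H2 H2'; nra.
- apply: le_trans (ler_normD _ _) _.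
  by have := b2 _ _ _ _ H3 H2'; have := b2 _ _ _ _ H2 H3'; nra.
Qed.

Lemma first_order_powR (a : T -> R) (A e : R) : (forall t, D t -> `|a t| <= A) ->
  first_order (fun h t => (1 + h * a t) `^ e) (fun _ => 1) (fun t => e * a t).
Proof.
move=> aA.
pose K := 1 + `|A|; have K0 : 0 < K by rewrite ltr_pwDl.
have e0 := normr_ge0 e.
have M0 : 0 < 2 * (1 + 2 * `|e|) * K by nra.
have eK : 0 <= `|e| * K by rewrite mulr_ge0// ltW.
have cK : 0 <= (2 * `|e| + 8 * `|e| ^+ 2) * K ^+ 2.
  by rewrite mulr_ge0 ?sqr_ge0//; have := sqr_ge0 `|e|; lra.
exists ((2 * `|e| + 8 * `|e| ^+ 2) * K ^+ 2 + 1 + `|e| * K), (Num.min 1 (2 * (1 + 2 * `|e|) * K)^-1); split.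
- by lra.
- by rewrite lt_min ltr01 invr_gt0 M0/= ge_min lexx.
move=> h t; rewrite le_min => /andP[h1 hM] Dt.
have aK : `|a t| <= K.
  by apply: le_trans (aA t Dt) _; rewrite /K; have := ler_norm A; lra.
have haK : `|h * a t| <= `|h| * K by rewrite normrM ler_wpM2l.
have hKe : `|h| * K * (1 + 2 * `|e|) <= 1 / 2.
  move: hM; rewrite -(ler_pM2r M0) mulVf ?gt_eqF//; lra.
have hK0 : 0 <= `|h| * K by rewrite mulr_ge0//; lra.
have := @powR1D_expansion _ (h * a t) e; rewrite -mulrA.
have e1 : 0 <= `|h| * K * `|e| by rewrite mulr_ge0.
have e2 : `|e| * `|h * a t| <= `|e| * (`|h| * K) by rewrite ler_wpM2l.
move=> /(_ ltac:(lra) ltac:(lra)) H.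
split.
- rewrite (_ : h * (e * a t) = e * (h * a t)); last by ring.
  apply: le_trans H _; rewrite exprMn.
  have a2 : a t ^+ 2 <= K ^+ 2.
    by rewrite -(real_normK (num_real (a t))) ler_pXn2r// nnegrE// ltW.
  have h0 := sqr_ge0 h.
  have c0 : 0 <= 2 * `|e| + 8 * `|e| ^+ 2 by have := sqr_ge0 `|e|; lra.
  rewrite mulrDl mulrDl -addrA.
  have : (2 * `|e| + 8 * `|e| ^+ 2) * (h ^+ 2 * a t ^+ 2) <= (2 * `|e| + 8 * `|e| ^+ 2) * K ^+ 2 * h ^+ 2.
    by rewrite -mulrA [K ^+ 2 * _]mulrC ler_wpM2l// ler_wpM2l.
  have : 0 <= `|e| * K * h ^+ 2 by rewrite mulr_ge0.
  lra.
- by rewrite normr1; lra.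
- rewrite normrM.
  have : `|e| * `|a t| <= `|e| * K by rewrite ler_wpM2l.
  lra.
Qed.

Lemma first_order_sum (I : Type) (r : seq I) (P : pred I) (f : I -> R -> T -> R)
    (u v : I -> T -> R) : (forall i, P i -> first_order (f i) (u i) (v i)) ->
  first_order (fun h t => \sum_(i <- r | P i) f i h t)
    (fun t => \sum_(i <- r | P i) u i t) (fun t => \sum_(i <- r | P i) v i t).
Proof.
move=> H; elim: r => [|i r IH].
  under [X in first_order X]eq_fun do under eq_fun do rewrite big_nil.
  under [X in first_order _ X]eq_fun do rewrite big_nil.
  under [X in first_order _ _ X]eq_fun do rewrite big_nil.
  by apply: (@first_order_cst _ 0) => t _; rewrite normr0.
under [X in first_order X]eq_fun do under eq_fun do rewrite big_cons.
under [X in first_order _ X]eq_fun do rewrite big_cons.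
under [X in first_order _ _ X]eq_fun do rewrite big_cons.
case Pi: (P i) => //.
exact: (first_orderD (H i Pi) IH).
Qed.

(** The logarithmic derivative: only factors equal to 1 at [h = 0] occur. *)
Lemma first_order_prod1 (I : Type) (r : seq I) (P : pred I) (f : I -> R -> T -> R)
    (v : I -> T -> R) : (forall i, P i -> first_order (f i) (fun _ => 1) (v i)) ->
  first_order (fun h t => \prod_(i <- r | P i) f i h t)
    (fun t => 1) (fun t => \sum_(i <- r | P i) v i t).
Proof.
move=> H; elim: r => [|i r IH].
  under [X in first_order X]eq_fun do under eq_fun do rewrite big_nil.
  under [X in first_order _ _ X]eq_fun do rewrite big_nil.
  by apply: (@first_order_cst _ 1) => t _; rewrite normr1.
under [X in first_order X]eq_fun do under eq_fun do rewrite big_cons.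
under [X in first_order _ _ X]eq_fun do rewrite big_cons.
case Pi: (P i) => //.
move: (first_orderM (H i Pi) IH).
under [X in first_order _ X]eq_fun do rewrite mulr1.
by under [X in first_order _ _ X]eq_fun do rewrite mulr1 mul1r.
Qed.

End first_order.

(** * Differentiation under the integral sign *)

Lemma is_derive1_quadratic {R : realType} (F : R -> R) (s a C d : R) : 0 < d ->
  (forall h, `|h| <= d -> `|F (s + h) - F s - h * a| <= C * h ^+ 2) ->
  is_derive s 1 F a.
Proof.
move=> d0 FC; apply/is_derive1_caratheodory.
have nb r : 0 < r -> \forall z \near s, `|z - s| <= r.
  by move=> r0; apply/nbhs_ballP; exists r => //= y; rewrite /ball/= distrC => /ltW.
exists (fun z => if z == s then a else (F z - F s) / (z - s)); split.
- move=> z; case: eqVneq => [->|zs]; first by rewrite !subrr mulr0.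
  by rewrite divfK// subr_eq0.
- apply/cvgrPdist_le => /= e e0; rewrite eqxx.
  have c1 : 0 < `|C| + 1 by rewrite ltr_wpDl.
  near=> z; case: eqVneq => [_|zs]; first by rewrite subrr normr0 ltW.
  have zs0 : 0 < `|z - s| by rewrite normr_gt0 subr_eq0.
  have zd : `|z - s| <= d.
    by near: z; exact: nb.
  have ze : `|z - s| <= e / (`|C| + 1).
    by near: z; apply/nb; rewrite divr_gt0.
  have := FC _ zd; rewrite subrKC => H.
  have -> : a - (F z - F s) / (z - s) = - ((F z - F s - (z - s) * a) / (z - s)).
    by field; rewrite subr_eq0.
  rewrite normrN normrM normfV ler_pdivrMr//; apply: le_trans H _.
  rewrite -(real_normK (num_real (z - s))) expr2 mulrA ler_wpM2r//.
  move: ze; rewrite ler_pdivlMr// => ze.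
  by apply: le_trans ze; rewrite mulrC ler_wpM2l//; have := ler_norm C; lra.
- by rewrite eqxx.
Unshelve. all: by end_near. Qed.

Section first_order_integral.
Context d (T : measurableType d) (R : realType) (mu : {measure set T -> \bar R}).
Variables (D : set T) (Psi : T -> R).
Hypotheses (mD : measurable D) (iPsi : mu.-integrable D (EFin \o Psi)).

Lemma integrable_bounded_mul (g : T -> R) (B : R) : measurable_fun D g ->
  (forall t, D t -> `|g t| <= B) ->
  mu.-integrable D (EFin \o (fun t => Psi t * g t)).
Proof.
move=> mg gB.
apply: (@le_integrable _ _ _ _ _ mD _ (fun t => B%:E * (Psi t)%:E)%E).
- apply/measurable_EFinP; apply: measurable_funM => //.
  by apply/measurable_EFinP; exact: measurable_int iPsi.
- move=> t Dt /=; rewrite lee_fin !normrM mulrC ler_wpM2r//.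
  by rewrite (le_trans (gB t Dt))// ler_norm.
- exact: integrableZl.
Qed.

(** A uniform first-order expansion of the integrand is integrated term by term. *)
Lemma first_order_integral (f : R -> T -> R) (u v : T -> R) :
  first_order D f u v ->
  (forall h, measurable_fun D (f h)) -> measurable_fun D u -> measurable_fun D v ->
  exists C d : R, 0 < d /\ forall h, `|h| <= d ->
    `|\int[mu]_(t in D) (Psi t * f h t) - \int[mu]_(t in D) (Psi t * u t)
      - h * \int[mu]_(t in D) (Psi t * v t)| <= C * h ^+ 2.
Proof.
move=> [C [e [C0 e01 H]]] mf mu_ mv.
exists (C * \int[mu]_(t in D) `|Psi t|), e; split; first by case/andP: e01.
move=> h he.
have iu : mu.-integrable D (EFin \o (fun t => Psi t * u t)).
  by apply: (@integrable_bounded_mul _ C) => // t /(H h t he)[].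
have iv : mu.-integrable D (EFin \o (fun t => Psi t * v t)).
  by apply: (@integrable_bounded_mul _ C) => // t /(H h t he)[].
have ihv : mu.-integrable D (EFin \o (fun t => h * (Psi t * v t))).
  exact: (integrableZl mD h iv).
have mr : measurable_fun D (fun t => f h t - u t - h * v t).
  by apply: measurable_funB; [exact: measurable_funB|exact: measurable_funM].
have ir : mu.-integrable D (EFin \o (fun t => Psi t * (f h t - u t - h * v t))).
  by apply: (@integrable_bounded_mul _ (C * h ^+ 2)) => // t /(H h t he)[].
have if_ : mu.-integrable D (EFin \o (fun t => Psi t * f h t)).
  have := integrableD mD (integrableD mD ir iu) ihv.
  by apply: eq_integrable => // t _ /=; congr EFin; ring.
rewrite -RintegralB// -RintegralZl//.
rewrite -RintegralB//; last exact: (integrableB mD if_ iu).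
rewrite (_ : Rintegral _ _ _ = \int[mu]_(t in D) (Psi t * (f h t - u t - h * v t))); last first.
  by apply: eq_Rintegral => t _; ring.
apply: le_trans (le_normr_Rintegral mD ir) _.
have in_ : mu.-integrable D (EFin \o (fun t => `|Psi t|)) by exact: integrable_norm.
rewrite mulrAC -RintegralZl//.
apply: le_Rintegral => //.
- exact: integrable_norm.
- exact: (integrableZl mD (C * h ^+ 2) in_).
- by move=> t Dt; rewrite normrM mulrC ler_wpM2r//; have [] := H h t he Dt.
Qed.

End first_order_integral.

(** * Change of variables on the line *)

Section weighted_integral.
Context d (T : measurableType d) d' (Y : measurableType d') (R : realType).
Variables (mu : {measure set T -> \bar R}) (phi : T -> Y) (w : T -> R).
Hypotheses (mphi : measurable_fun setT phi) (mw : measurable_fun setT w)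
  (w0 : forall t, 0 <= w t).
Local Open Scope ereal_scope.
Import HBNNSimple.

Let weighted_indic (A : set Y) : measurable A ->
  measurable_fun setT (fun t => (\1_A (phi t))%:E * (w t)%:E).
Proof.
move=> mA; apply: emeasurable_funM; apply/measurable_EFinP => //.
by apply: (measurableT_comp _ mphi); exact: measurable_indic.
Qed.

(** Reduces weighted integrals along [phi] to those of indicators, by monotone
    convergence over simple functions. *)
Lemma weighted_integral_approx (f : Y -> \bar R) (mf : measurable_fun setT f) :
  (forall y, 0 <= f y) ->
  \int[mu]_t (f (phi t) * (w t)%:E) =
  limn (fun n => \sum_(k \in range (nnsfun_approx measurableT mf n))
    (k%:E * \int[mu]_t ((\1_(nnsfun_approx measurableT mf n @^-1` [set k]) (phi t))%:E * (w t)%:E))).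
Proof.
move=> f0; set g := nnsfun_approx _ _.
have mg n : measurable_fun setT (fun t => (g n (phi t))%:E * (w t)%:E).
  apply: emeasurable_funM; apply/measurable_EFinP => //.
  exact: measurableT_comp.
transitivity (limn (fun n => \int[mu]_t ((g n (phi t))%:E * (w t)%:E))).
  rewrite -monotone_convergence//.
  - apply: eq_integral => t _; apply/esym/cvg_lim => //.
    by apply: cvgeZr => //; exact: cvg_nnsfun_approx.
  - by move=> n t _; rewrite -EFinM lee_fin mulr_ge0.
  - move=> t _ m n mn; rewrite -!EFinM lee_fin ler_wpM2r//.
    exact/lefP/nd_nnsfun_approx.
congr (limn _); apply/funext => n.
rewrite (eq_integral (fun t => \sum_(k \in range (g n))
    (k%:E * ((\1_(g n @^-1` [set k]) (phi t))%:E * (w t)%:E)))); last first.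
  move=> t _; rewrite [in LHS]fimfunE -fsumEFin// ge0_mule_fsuml//.
    by apply: eq_fsbigr => k _; rewrite EFinM muleA.
  by move=> k; exact: nnfun_muleindic_ge0.
rewrite ge0_integral_fsum//.
- apply: eq_fsbigr => k /[!inE] -[y _ <-].
  rewrite ge0_integralZl_EFin//.
  + by move=> t _; rewrite -EFinM lee_fin mulr_ge0// indicE.
  + exact: weighted_indic.
- move=> k; apply: measurable_funeM; exact: weighted_indic.
- move=> k t _; rewrite muleA mule_ge0//; [exact: nnfun_muleindic_ge0|by rewrite lee_fin].
Qed.

End weighted_integral.

Section eq_weighted_integral.
Import HBNNSimple.

(** Monotone-class principle: a change of variables holds for all nonnegative
    functions as soon as it holds for indicators. *)
Lemma eq_weighted_integral d (T : measurableType d) d' (Y : measurableType d')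
    (R : realType) (mu : {measure set T -> \bar R}) (phi : T -> Y) (w : T -> R)
    (nu : {measure set Y -> \bar R}) (v : Y -> R) :
  measurable_fun setT phi -> measurable_fun setT w -> (forall t, 0 <= w t) ->
  measurable_fun setT v -> (forall t, 0 <= v t) ->
  (forall A, measurable A -> \int[mu]_t ((\1_A (phi t))%:E * (w t)%:E) =
                             \int[nu]_y ((\1_A y)%:E * (v y)%:E))%E ->
  forall f : Y -> \bar R, measurable_fun setT f -> (forall y, 0 <= f y)%E ->
  (\int[mu]_t (f (phi t) * (w t)%:E) = \int[nu]_y (f y * (v y)%:E))%E.
Proof.
move=> mphi mw w0 mv v0 H f mf f0.
rewrite (weighted_integral_approx _ mphi mw w0 mf f0).
rewrite (@weighted_integral_approx _ _ _ _ _ nu id v (@measurable_id _ _ _) mv v0 _ mf f0).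
congr (limn _); apply/funext => n; apply: eq_fsbigr => k _; congr (_ * _)%E.
by rewrite H.
Qed.

End eq_weighted_integral.

Section density_measure.
Context d (T : measurableType d) (R : realType).
Variables (mu : {measure set T -> \bar R}) (w : T -> R).
Hypotheses (mw : measurable_fun setT w) (w0 : forall t, 0 <= w t).

(** The two proofs are arguments of the definition so that the measure structure
    below can be inferred from the term. *)
Definition density_measure of measurable_fun setT w & (forall t, 0 <= w t) :=
  fun A : set T => (\int[mu]_(t in A) (w t)%:E)%E.

Local Notation nu := (density_measure mw w0).

Let nu0 : nu set0 = 0%E.
Proof. by rewrite /density_measure integral_set0. Qed.

Let nu_ge0 A : (0 <= nu A)%E.
Proof. by apply: integral_ge0 => t _; rewrite lee_fin. Qed.

Let nu_sigma_additive : semi_sigma_additive nu.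
Proof.
move=> F mF tF mUF; rewrite /density_measure; apply: cvg_toP.
  apply: ereal_nondecreasing_is_cvgn => m n mn.
  by apply: lee_sum_nneg_natr => // k _ _; exact: nu_ge0.
rewrite ge0_integral_bigcup//=.
- by apply/measurable_funTS/measurableT_comp.
- by move=> x _; rewrite lee_fin.
Qed.

HB.instance Definition _ := isMeasure.Build _ _ _ nu nu0 nu_ge0 nu_sigma_additive.

End density_measure.

Section change_of_variables.
Context {R : realType}.
Notation lambda := (@lebesgue_measure R).
Variables (phi dphi : R -> R) (a b : R).
Hypothesis ab : a < b.
Hypothesis dphiE : forall x, a <= x <= b -> is_derive x 1 phi (dphi x).
Hypothesis dphi_gt0 : forall x, a <= x <= b -> 0 < dphi x.
Hypothesis cdphi : {within `[a, b], continuous dphi}.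
Hypothesis mphi : @measurable_fun _ _ (measurableTypeR R) (measurableTypeR R) setT phi.
Hypothesis mdphi : @measurable_fun _ _ (measurableTypeR R) R setT dphi.

Let cphi x : a <= x <= b -> {for x, continuous phi}.
Proof.
move=> /dphiE dx; apply/differentiable_continuous/derivable1_diffP.
exact: ex_derive.
Qed.

Let cphiw c e : a <= c -> e <= b -> {within `[c, e], continuous phi}.
Proof.
move=> ac eb; apply: continuous_in_subspaceT => x.
rewrite inE/= in_itv/= => /andP[cx xe]; apply: cphi; lra.
Qed.

Let incr x y : a <= x -> y <= b -> x < y -> phi x < phi y.
Proof.
move=> ax yb xy.
have [z|z zxy] := @MVT _ phi dphi x y xy _ (cphiw ax yb).
  by rewrite in_itv/= => /andP[xz zy]; apply: dphiE; lra.
move: zxy; rewrite in_itv/= => /andP[xz zy].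
rewrite -subr_gt0 => ->; rewrite mulr_gt0 ?subr_gt0//; apply: dphi_gt0; lra.
Qed.

Let incrE x y : a <= x <= b -> a <= y <= b -> (phi x < phi y) = (x < y).
Proof.
move=> xab yab; have [xy|yx|->] := ltgtP x y; last by rewrite ltxx.
  by rewrite incr//; lra.
by apply/negbTE; rewrite -leNgt ltW// incr//; lra.
Qed.

Let FTC c e : a <= c -> e <= b -> c < e ->
  (\int[lambda]_(t in `]c, e]) (dphi t)%:E = (phi e - phi c)%:E)%E.
Proof.
move=> ac eb ce; rewrite integral_itv_obnd_cbnd; last first.
  by apply: (measurable_funS measurableT) => //; exact/measurable_EFinP.
rewrite (@continuous_FTC2 _ _ phi)// ?EFinB//.
- apply: continuous_subspaceW cdphi => x /=; rewrite !in_itv/=; lra.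
- split.
  + move=> x; rewrite in_itv/= => /andP[cx xe].
    by apply: (@ex_derive _ _ _ _ _ _ _ (dphiE _)); lra.
  + by apply: cvg_at_right_filter; apply: cphi; lra.
  + by apply: cvg_at_left_filter; apply: cphi; lra.
- move=> x; rewrite in_itv/= => /andP[cx xe].
  by rewrite derive1E; apply: (@derive_val _ _ _ _ _ _ _ (dphiE _)); lra.
Qed.

Let w (t : measurableTypeR R) : R := dphi t * \1_(`]a, b] : set R) t.
Let v (t : measurableTypeR R) : R := \1_(`]phi a, phi b] : set R) t.

Let mw : measurable_fun setT w.
Proof. by apply: measurable_funM => //; exact: measurable_indic. Qed.

Let w0 t : 0 <= w t.
Proof.
rewrite /w indicE; have [|_] := boolP (t \in _); last by rewrite mulr0.
by rewrite inE/= in_itv/= mulr1 => tab; rewrite ltW// dphi_gt0//; lra.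
Qed.

Let m1 := density_measure lambda mw w0.
Let phim : {mfun measurableTypeR R >-> measurableTypeR R} :=
  @mfun_Sub _ _ (measurableTypeR R) (measurableTypeR R) phi (mem_set mphi).
Let mD : measurable (~` `]phi a, phi b]%classic : set (measurableTypeR R)).
Proof. exact: measurableC. Qed.

Let weighted_indicE (A : set (measurableTypeR R)) :
  ((\int[lambda]_t ((\1_A (phi t))%:E * (w t)%:E)) = pushforward m1 phim A)%E.
Proof.
rewrite /pushforward /m1 /density_measure [RHS]integral_mkcond.
apply: eq_integral => t _; rewrite patchE indicE /preimage.
rewrite (_ : (t \in _) = (phi t \in A)); last by apply/idP/idP; rewrite !inE.
by case: (phi t \in A); rewrite ?mul1e ?mul0e.
Qed.

Let IVT_phi z : phi a <= z <= phi b -> exists2 x, a <= x <= b & phi x = z.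
Proof.
move=> zab; have [|x xab <-] := @IVT _ phi a b z (ltW ab) (cphiw (lexx _) (lexx _)).
  by rewrite minElt maxElt incrE ?lexx ?(ltW ab)// ab.
by exists x.
Qed.

Let push_oc (c e : R) : pushforward m1 phim `]c, e]%classic =
  lambda (`]c, e] `&` `]phi a, phi b])%classic.
Proof.
have pab : phi a < phi b by rewrite incrE ?lexx ?(ltW ab).
have wE (A : set (measurableTypeR R)) : (\int[lambda]_(t in A) (w t)%:E =
    \int[lambda]_(t in A `&` `]a, b]) (dphi t)%:E)%E.
  rewrite integral_mkcondr; apply: eq_integral => t _.
  by rewrite /w patchE indicE; case: (_ \in _); rewrite ?mulr1 ?mulr0.
rewrite /pushforward /m1 /density_measure wE.
pose c' := Order.max c (phi a); pose e' := Order.min e (phi b).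
have c'P x : (c' < x) = (c < x) && (phi a < x) by rewrite /c' gt_max.
have e'P x : (x <= e') = (x <= e) && (x <= phi b) by rewrite /e' le_min.
have -> : `]c, e] `&` `]phi a, phi b] = `]c', e']%classic.
  apply/seteqP; split => x /=; rewrite !in_itv/= c'P e'P.
    by move=> [/andP[-> ->] /andP[-> ->]].
  by move=> /andP[/andP[-> ->] /andP[-> ->]].
have [ce|ec] := ltP c' e'; last first.
  rewrite [X in lambda X](_ : _ = set0); last first.
    by apply/seteqP; split => // x/=; rewrite in_itv/=; lra.
  rewrite [X in integral _ X](_ : _ = set0) ?integral_set0 ?measure0//.
  apply/seteqP; split => // t [/=]; rewrite !in_itv/= => /andP[ct te] /andP[at_ tb].
  have h1 : phi a < phi t by rewrite incrE; lra.
  have h2 : phi t <= phi b by rewrite leNgt incrE; lra.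
  have : c' < phi t by rewrite c'P ct h1.
  have : phi t <= e' by rewrite e'P te h2.
  by lra.
have pac : phi a <= c' by rewrite /c' le_max lexx orbT.
have peb : e' <= phi b by rewrite /e' ge_min lexx orbT.
have [|al alab alE] := @IVT_phi c'; first lra.
have [|de deab deE] := @IVT_phi e'; first lra.
have alde : al < de by rewrite -incrE// alE deE.
rewrite [X in integral _ X](_ : _ = `]al, de]%classic); last first.
  apply/seteqP; split => [t [/=]|t /=]; rewrite !in_itv/=.
    move=> /andP[ct te] /andP[at_ tb].
    have tab : a <= t <= b by lra.
    have pt : phi a < phi t by rewrite incrE ?lexx// ltW.
    have ptb : phi t <= phi b by rewrite leNgt incrE ?lexx// ?(ltW ab) ?andbT ?(ltW ab)// -leNgt.
    rewrite -(incrE alab tab) leNgt -(incrE deab tab) -leNgt alE deE c'P e'P.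
    by rewrite ct te pt ptb.
  move=> /andP[lt_ td].
  have h1 : phi al < phi t by rewrite incrE; lra.
  have h2 : phi t <= phi de by rewrite leNgt incrE; lra.
  by move: h1 h2; rewrite alE deE c'P e'P; lra.
rewrite FTC; [|by case/andP: alab|by case/andP: deab|exact: alde].
rewrite alE deE.
by rewrite lebesgue_measure_itv/= lte_fin ce EFinB.
Qed.

(** By the uniqueness of the Lebesgue measure, it suffices to know the
    push-forward of the weight [dphi] on intervals, where it is the fundamental
    theorem. The function [f] is only measurable because it will be an integral over
    other variables. *)
Lemma change_of_variables (f : measurableTypeR R -> \bar R) :
  measurable_fun setT f -> (forall y, 0 <= f y)%E ->
  (\int[lambda]_t (f (phi t) * (dphi t * \1_(`]a, b] : set R) t)%:E) =
   \int[lambda]_y (f y * (\1_(`]phi a, phi b] : set R) y)%:E))%E.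
Proof.
move=> mf f0.
have mv : measurable_fun setT v by exact: measurable_indic.
have v0 t : 0 <= v t by rewrite /v indicE.
apply: (@eq_weighted_integral _ (measurableTypeR R) _ (measurableTypeR R) R
  lambda phi w lambda v mphi mw w0 mv v0 _ f mf f0).
move=> A mA; rewrite weighted_indicE.
pose I : set (measurableTypeR R) := `]phi a, phi b]%classic.
have mI : measurable I by exact: measurable_itv.
have mAI : measurable (A `&` I) by exact: measurableI.
have push_setI : pushforward m1 phim (A `&` I) = pushforward m1 phim A.
  rewrite /pushforward /m1 /density_measure integral_mkcond [RHS]integral_mkcond.
  apply: eq_integral => t _; rewrite !patchE /w indicE.
  have [|_] := boolP (t \in `]a, b]%classic); last by rewrite mulr0 !if_same.
  rewrite inE/= in_itv/= => tab.
  suff -> : (t \in phim @^-1` (A `&` I)) = (t \in phim @^-1` A) by [].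
  apply/idP/idP; rewrite !inE/=; first by case.
  move=> At; split => //; rewrite /I/= in_itv/=; apply/andP; split.
    by rewrite incrE; lra.
  by rewrite leNgt incrE; lra.
have intI : (\int[lambda]_t ((\1_A t)%:E * (v t)%:E) = lambda (A `&` I))%E.
  rewrite -(setIT (A `&` I)) -integral_indic//; apply: eq_integral => t _.
  by rewrite /v -EFinM indicI.
rewrite intI -push_setI.
pose P0 : {measure set (measurableTypeR R) -> \bar R} := pushforward m1 phim.
pose P := P0 mphi.
pose M : {measure set (measurableTypeR R) -> \bar R} := measure_add P (mrestr lambda mD).
have ME B : M B = (pushforward m1 phim B + lambda (B `&` ~` `]phi a, phi b]%classic))%E.
  exact: measure_addE.
have -> : lambda (A `&` I) = M (A `&` I).
  apply: (@lebesgue_measure_unique R M) => //.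
  move=> _ [[c e] _ <-]; rewrite ME [X in (X + _)%E]push_oc -measureU//.
  - by rewrite -setIUr setUv setIT.
  - exact: measurableI.
  - exact: measurableI.
  - by rewrite -setIIr setICr setI0.
by rewrite ME -setIA setICr setI0 measure0 adde0.
Qed.

End change_of_variables.

(** * Integrals over tuples *)

Section lebesgue_tuple_integral.
Context {R : realType}.
Local Notation RR := (measurableTypeR R).
Local Notation lambda := (@lebesgue_measure R).

Lemma integral_lebesgue_tupleS n (F : n.+1.-tuple RR -> \bar R) :
  measurable_fun setT F -> (forall t, 0 <= F t)%E ->
  (\int[lebesgue_tuple R n.+1]_t F t =
   \int[lambda]_x \int[lebesgue_tuple R n]_t F [tuple of x :: t])%E.
Proof.
move=> mF F0.
pose cp : {mfun (RR * n.-tuple RR)%type >-> n.+1.-tuple RR} :=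
  mfun_Sub (mem_set (@measurable_cons_pair _ RR n)).
have mcp := @measurable_cons_pair _ RR n.
pose P0 : {measure set (n.+1.-tuple RR) -> \bar R} :=
  pushforward (lambda \x lebesgue_tuple R n)%E cp.
rewrite (@eq_measure_integral _ _ _ _ (P0 mcp)); last first.
  by move=> A mA _.
rewrite ge0_integral_pushforward//=.
rewrite preimage_setT.
rewrite (fubini_tonelli1 (F \o cons_pair (n:=n)))//.
  by apply: measurableT_comp.
by move=> x; exact: F0.
Qed.

Lemma integral_lebesgue_tuple0 (F : 0.-tuple RR -> \bar R) :
  measurable_fun setT F -> (forall t, 0 <= F t)%E ->
  (\int[lebesgue_tuple R 0]_t F t = F [tuple])%E.
Proof. by move=> mF F0; rewrite integral_dirac// diracT mul1e. Qed.

Lemma measurable_fun_map_tuple n (phi : RR -> RR) : measurable_fun setT phi ->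
  measurable_fun setT (fun t : n.-tuple RR => [tuple of map phi t]).
Proof.
move=> mphi; apply/measurable_fun_tnthP => i.
rewrite (_ : _ \o _ = phi \o (fun t : n.-tuple RR => tnth t i)).
  by apply: measurableT_comp => //; exact: measurable_tnth.
by apply/funext => t /=; rewrite tnth_map.
Qed.

Lemma measurable_prod_tnth n (w : RR -> R) : measurable_fun setT w ->
  measurable_fun setT (fun t : n.-tuple RR => \prod_(i < n) w (tnth t i)).
Proof.
move=> mw; apply: measurable_prod => i _.
by apply: measurableT_comp => //; exact: measurable_tnth.
Qed.

Lemma measurable_cons_tuple n (x : RR) :
  measurable_fun setT (fun t : n.-tuple RR => [tuple of x :: t]).
Proof. by apply: (measurable_cons (@measurable_cst _ _ _ _ setT x) (@measurable_id _ _ setT)). Qed.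

(** Tonelli splits off one coordinate at a time; the substitution on the line is
    an arbitrary identity between weighted integrals, so that both the rescaling
    of an interval and the flow of a vector field are instances. *)
Lemma lebesgue_tuple_change_of_variables (phi : RR -> RR) (w v : RR -> R) :
  measurable_fun setT phi -> measurable_fun setT w -> (forall t, 0 <= w t) ->
  measurable_fun setT v -> (forall t, 0 <= v t) ->
  (forall f : RR -> \bar R, measurable_fun setT f -> (forall y, 0 <= f y)%E ->
    (\int[lambda]_t (f (phi t) * (w t)%:E) = \int[lambda]_y (f y * (v y)%:E))%E) ->
  forall n (F : n.-tuple RR -> \bar R), measurable_fun setT F ->
    (forall t, 0 <= F t)%E ->
  (\int[lebesgue_tuple R n]_t (F [tuple of map phi t] * (\prod_(i < n) w (tnth t i))%:E) =
   \int[lebesgue_tuple R n]_t (F t * (\prod_(i < n) v (tnth t i))%:E))%E.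
Proof.
move=> mphi mw w0 mv v0 H; elim=> [|n IH] F mF F0.
  rewrite !integral_lebesgue_tuple0//=.
  - by rewrite !big_ord0; congr (F _ * _)%E; exact: val_inj.
  - apply: emeasurable_funM => //; apply/measurable_EFinP.
    exact: measurable_prod_tnth.
  - by move=> t; rewrite mule_ge0// lee_fin prodr_ge0.
  - apply: emeasurable_funM => //; last by apply/measurable_EFinP; exact: measurable_prod_tnth.
    by apply: measurableT_comp => //; exact: measurable_fun_map_tuple.
  - by move=> t; rewrite mule_ge0// lee_fin prodr_ge0.
have mFphi k (G : k.-tuple RR -> \bar R) : measurable_fun setT G ->
    measurable_fun setT (fun t : k.-tuple RR => G [tuple of map phi t]).
  by move=> mG; apply: measurableT_comp => //; exact: measurable_fun_map_tuple.
have mG k (G : k.-tuple RR -> \bar R) (u : RR -> R) : measurable_fun setT u -> measurable_fun setT G ->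
    measurable_fun setT (fun t : k.-tuple RR => G t * (\prod_(i < k) u (tnth t i))%:E)%E.
  move=> mu_ mG; apply: emeasurable_funM => //.
  by apply/measurable_EFinP; exact: measurable_prod_tnth.
have mFc x : measurable_fun setT (fun t : n.-tuple RR => F [tuple of x :: t]).
  by apply: measurableT_comp => //; exact: measurable_cons_tuple.
rewrite integral_lebesgue_tupleS; last 2 first.
  by apply: mG => //; exact: mFphi.
  by move=> t; rewrite mule_ge0// lee_fin prodr_ge0.
rewrite integral_lebesgue_tupleS; last 2 first.
  by apply: mG.
  by move=> t; rewrite mule_ge0// lee_fin prodr_ge0.
pose K x := (\int[lebesgue_tuple R n]_t (F [tuple of x :: t] * (\prod_(i < n) v (tnth t i))%:E))%E.
have K0 x : (0 <= K x)%E.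
  by apply: integral_ge0 => t _; rewrite mule_ge0// lee_fin prodr_ge0.
have mK : measurable_fun setT K.
  pose F2 (p : (RR * n.-tuple RR)%type) := (F [tuple of p.1 :: p.2] * (\prod_(i < n) v (tnth p.2 i))%:E)%E.
  apply: (measurable_fun_fubini_tonelli_F F2) => //.
  - apply: emeasurable_funM.
      by apply: measurableT_comp => //; exact: measurable_cons_pair.
    apply/measurable_EFinP.
    by apply: (measurableT_comp (measurable_prod_tnth mv)).
  - by move=> p; rewrite mule_ge0// lee_fin prodr_ge0.
transitivity (\int[lambda]_x (K (phi x) * (w x)%:E))%E.
  apply: eq_integral => x _; rewrite /K -IH//.
  rewrite muleC -ge0_integralZl_EFin//.
  - apply: eq_integral => t _; rewrite big_ord_recl tnth0.
    under eq_bigr do rewrite tnthS.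
    rewrite EFinM muleCA; congr (_ * (F _ * _))%E.
    exact: val_inj.
  - by move=> t _; rewrite mule_ge0// lee_fin prodr_ge0.
  - by apply: mG => //; apply: (mFphi n (fun t => F [tuple of phi x :: t])).
rewrite H//; apply: eq_integral => x _.
rewrite /K muleC -ge0_integralZl_EFin//.
- apply: eq_integral => t _; rewrite big_ord_recl tnth0.
  under [in RHS]eq_bigr do rewrite tnthS.
  by rewrite EFinM muleCA.
- by move=> t _; rewrite mule_ge0// lee_fin prodr_ge0.
- exact: mG.
Qed.

Lemma integral_lebesgue_tuple_prod (w : RR -> R) n :
  measurable_fun setT w -> (forall t, 0 <= w t) ->
  (\int[lebesgue_tuple R n]_t (\prod_(i < n) w (tnth t i))%:E =
   (\int[lambda]_x (w x)%:E) ^+ n)%E.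
Proof.
move=> mw w0; elim: n => [|n IH].
  rewrite integral_lebesgue_tuple0//=; first by rewrite big_ord0.
  - by apply/measurable_EFinP; exact: measurable_prod_tnth.
  - by move=> t; rewrite lee_fin prodr_ge0.
rewrite integral_lebesgue_tupleS; last 2 first.
  - by apply/measurable_EFinP; exact: measurable_prod_tnth.
  - by move=> t; rewrite lee_fin prodr_ge0.
rewrite expeS -ge0_integralZr//; last 3 first.
- exact/measurable_EFinP.
- by move=> *; rewrite lee_fin.
- by rewrite -IH integral_ge0// => t _; rewrite lee_fin prodr_ge0.
apply: eq_integral => x _; rewrite -IH -ge0_integralZl_EFin//.
- apply: eq_integral => t _; rewrite big_ord_recl tnth0 -EFinM.
  by under eq_bigr do rewrite tnthS.
- by move=> t _; rewrite lee_fin prodr_ge0.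
- by apply/measurable_EFinP; exact: measurable_prod_tnth.
Qed.

End lebesgue_tuple_integral.

(** * Improper integrals by the fundamental theorem *)

Section fundamental_theorem.
Context {R : realType}.
Implicit Types (f F : R -> R) (x l a b : R).
Notation lambda := (@lebesgue_measure R).

Lemma is_derive1_continuous F x l : is_derive x 1 F l -> {for x, continuous F}.
Proof.
by move=> dF; apply/differentiable_continuous/derivable1_diffP; exact: ex_derive.
Qed.

Lemma FTC_segment f F a b : a < b ->
  (forall x, a <= x <= b -> is_derive x 1 F (f x)) ->
  (forall x, a <= x <= b -> {for x, continuous f}) ->
  (\int[lambda]_(x in `[a, b]) (f x)%:E = (F b - F a)%:E)%E.
Proof.
move=> ab dF cf; rewrite (@continuous_FTC2 _ _ F)// ?EFinB//.
- by apply: continuous_in_subspaceT => x; rewrite inE/= in_itv/=; exact: cf.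
- split.
  + by move=> x; rewrite in_itv/= => xab; apply: (@ex_derive _ _ _ _ _ _ _ (dF x _)); lra.
  + by apply: cvg_at_right_filter; apply: is_derive1_continuous (dF a _); lra.
  + by apply: cvg_at_left_filter; apply: is_derive1_continuous (dF b _); lra.
- move=> x; rewrite in_itv/= => xab.
  by rewrite derive1E; apply: (@derive_val _ _ _ _ _ _ _ (dF x _)); lra.
Qed.

(** The integrand may blow up at the ends of [D]: integrate over growing segments
    inside [D] and pass to the limit by monotone convergence. *)
Lemma ge0_FTC_exhaust f F (a b : nat -> R) (D : set (measurableTypeR R)) l :
  (forall n, a n < b n) -> (forall n, a n.+1 <= a n) -> (forall n, b n <= b n.+1) ->
  (forall x, D x <-> exists n, a n <= x <= b n) ->
  (forall x, D x -> 0 <= f x) ->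
  (forall x, D x -> is_derive x 1 F (f x)) ->
  (forall x, D x -> {for x, continuous f}) ->
  F (b n) - F (a n) @[n --> \oo] --> l ->
  measurable_fun D f /\ (\int[lambda]_(x in D) (f x)%:E = l%:E)%E.
Proof.
move=> ab decra incrb DE f0 dF cf Fl.
pose I n : set (measurableTypeR R) := `[a n, b n]%classic.
have DI : D = \bigcup_n I n.
  apply/seteqP; split => x.
    by move=> /DE[n nx]; exists n => //; rewrite /I/= in_itv.
  by move=> [n _]; rewrite /I/= in_itv/= => nx; apply/DE; exists n.
have ID n x : a n <= x <= b n -> D x by move=> nx; apply/DE; exists n.
have mI n : measurable (I n) by exact: measurable_itv.
have mf n : measurable_fun (I n) f.
  have : {within `[a n, b n], continuous f}.
    by apply: continuous_in_subspaceT => x; rewrite inE/= in_itv/= => /ID; exact: cf.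
  by apply: subspace_continuous_measurable_fun; exact: measurable_itv.
have mfD : measurable_fun D f.
  by rewrite DI; apply/measurable_fun_bigcup.
split=> //; rewrite DI.
have ndI : nondecreasing_seq I.
  apply/nondecreasing_seqP => n; apply/subsetPset => x; rewrite /I/= !in_itv/= => /andP[ax xb].
  by rewrite (le_trans (decra n))//= (le_trans xb).
have := @ge0_nondecreasing_set_cvg_integral _ _ _ I (EFin \o f) lambda ndI mI.
move=> /(_ (fun n => (measurable_EFinP _ _).2 (mf n))).
move=> /(_ ltac:(by move=> n x; rewrite /I/= in_itv/= => /ID xD; rewrite lee_fin f0)).
have -> : (fun n => \int[lambda]_(x in I n) (EFin \o f) x)%E = (fun n => (F (b n) - F (a n))%:E).
  apply/funext => n; apply: FTC_segment => // x /ID xD; [exact: dF|exact: cf].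
move=> cI; apply: (cvg_unique _ cI) => //.
by apply: cvg_EFin => //; exact: nearW.
Qed.

Lemma powR_cvg0_seq (u : nat -> R) (r : R) : 0 < r -> (forall n, 0 <= u n) ->
  u @ \oo --> (0 : R) -> u n `^ r @[n --> \oo] --> (0 : R).
Proof.
move=> r0 u0 cu; apply/cvgrPdist_lt => e e0.
have /cvgrPdist_lt /(_ _ (powR_gt0 r^-1 e0)) := cu.
apply: filterS => n; rewrite !sub0r !normrN !ger0_norm ?powR_ge0// => H.
have := @gt0_ltr_powR _ r r0 _ _ _ _ H; rewrite -powRrM mulVf ?gt_eqF// powRr1 ?ltW//.
by apply; rewrite nnegrE ?powR_ge0.
Qed.

(** For [q < 1] the integrand is unbounded at 1; it dominates each coordinate of
    the Jacobi kernel. *)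
Lemma integral_onem_powR (q : R) : 0 < q ->
  (\int[lambda]_(t in `]0%R, 1%R]) ((1 - t) `^ (q - 1))%:E = q^-1%:E)%E.
Proof.
move=> q0.
have cv0 : (fun n => n.+2%:R^-1 : R) @ \oo --> 0.
  by have := @cvg_harmonic R; rewrite -cvg_shiftS.
have decr n : (n.+3%:R^-1 : R) <= n.+2%:R^-1 by rewrite lef_pV2 ?posrE ?ltr0n// ler_nat.
have dF (x : R) : 0 < x < 1 ->
    is_derive x (1 : R) (fun t => - (q^-1 * (1 - t) `^ q)) ((1 - x) `^ (q - 1)).
  move=> x01.
  have h : is_derive x (1:R) (fun t : R => 1 - t) (- 1).
    by apply: is_derive_eq; ring.
  have x1 : 0 < 1 - x by lra.
  have h2 := @is_derive1_comp _ (fun t : R => t `^ q) _ x _ _ (@is_derive1_powR R q _ x1) h.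
  rewrite (_ : (fun t => _) = - (q^-1 \*: ((fun t : R => t `^ q) \o (fun t => 1 - t)))); last by [].
  apply: is_derive_eq; rewrite /GRing.scale/= mulrN1 mulrN opprK mulrA mulVf ?mul1r//.
  by rewrite gt_eqF.
have cf (x : R) : 0 < x < 1 -> {for x, continuous (fun t : R => (1 - t) `^ (q - 1))}.
  move=> x01; have x1 : 0 < 1 - x by lra.
  apply: (@continuous_comp _ _ _ (fun t : R => 1 - t) (fun t => t `^ (q - 1))).
    by apply: continuousB => //; exact: cst_continuous.
  exact: is_derive1_continuous (@is_derive1_powR R _ _ x1).
have n3 n : 0 < (n.+3%:R^-1 : R) <= 1 / 3.
  by rewrite invr_gt0 ltr0n/= div1r lef_pV2 ?posrE ?ltr0n// ler_nat.
have DE (x : R) : (`]0, 1[%classic : set R) x <-> exists n, n.+3%:R^-1 <= x <= 1 - n.+3%:R^-1.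
  rewrite /= in_itv/=; split => [/andP[x0 x1]|[n]]; last first.
    by move: (n3 n); move: (_^-1) => z; lra.
  pose m := Num.min x (1 - x).
  have m0 : 0 < m by rewrite /m lt_min x0 subr_gt0.
  have [N _ HN] : \forall n \near \oo, (n.+2%:R^-1 : R) < m.
    by move/cvgrPdist_lt : cv0 => /(_ _ m0); apply: filterS => n; rewrite sub0r normrN gtr0_norm// invr_gt0.
  by exists N; move: (HN N.+1 (leqnSn N)); rewrite lt_min; move: (_^-1) => z; lra.
have cv1 : (fun n => - (q^-1 * (1 - (1 - n.+3%:R^-1)) `^ q) - - (q^-1 * (1 - n.+3%:R^-1) `^ q)) @ \oo --> q^-1.
  have c0 : (fun n => n.+3%:R^-1 : R) @ \oo --> 0 by move: cv0; rewrite -cvg_shiftS.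
  have c1 : (fun n => n.+3%:R^-1 `^ q) @ \oo --> (0 : R) by exact: powR_cvg0_seq.
  have c2 : (fun n => (1 - n.+3%:R^-1) `^ q) @ \oo --> (1 : R).
    have h1 : (fun n => 1 - n.+3%:R^-1 : R) @ \oo --> (1 : R).
      by rewrite -[X in _ --> X]subr0; apply: cvgB => //; exact: cvg_cst.
    have h2 := is_derive1_continuous (@is_derive1_powR R q _ ltr01).
    by have := cvg_comp _ _ h1 h2; rewrite powR1.
  rewrite [X in _ --> X](_ : _ = - (q^-1 * 0) - - (q^-1 * 1)); last by ring.
  under eq_fun do rewrite subKr.
  by apply: cvgB; apply: cvgN; apply: cvgM => //; exact: cvg_cst.
have ab n : (n.+3%:R^-1 : R) < 1 - n.+3%:R^-1 by move: (n3 n); move: (n.+3%:R^-1) => z; lra.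
have incrb n : 1 - (n.+3%:R^-1 : R) <= 1 - n.+4%:R^-1.
  by move: (decr n.+1); rewrite lerD2l lerN2.
have [mf intE] := @ge0_FTC_exhaust (fun t => (1 - t) `^ (q - 1))
   (fun t => - (q^-1 * (1 - t) `^ q)) (fun n => n.+3%:R^-1) (fun n => 1 - n.+3%:R^-1) `]0, 1[%classic q^-1
   ab (fun n => decr n.+1) incrb
   DE (fun x _ => powR_ge0 _ _) dF cf cv1.
by rewrite -integral_itv_bndo_bndc; [exact: intE|exact/measurable_EFinP].
Qed.

End fundamental_theorem.

(** * The Jacobi kernel on the unit cube *)

Section jacobi_kernel.
Context {R : realType}.
Local Notation RR := (measurableTypeR R).
Local Notation lambda := (@lebesgue_measure R).

(** Half-open sides match the half-open intervals of [change_of_variables]. *)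
Definition cube m : set (m.-tuple RR) := [set t | forall i, 0 < tnth t i <= 1].
Arguments cube : clear implicits.

Lemma indic_cube m (t : m.-tuple RR) :
  \1_(cube m) t = \prod_(i < m) \1_(`]0, 1] : set R) (tnth t i) :> R.
Proof.
rewrite indicE; have [|] := boolP (t \in cube m); rewrite ?inE ?notin_setE => tc.
  rewrite big1// => i _; rewrite indicE mem_set//= in_itv/=; exact: tc.
have /existsNP[i Hi] := tc.
rewrite (bigD1 i)//= indicE memNset ?mul0r//= in_itv/=; exact/negP/negP.
Qed.

Lemma measurable_cube m : measurable (cube m).
Proof.
have -> : cube m = \big[setI/setT]_(i < m) ((fun t : m.-tuple RR => tnth t i) @^-1` `]0%R, 1%R]).
  rewrite -bigcap_seq; apply/seteqP; split => t /=.
    by move=> H i _ /=; rewrite in_itv/=; exact: H.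
  by move=> H i; have := H i; rewrite /= in_itv/= mem_index_enum; exact.
apply: bigsetI_measurable => i _; rewrite -[X in measurable X]setTI.
exact: measurable_tnth.
Qed.

Lemma integral_cube m (F : m.-tuple RR -> \bar R) :
  (\int[lebesgue_tuple R m]_(t in cube m) F t =
   \int[lebesgue_tuple R m]_t (F t * (\prod_(i < m) \1_(`]0%R, 1%R] : set R) (tnth t i))%:E))%E.
Proof.
rewrite integral_mkcond; apply: eq_integral => t _.
by rewrite -indic_cube patchE indicE; case: (_ \in _); rewrite ?mule1 ?mule0.
Qed.

(** The parametrization of Selberg's integral: [p] and [q] are the exponents at 0
    and 1 and [k] is half of the Dyson index. *)
Definition jacobi_kernel (p q k : R) m (t : m.-tuple RR) : R :=
  (\prod_(i < m) (tnth t i `^ (p - 1) * (1 - tnth t i) `^ (q - 1))) *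
  \prod_(i < m) \prod_(j < m | (i < j)%N) `|tnth t i - tnth t j| `^ (2 * k).

Lemma measurable_fun_tnth m (i : 'I_m) : measurable_fun setT (fun t : m.-tuple RR => tnth t i : R).
Proof. exact: measurable_tnth. Qed.

Lemma measurable_jacobi_kernel p q k m : measurable_fun setT (@jacobi_kernel p q k m).
Proof.
have mt := @measurable_fun_tnth m.
apply: measurable_funM.
  apply: measurable_prod => i _; apply: measurable_funM.
    exact: (measurableT_comp (measurable_powR _) (mt i)).
  apply: (measurableT_comp (measurable_powR _)).
  by apply: measurable_funB => //; exact: mt.
apply: measurable_prod => i _.
rewrite [X in measurable_fun _ X](_ : _ = fun t : m.-tuple RR => \prod_(j <- [seq j : 'I_m <- index_enum _ | (i < j)%N])
    `|tnth t i - tnth t j| `^ (2 * k)); last first.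
  by apply/funext => t; rewrite big_filter.
apply: measurable_prod => j _.
apply: (measurableT_comp (measurable_powR _)).
by apply: measurableT_comp => //; apply: measurable_funB; exact: mt.
Qed.

Lemma jacobi_kernel_ge0 p q k m t : 0 <= @jacobi_kernel p q k m t.
Proof.
by rewrite mulr_ge0//; apply: prodr_ge0 => i _; rewrite ?mulr_ge0 ?powR_ge0// prodr_ge0// => *; exact: powR_ge0.
Qed.

Lemma powR_le1 (x r : R) : 0 <= x <= 1 -> 0 <= r -> x `^ r <= 1.
Proof.
move=> /andP[x0 x1] r0.
by apply: le_trans (ge0_ler_powR r0 _ _ x1) _; rewrite ?nnegrE ?powR1.
Qed.

Lemma integrable_jacobi_kernel p q k m : 1 <= p -> 0 < q -> 0 <= k ->
  (lebesgue_tuple R m).-integrable (cube m) (EFin \o @jacobi_kernel p q k m).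
Proof.
move=> p1 q0 k0.
pose w (t : RR) : R := \1_(`]0, 1] : set R) t * (1 - t) `^ (q - 1).
have mw : measurable_fun setT w.
  apply: measurable_funM; first exact: measurable_indic.
  by apply: (measurableT_comp (measurable_powR _)); exact: measurable_funB.
have w0 t : 0 <= w t by rewrite mulr_ge0 ?powR_ge0// indicE.
have mc := @measurable_cube m.
apply: (@le_integrable _ _ _ _ _ mc _ (fun t => (\prod_(i < m) w (tnth t i))%:E)).
- apply/measurable_EFinP; apply: (measurable_funS measurableT) => //.
  exact: measurable_jacobi_kernel.
- move=> t tc /=; rewrite lee_fin !ger0_norm ?jacobi_kernel_ge0 ?prodr_ge0//.
  rewrite -[leRHS]mulr1; apply: ler_pM.
  + by apply: prodr_ge0 => i _; rewrite mulr_ge0 ?powR_ge0.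
  + by apply: prodr_ge0 => i _; apply: prodr_ge0 => j _; exact: powR_ge0.
  + apply: ler_prod => i _; rewrite mulr_ge0 ?powR_ge0//= /w indicE mem_set ?mul1r; last first.
      by rewrite /= in_itv/=; exact: tc.
    have /andP[t0 t1] := tc i.
    by rewrite -[leRHS]mul1r ler_wpM2r ?powR_ge0//; apply: powR_le1; rewrite ?subr_ge0// t1 ltW.
  + apply: prodr_ile1 => i _; rewrite prodr_ge0/=; last by move=> *; exact: powR_ge0.
    apply: prodr_ile1 => j _; rewrite powR_ge0/= powR_le1 ?mulr_ge0// normr_ge0/=.
    by have := tc i; have := tc j; rewrite ler_norml; lra.
- apply: (integrableS measurableT) => //.
  have mP := @measurable_prod_tnth R m w mw.
  apply/integrableP; split; first exact/measurable_EFinP.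
  under eq_integral do rewrite /= ger0_norm ?prodr_ge0//.
  rewrite integral_lebesgue_tuple_prod//.
  have -> : (\int[lambda]_x (w x)%:E = q^-1%:E)%E.
    rewrite -(integral_onem_powR q0) [RHS]integral_mkcond; apply: eq_integral => t _.
    by rewrite /w patchE indicE; case: (_ \in _); rewrite ?mul1r ?mul0r.
  by rewrite -EFin_expe ltry.
Qed.

End jacobi_kernel.
Arguments cube {R} m.

(** * Averages of a shifted product and their derivatives *)

Section shifted_average.
Context {R : realType}.
Local Notation RR := (measurableTypeR R).
Variables (p q k : R) (m : nat).
Hypotheses (p1 : 1 <= p) (q0 : 0 < q) (k0 : 0 <= k).
Implicit Types s h : R.

Definition shift_inv (s : R) (i : 'I_m) (t : m.-tuple RR) : R := (tnth t i + s)^-1.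
Definition shift_prod (s : R) (t : m.-tuple RR) : R := \prod_(i < m) (tnth t i + s) `^ (- k).
Definition power_sum1 (s : R) (t : m.-tuple RR) : R := \sum_(i < m) shift_inv s i t.
Definition power_sum2 (s : R) (t : m.-tuple RR) : R := \sum_(i < m) shift_inv s i t ^+ 2.

(** The first derivatives in [s] of the average of [shift_prod] are again averages,
    of the power sums of the [shift_inv]; this is what makes a differential
    equation possible. *)
Definition shifted_average (s : R) (g : m.-tuple RR -> R) : R :=
  \int[lebesgue_tuple R m]_(t in cube m) (jacobi_kernel p q k t * (shift_prod s t * g t)).

Lemma shift_inv_bound s i t : 0 < s -> cube m t -> 0 < shift_inv s i t <= s^-1.
Proof.
move=> s0 tc; have /andP[t0 t1] := tc i.
by rewrite invr_gt0 addr_gt0//= lef_pV2 ?posrE ?addr_gt0//; lra.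
Qed.

Lemma measurable_shift_inv s i : 0 < s -> measurable_fun (cube m) (shift_inv s i).
Proof.
move=> s0; apply: (@eq_measurable_fun _ _ _ _ _ (fun t : m.-tuple RR => (tnth t i + s) `^ (-1))).
  move=> t; rewrite inE => tc; rewrite powR_inv1//.
  by have /andP[t0 _] := tc i; rewrite addr_ge0// ltW.
apply: (measurable_funS measurableT) => //.
apply: (measurableT_comp (measurable_powR _)).
by apply: measurable_funD => //; exact: measurable_fun_tnth.
Qed.

Lemma measurable_shift_prod s : measurable_fun setT (shift_prod s).
Proof.
apply: measurable_prod => i _; apply: (measurableT_comp (measurable_powR _)).
by apply: measurable_funD => //; exact: measurable_fun_tnth.
Qed.

Lemma shift_prod_ge0 s t : 0 <= shift_prod s t.
Proof. by apply: prodr_ge0 => i _; exact: powR_ge0. Qed.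

Lemma shift_prod_le s t : 0 < s -> cube m t -> shift_prod s t <= (s `^ (- k)) ^+ m.
Proof.
move=> s0 tc; rewrite -[X in _ ^+ X]card_ord -prodr_const.
apply: ler_prod => i _; rewrite powR_ge0/= !powRN.
have /andP[t0 t1] := tc i.
rewrite lef_pV2 ?posrE ?powR_gt0// ?addr_gt0//.
by apply: ge0_ler_powR => //; rewrite ?nnegrE; lra.
Qed.

Lemma measurable_power_sum1 s : 0 < s -> measurable_fun (cube m) (power_sum1 s).
Proof. by move=> s0; apply: measurable_sum => i; exact: measurable_shift_inv. Qed.

Lemma measurable_power_sum2 s : 0 < s -> measurable_fun (cube m) (power_sum2 s).
Proof.
by move=> s0; apply: measurable_sum => i; apply: measurable_funX; exact: measurable_shift_inv.
Qed.

Lemma power_sum1_bound s t : 0 < s -> cube m t -> 0 <= power_sum1 s t <= m%:R / s.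
Proof.
move=> s0 tc; rewrite sumr_ge0/=; last first.
  by move=> i _; have /andP[/ltW] := @shift_inv_bound s i t s0 tc.
rewrite mulr_natl -[X in _ *+ X]card_ord -sumr_const.
by apply: ler_sum => i _; have /andP[] := @shift_inv_bound s i t s0 tc.
Qed.

Lemma power_sum2_bound s t : 0 < s -> cube m t -> 0 <= power_sum2 s t <= m%:R / s ^+ 2.
Proof.
move=> s0 tc; rewrite sumr_ge0/=; last by move=> i _; exact: sqr_ge0.
rewrite mulr_natl -[X in _ *+ X]card_ord -sumr_const.
apply: ler_sum => i _; have /andP[u0 u1] := @shift_inv_bound s i t s0 tc.
by rewrite -exprVn ler_pXn2r// nnegrE ltW// invr_gt0.
Qed.

Let mc := @measurable_cube R m.

Lemma integrable_shifted_average s (g : m.-tuple RR -> R) (B : R) : 0 < s ->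
  measurable_fun (cube m) g -> (forall t, cube m t -> `|g t| <= B) ->
  (lebesgue_tuple R m).-integrable (cube m)
    (EFin \o (fun t => jacobi_kernel p q k t * (shift_prod s t * g t))).
Proof.
move=> s0 mg gB.
apply: (integrable_bounded_mul mc (integrable_jacobi_kernel m p1 q0 k0) (B := (s `^ (- k)) ^+ m * B)).
  apply: measurable_funM => //; apply: (measurable_funS measurableT) => //.
  exact: measurable_shift_prod.
move=> t tc; rewrite normrM ler_pM//; last exact: gB.
by rewrite ger0_norm ?shift_prod_ge0// shift_prod_le.
Qed.

Lemma integrable_shift_prod s : 0 < s ->
  (lebesgue_tuple R m).-integrable (cube m)
    (EFin \o (fun t => jacobi_kernel p q k t * (shift_prod s t * 1))).
Proof.
by move=> s0; apply: (@integrable_shifted_average _ (fun=> 1) 1) => // t _; rewrite normr1.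
Qed.

Lemma integrable_power_sum1 s : 0 < s ->
  (lebesgue_tuple R m).-integrable (cube m)
    (EFin \o (fun t => jacobi_kernel p q k t * (shift_prod s t * power_sum1 s t))).
Proof.
move=> s0; apply: (@integrable_shifted_average _ _ (m%:R / s)) => //.
  exact: measurable_power_sum1.
by move=> t tc; have /andP[u0 u1] := power_sum1_bound s0 tc; rewrite ger0_norm.
Qed.

Lemma integrable_power_sum2 s : 0 < s ->
  (lebesgue_tuple R m).-integrable (cube m)
    (EFin \o (fun t => jacobi_kernel p q k t *
      (shift_prod s t * (power_sum2 s t + k * power_sum1 s t ^+ 2)))).
Proof.
move=> s0; apply: (@integrable_shifted_average _ _ (m%:R / s ^+ 2 + k * (m%:R / s) ^+ 2)) => //.
  apply: measurable_funD; first exact: measurable_power_sum2.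
  by apply: measurable_funM => //; apply: measurable_funX; exact: measurable_power_sum1.
move=> t tc; have /andP[u0 u1] := power_sum1_bound s0 tc.
have /andP[v0 v1] := power_sum2_bound s0 tc.
rewrite ger0_norm; last by rewrite addr_ge0// mulr_ge0// sqr_ge0.
by rewrite lerD// ler_wpM2l// ler_pXn2r// nnegrE (le_trans u0).
Qed.

Lemma shift_prodD s h t : 0 < s -> `|h| <= s -> cube m t ->
  shift_prod (s + h) t = shift_prod s t * \prod_(i < m) (1 + h * shift_inv s i t) `^ (- k).
Proof.
move=> s0 hs tc; rewrite -big_split; apply: eq_bigr => i _ /=.
have /andP[t0 t1] := tc i; move: hs; rewrite ler_norml => /andP[h1 h2].
have ts : 0 < tnth t i + s by rewrite addr_gt0.
have E : 1 + h * shift_inv s i t = (tnth t i + (s + h)) / (tnth t i + s).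
  by rewrite /shift_inv; field; rewrite gt_eqF.
rewrite -powRM; first by rewrite E mulrC divfK ?gt_eqF.
- exact: ltW.
- by rewrite E divr_ge0 ?(ltW ts)//; lra.
Qed.

Lemma shift_invD s h i t : 0 < s -> `|h| <= s -> cube m t ->
  shift_inv (s + h) i t = shift_inv s i t * (1 + h * shift_inv s i t) `^ (-1).
Proof.
move=> s0 hs tc.
have /andP[t0 t1] := tc i; move: hs; rewrite ler_norml => /andP[h1 h2].
have ts : 0 < tnth t i + s by rewrite addr_gt0.
have ths : 0 < tnth t i + (s + h) by lra.
have E : 1 + h * shift_inv s i t = (tnth t i + (s + h)) / (tnth t i + s).
  by rewrite /shift_inv; field; rewrite gt_eqF.
rewrite E powR_inv1; last by rewrite divr_ge0 ?ltW.
by rewrite /shift_inv; field; rewrite !gt_eqF.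
Qed.

Let fo_prod s : 0 < s ->
  first_order (cube m) (fun h t => shift_prod s t * \prod_(i < m) (1 + h * shift_inv s i t) `^ (- k))
    (fun t => shift_prod s t * 1)
    (fun t => 0 * 1 + shift_prod s t * \sum_(i < m) (- k * shift_inv s i t)).
Proof.
move=> s0; apply: first_orderM.
  apply: (@first_order_cst _ _ _ _ ((s `^ (- k)) ^+ m)) => t tc.
  by rewrite ger0_norm ?shift_prod_ge0// shift_prod_le.
apply: first_order_prod1 => i _; apply: (@first_order_powR _ _ _ _ s^-1) => t tc.
by have /andP[u0 u1] := @shift_inv_bound s i t s0 tc; rewrite ger0_norm// ltW.
Qed.

Let mprod s h : 0 < s ->
  measurable_fun (cube m) (fun t => shift_prod s t * \prod_(i < m) (1 + h * shift_inv s i t) `^ (- k)).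
Proof.
move=> s0; apply: measurable_funM.
  by apply: (measurable_funS measurableT) => //; exact: measurable_shift_prod.
apply: measurable_prod => i _; apply: (measurableT_comp (measurable_powR _)).
by apply: measurable_funD => //; apply: measurable_funM => //; exact: measurable_shift_inv.
Qed.

Let mS s : measurable_fun (cube m) (shift_prod s).
Proof. by apply: (measurable_funS measurableT) => //; exact: measurable_shift_prod. Qed.

(** [shift_prod] changes by a product of factors [1 + h / (t_i + s)], which is
    expanded to first order uniformly on the cube. *)
Lemma is_derive_shifted_average s : 0 < s ->
  is_derive s (1 : R) (fun s => shifted_average s (fun=> 1)) (- k * shifted_average s (power_sum1 s)).
Proof.
move=> s0.
have [| | |C [d [d0 H]]] := first_order_integral mc (integrable_jacobi_kernel m p1 q0 k0) (fo_prod s0).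
- by move=> h; exact: mprod.
- by apply: measurable_funM.
- apply: measurable_funD; first exact: measurable_cst.
  apply: measurable_funM => //; apply: measurable_sum => i; apply: measurable_funM => //.
  exact: measurable_shift_inv.
apply: (@is_derive1_quadratic _ _ _ _ C (Num.min d s)); first by rewrite lt_min d0.
move=> h; rewrite le_min => /andP[hd hs].
have := H h hd; congr (`|_ - _ - _| <= _).
- apply: eq_Rintegral => t; rewrite inE => tc.
  by rewrite shift_prodD// mulr1.
- congr (h * _); rewrite -RintegralZl//; last exact: integrable_power_sum1.
  apply: eq_Rintegral => t _; rewrite mul0r add0r -mulr_sumr -/(power_sum1 s t); ring.
Qed.

Lemma is_derive_shifted_average_power_sum1 s : 0 < s ->
  is_derive s (1 : R) (fun s => shifted_average s (power_sum1 s))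
    (- shifted_average s (fun t => power_sum2 s t + k * power_sum1 s t ^+ 2)).
Proof.
move=> s0.
have foS : first_order (cube m)
    (fun h t => \sum_(i < m) (shift_inv s i t * (1 + h * shift_inv s i t) `^ (-1)))
    (fun t => \sum_(i < m) (shift_inv s i t * 1))
    (fun t => \sum_(i < m) (0 * 1 + shift_inv s i t * (-1 * shift_inv s i t))).
  apply: first_order_sum => i _.
  have ub t : cube m t -> `|shift_inv s i t| <= s^-1.
    by move=> tc; have /andP[u0 u1] := @shift_inv_bound s i t s0 tc; rewrite ger0_norm// ltW.
  by apply: first_orderM; [exact: first_order_cst ub|exact: first_order_powR ub].
have [| | |C [d [d0 H]]] := first_order_integral mc (integrable_jacobi_kernel m p1 q0 k0)
  (first_orderM (fo_prod s0) foS).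
- move=> h; apply: measurable_funM; first exact: mprod.
  apply: measurable_sum => i; apply: measurable_funM; first exact: measurable_shift_inv.
  apply: (measurableT_comp (measurable_powR _)).
  by apply: measurable_funD => //; apply: measurable_funM => //; exact: measurable_shift_inv.
- apply: measurable_funM; first exact: measurable_funM.
  by apply: measurable_sum => i; apply: measurable_funM => //; exact: measurable_shift_inv.
- apply: measurable_funD; apply: measurable_funM.
  + apply: measurable_funD; first exact: measurable_cst.
    apply: measurable_funM => //; apply: measurable_sum => i; apply: measurable_funM => //.
    exact: measurable_shift_inv.
  + by apply: measurable_sum => i; apply: measurable_funM => //; exact: measurable_shift_inv.
  + exact: measurable_funM.
  + apply: measurable_sum => i; apply: measurable_funD; first exact: measurable_cst.
    by apply: measurable_funM; [|apply: measurable_funM => //]; exact: measurable_shift_inv.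
apply: (@is_derive1_quadratic _ _ _ _ C (Num.min d s)); first by rewrite lt_min d0.
move=> h; rewrite le_min => /andP[hd hs].
have := H h hd; congr (`|_ - _ - _| <= _).
- apply: eq_Rintegral => t; rewrite inE => tc.
  rewrite shift_prodD//; congr (_ * (_ * _)).
  by apply: eq_bigr => i _; rewrite shift_invD.
- apply: eq_Rintegral => t _; rewrite mulr1; congr (_ * (_ * _)).
  by apply: eq_bigr => i _; rewrite mulr1.
- congr (h * _); rewrite -[RHS]mulN1r -RintegralZl//; last exact: integrable_power_sum2.
  apply: eq_Rintegral => t _.
  have -> : \sum_(i < m) (0 * 1 + shift_inv s i t * (-1 * shift_inv s i t)) = - power_sum2 s t.
    by rewrite /power_sum2 -sumrN; apply: eq_bigr => i _; ring.
  have -> : \sum_(i < m) shift_inv s i t * 1 = power_sum1 s t.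
    by rewrite /power_sum1; apply: eq_bigr => i _; rewrite mulr1.
  rewrite -mulr_sumr -/(power_sum1 s t); ring.
Qed.

End shifted_average.

(** * The loop equation *)

Lemma sum_symmetric {R : realType} m (f : 'I_m -> 'I_m -> R) : (forall i j, f i j = f j i) ->
  \sum_(i < m) \sum_(j < m) f i j =
  \sum_(i < m) f i i + 2 * \sum_(i < m) \sum_(j < m | (i < j)%N) f i j.
Proof.
move=> fC.
have split_i (i : 'I_m) : \sum_(j < m) f i j =
    f i i + \sum_(j < m | (i < j)%N) f i j + \sum_(j < m | (j < i)%N) f i j.
  rewrite (bigID (fun j : 'I_m => (i < j)%N))/= [X in _ + X](bigD1 i) ?ltnn//=.
  rewrite addrCA addrA; congr (_ + _); apply: eq_bigl => j.
  by rewrite -leqNgt ltn_neqAle andbC.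
under eq_bigr do rewrite split_i.
rewrite !big_split/= -addrA; congr (_ + _).
rewrite mulr_natl mulr2n; congr (_ + _).
rewrite (exchange_big_dep xpredT)//=.
by apply: eq_bigr => i _; apply: eq_bigr => j _; rewrite fC.
Qed.

Section loop_equation.
Context {R : realType}.
Local Notation RR := (measurableTypeR R).
Local Notation lambda := (@lebesgue_measure R).

Section interval_flow.
Variables (s h : R).
Hypotheses (s0 : 0 < s) (h01 : 0 < h < 1).

(** The first-order flow of the vector field [t (1 - t) / (t + s)], which vanishes
    at 0 and 1; for [0 < h < 1] it is an increasing bijection of [[0, 1]]. *)
Definition interval_flow (t : R) : R := t + h * (t * (1 - t) * (t + s) `^ (-1)).
Definition interval_flow_derivative (t : R) : R := 1 + h * (-1 + s * (1 + s) * (t + s) `^ (-2)).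

Local Notation phi := interval_flow.
Local Notation dphi := interval_flow_derivative.

Lemma powRN1 (x : R) : 0 <= x -> x `^ (-1) = x^-1. Proof. exact: powR_inv1. Qed.
Lemma powRN2 (x : R) : 0 <= x -> x `^ (-2) = x^-1 ^+ 2.
Proof. by move=> x0; rewrite powRN exprVn -powR_mulrn. Qed.

Let measurable_shiftp (r : R) : measurable_fun setT (fun t : RR => (t + s : R) `^ r).
Proof. by apply: (measurableT_comp (measurable_powR _)); exact: measurable_funD. Qed.

Lemma measurable_interval_flow : @measurable_fun _ _ RR RR setT phi.
Proof.
apply: measurable_funD => //; apply: measurable_funM => //.
apply: measurable_funM => //; apply: measurable_funM => //.
exact: measurable_funB.
Qed.

Lemma measurable_interval_flow_derivative : @measurable_fun _ _ RR R setT dphi.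
Proof.
apply: measurable_funD => //; apply: measurable_funM => //.
by apply: measurable_funD => //; apply: measurable_funM.
Qed.

Lemma interval_flow_derivative_gt0 (t : R) : 0 < dphi t.
Proof.
have /andP[h0 h1] := h01; have s0' := s0.
rewrite /dphi; have := powR_ge0 (t + s) (-2).
move: (_ `^ _) => z z0.
have : 0 <= h * (s * (1 + s) * z) by rewrite !mulr_ge0//; lra.
by rewrite mulrDr; lra.
Qed.

Lemma is_derive_interval_flow (t : R) : 0 <= t -> is_derive t (1:R) phi (dphi t).
Proof.
move=> t0; have ts : 0 < t + s by rewrite ltr_wpDl.
have d1 : is_derive t (1 : R) (fun t : R => t + s) 1.
  by apply: is_derive_eq; ring.
have d2 := @is_derive1_comp _ (fun x : R => x `^ (-1)) _ t _ _ (@is_derive1_powR R (-1) _ ts) d1.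
have d3 : is_derive t (1 : R) (fun t : R => t * (1 - t)) (1 - 2 * t).
  by apply: is_derive_eq; rewrite /GRing.scale/=; ring.
have d4 := is_deriveD (is_derive_id t (1 : R)) (is_deriveZ h (is_deriveM d3 d2)).
apply: (is_derive_eq d4); rewrite /GRing.scale/= /dphi.
rewrite (_ : -1 - 1 = -2 :> R); last by lra.
by rewrite powRN1 ?powRN2 ?ltW//; field; rewrite gt_eqF.
Qed.

Lemma interval_flow_change_of_variables (f : RR -> \bar R) :
  measurable_fun setT f -> (forall y, 0 <= f y)%E ->
  (\int[lambda]_t (f (phi t) * (dphi t * \1_(`]0%R, 1%R] : set R) t)%:E) =
   \int[lambda]_y (f y * (\1_(`]0%R, 1%R] : set R) y)%:E))%E.
Proof.
move=> mf f0.
have := @change_of_variables R phi dphi 0 1 ltr01 _ _ _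
  measurable_interval_flow measurable_interval_flow_derivative f mf f0.
have -> : phi 0 = 0 by rewrite /phi !mul0r mulr0 addr0.
have -> : phi 1 = 1 by rewrite /phi subrr mulr0 mul0r mulr0 addr0.
apply.
- by move=> x /andP[x0 _]; exact: is_derive_interval_flow.
- by move=> x _; exact: interval_flow_derivative_gt0.
- apply: continuous_in_subspaceT => x; rewrite inE/= in_itv/= => /andP[x0 _].
  have ts : 0 < x + s by rewrite ltr_wpDl.
  apply: (is_derive1_continuous (l := h * (s * (1 + s) * ((-2 * (x + s) `^ (-2 - 1)) * 1)))).
  have d1 : is_derive x (1 : R) (fun t : R => t + s) 1.
    by apply: is_derive_eq; ring.
  have d2 := @is_derive1_comp _ (fun x : R => x `^ (-2)) _ x _ _ (@is_derive1_powR R (-2) _ ts) d1.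
  have d4 := is_deriveD (is_derive_cst (1 : R) (x : R) (1 : R)) (is_deriveZ h (is_deriveD (is_derive_cst (-1 : R) (x : R) (1 : R)) (is_deriveZ (s * (1 + s)) d2))).
  by apply: (is_derive_eq d4); rewrite /GRing.scale/=; ring.
Qed.

End interval_flow.

Variables (p q k : R) (m : nat) (s : R).
Hypotheses (p1 : 1 <= p) (q0 : 0 < q) (k0 : 0 <= k) (s0 : 0 < s).
Implicit Types (h : R) (t : m.-tuple RR) (i j : 'I_m).
Local Notation u := (@shift_inv R m s).

Let A i t := -1 + s * (1 + s) * u i t ^+ 2.
Let B i t := (1 - tnth t i) * u i t.
Let C i t := - (tnth t i * u i t).
Let G i t := tnth t i * (1 - tnth t i) * u i t ^+ 2.
Let V i j t := -1 + s * (1 + s) * (u i t * u j t).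

(** The factor by which the flow multiplies the integrand times the Jacobian: [A]
    comes from the Jacobian, [B], [C] and [G] from the distances to 0, 1 and [- s],
    and [V] from the differences of two variables. *)
Let flow_ratio h t :=
  (\prod_(i < m) ((1 + h * A i t) `^ 1 * (1 + h * B i t) `^ (p - 1) *
     (1 + h * C i t) `^ (q - 1) * (1 + h * G i t) `^ (- k))) *
  \prod_(i < m) \prod_(j < m | (i < j)%N) (1 + h * V i j t) `^ (2 * k).

Let flow_log_derivative t :=
  \sum_(i < m) (1 * A i t + (p - 1) * B i t + (q - 1) * C i t + - k * G i t) +
  \sum_(i < m) \sum_(j < m | (i < j)%N) (2 * k * V i j t).

(** The double sum of [V] over pairs is what produces the square of the first power
    sum: each [V i j] is a product of a function of [t_i] and one of [t_j], up to a
    constant. *)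
Let flow_log_derivativeE t : cube m t -> flow_log_derivative t =
  s * (1 + s) * (power_sum2 s t + k * power_sum1 s t ^+ 2) +
  (- k * (1 + 2 * s) + (p - 1) * (1 + s) + (q - 1) * s) * power_sum1 s t +
  m%:R * (- 1 + k - (p - 1) - (q - 1) - k * (m%:R - 1)).
Proof.
move=> tc.
have [c cE] : exists c, c = - 1 + k - (p - 1) - (q - 1) by eexists.
have E i : 1 * A i t + (p - 1) * B i t + (q - 1) * C i t + - k * G i t =
   s * (1 + s) * (1 + k) * u i t ^+ 2 +
   (- k * (1 + 2 * s) + (p - 1) * (1 + s) + (q - 1) * s) * u i t +
   c.
  rewrite cE /A /B /C /G /shift_inv; have /andP[t0 _] := tc i; field.
  by rewrite gt_eqF// addr_gt0.
have VC i j : V i j t = V j i t by rewrite /V [u i t * _]mulrC.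
have H := sum_symmetric VC.
have sV : \sum_i \sum_j V i j t = - m%:R ^+ 2 + s * (1 + s) * power_sum1 s t ^+ 2.
  rewrite /V; under eq_bigr do rewrite big_split/= sumr_const card_ord -mulr_sumr -mulr_sumr.
  rewrite big_split/= sumr_const card_ord -mulr_sumr -mulr_suml -/(power_sum1 s t).
  by rewrite -[X in X + _]mulr_natr -[X in X * _ + _]mulr_natr; ring.
have sD : \sum_i V i i t = - m%:R + s * (1 + s) * power_sum2 s t.
  by rewrite /V big_split/= sumr_const card_ord -mulr_sumr mulNrn.
rewrite sV sD in H.
rewrite /flow_log_derivative (eq_bigr _ (fun i _ => E i)) !big_split/= -!mulr_sumr.
rewrite -/(power_sum1 s t) -/(power_sum2 s t) sumr_const card_ord.
have -> : \sum_(i < m) \sum_(j < m | (i < j)%N) (2 * k * V i j t) =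
    k * (2 * \sum_(i < m) \sum_(j < m | (i < j)%N) V i j t).
  by rewrite mulrA [k * 2]mulrC mulr_sumr; apply: eq_bigr => i _; rewrite mulr_sumr.
have -> : 2 * \sum_(i < m) \sum_(j < m | (i < j)%N) V i j t =
    (- m%:R ^+ 2 + s * (1 + s) * power_sum1 s t ^+ 2) - (- m%:R + s * (1 + s) * power_sum2 s t).
  by rewrite H addrAC subrr add0r.
by rewrite -[X in _ + X + _ = _]mulr_natr cE; ring.
Qed.

Let u_bound i t : cube m t -> 0 < u i t <= s^-1.
Proof. exact: shift_inv_bound. Qed.

Let mu_ i : measurable_fun (cube m) (u i).
Proof. exact: measurable_shift_inv. Qed.

Let mt i : measurable_fun (cube m) (fun t => tnth t i : R).
Proof. by apply: (measurable_funS measurableT) => //; exact: measurable_fun_tnth. Qed.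

Let m1t i : measurable_fun (cube m) (fun t => 1 - tnth t i : R).
Proof. exact: measurable_funB. Qed.

Let mA i : measurable_fun (cube m) (A i).
Proof. by apply: measurable_funD => //; apply: measurable_funM => //; exact: measurable_funX. Qed.
Let mB i : measurable_fun (cube m) (B i).
Proof. exact: measurable_funM. Qed.
Let mC i : measurable_fun (cube m) (C i).
Proof. by apply: measurableT_comp => //; exact: measurable_funM. Qed.
Let mG i : measurable_fun (cube m) (G i).
Proof. by apply: measurable_funM; [exact: measurable_funM|exact: measurable_funX]. Qed.
Let mV i j : measurable_fun (cube m) (V i j).
Proof. by apply: measurable_funD => //; apply: measurable_funM => //; exact: measurable_funM. Qed.

Let mpow (a : m.-tuple RR -> R) h (e : R) : measurable_fun (cube m) a ->
  measurable_fun (cube m) (fun t => (1 + h * a t) `^ e).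
Proof.
move=> ma; apply: (measurableT_comp (measurable_powR _)).
by apply: measurable_funD => //; exact: measurable_funM.
Qed.

Let measurable_prod_lt (f : 'I_m -> 'I_m -> m.-tuple RR -> R) i :
  (forall j, measurable_fun (cube m) (f i j)) ->
  measurable_fun (cube m) (fun t => \prod_(j < m | (i < j)%N) f i j t).
Proof.
move=> mf; rewrite (_ : (fun t => _) = fun t => \prod_(j <- [seq j : 'I_m <- index_enum _ | (i < j)%N]) f i j t).
  exact: measurable_prod.
by apply/funext => t; rewrite big_filter.
Qed.

Let measurable_sum_lt (f : 'I_m -> 'I_m -> m.-tuple RR -> R) i :
  (forall j, measurable_fun (cube m) (f i j)) ->
  measurable_fun (cube m) (fun t => \sum_(j < m | (i < j)%N) f i j t).
Proof.
move=> mf; rewrite (_ : (fun t => _) = fun t => \sum_(j <- [seq j : 'I_m <- index_enum _ | (i < j)%N]) f i j t).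
  exact: measurable_sum.
by apply/funext => t; rewrite big_filter.
Qed.

Let measurable_flow_ratio h : measurable_fun (cube m) (flow_ratio h).
Proof.
apply: measurable_funM; apply: measurable_prod => i _.
  by do 3 (apply: measurable_funM; last exact: mpow); exact: mpow.
by apply: (measurable_prod_lt (f := fun i j t => (1 + h * V i j t) `^ (2 * k))) => j; exact: mpow.
Qed.

Let measurable_flow_log_derivative : measurable_fun (cube m) flow_log_derivative.
Proof.
apply: measurable_funD; apply: measurable_sum => i.
  by do 3 (apply: measurable_funD; last exact: measurable_funM); exact: measurable_funM.
by apply: (measurable_sum_lt (f := fun i j t => 2 * k * V i j t)) => j; exact: measurable_funM.
Qed.

Let first_order_flow : first_order (cube m) flow_ratio (fun=> 1) flow_log_derivative.
Proof.
pose M := 1 + s * (1 + s) * s^-1 ^+ 2 + s^-1 + s^-1 ^+ 2.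
have s'0 : 0 < s^-1 by rewrite invr_gt0.
have ss0 : 0 < s * (1 + s) by rewrite mulr_gt0// addr_gt0.
have u2 i j t : cube m t -> 0 <= u i t * u j t <= s^-1 ^+ 2.
  move=> tc; have /andP[ui0 ui] := u_bound i tc; have /andP[uj0 uj] := u_bound j tc.
  by rewrite (mulr_ge0 (ltW ui0) (ltW uj0))/= expr2 ler_pM// ltW.
have suu i j t : cube m t -> 0 <= s * (1 + s) * (u i t * u j t) <= s * (1 + s) * s^-1 ^+ 2.
  by move=> tc; have /andP[a b] := u2 i j t tc; rewrite (mulr_ge0 (ltW ss0) a)/= ler_pM2l.
have sM : 0 <= s * (1 + s) * s^-1 ^+ 2 by rewrite mulr_ge0 ?sqr_ge0 ?ltW.
have s2 := sqr_ge0 s^-1.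
have pb (x y c : R) : 0 <= x <= 1 -> 0 <= y <= c -> 0 <= x * y <= c.
  move=> /andP[x0 x1] /andP[y0 yc]; rewrite mulr_ge0//=.
  by rewrite -[leRHS]mul1r ler_pM.
have bV i j t : cube m t -> `|V i j t| <= M.
  by move=> tc; have := suu i j t tc; rewrite /V /M ler_norml; lra.
have bA i t : cube m t -> `|A i t| <= M.
  by move=> tc; have := suu i i t tc; rewrite /A /M expr2 ler_norml; lra.
have bB i t : cube m t -> `|B i t| <= M.
  move=> tc; have /andP[t0 t1] := tc i; have /andP[u0 u1] := u_bound i tc.
  have : 0 <= (1 - tnth t i) * u i t <= s^-1 by apply: (pb); lra.
  by rewrite /B /M ler_norml; lra.
have bC i t : cube m t -> `|C i t| <= M.
  move=> tc; have /andP[t0 t1] := tc i; have /andP[u0 u1] := u_bound i tc.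
  have : 0 <= tnth t i * u i t <= s^-1 by apply: (pb); lra.
  by rewrite /C /M ler_norml; lra.
have bG i t : cube m t -> `|G i t| <= M.
  move=> tc; have /andP[t0 t1] := tc i; have /andP[u0 u1] := u2 i i t tc.
  have x01 : 0 <= tnth t i * (1 - tnth t i) <= 1 by apply: (pb); lra.
  have : 0 <= tnth t i * (1 - tnth t i) * u i t ^+ 2 <= s^-1 ^+ 2.
    by apply: (pb) => //; rewrite [u i t ^+ 2]expr2 u0 u1.
  by rewrite /G /M ler_norml; lra.
have fo (a : m.-tuple RR -> R) (e : R) : (forall t, cube m t -> `|a t| <= M) ->
    first_order (cube m) (fun h t => (1 + h * a t) `^ e) (fun=> 1) (fun t => e * a t).
  by move=> aM; exact: first_order_powR aM.
have foM (f f' : R -> m.-tuple RR -> R) (v v' : m.-tuple RR -> R) :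
    first_order (cube m) f (fun=> 1) v -> first_order (cube m) f' (fun=> 1) v' ->
    first_order (cube m) (fun h t => f h t * f' h t) (fun=> 1) (fun t => v t + v' t).
  move=> H H'; move: (first_orderM H H').
  under [X in first_order _ _ X]eq_fun do rewrite mulr1.
  by under [X in first_order _ _ _ X]eq_fun do rewrite mulr1 mul1r.
apply foM; apply: first_order_prod1 => i _.
  apply foM; last exact (fo _ _ (bG i)).
  apply foM; last exact (fo _ _ (bC i)).
  by apply foM; [exact (fo _ _ (bA i))|exact (fo _ _ (bB i))].
by apply: first_order_prod1 => j _; exact (fo _ _ (bV i j)).
Qed.

Let flow_pointwise h t : 0 < h < 1 -> cube m t ->
  jacobi_kernel p q k [tuple of map (interval_flow s h) t] *
  shift_prod k s [tuple of map (interval_flow s h) t] *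
  \prod_(i < m) interval_flow_derivative s h (tnth t i) =
  jacobi_kernel p q k t * shift_prod k s t * flow_ratio h t.
Proof.
move=> h01 tc; rewrite /jacobi_kernel /shift_prod /flow_ratio.
have ts i : 0 < tnth t i + s by have /andP[t0 _] := tc i; rewrite addr_gt0.
have phiE i : interval_flow s h (tnth t i) = tnth t i * (1 + h * B i t).
  by rewrite /interval_flow powRN1 ?ltW// /B /shift_inv; field; rewrite gt_eqF.
have phi1E i : 1 - interval_flow s h (tnth t i) = (1 - tnth t i) * (1 + h * C i t).
  by rewrite /interval_flow powRN1 ?ltW// /C /shift_inv; field; rewrite gt_eqF.
have phisE i : interval_flow s h (tnth t i) + s = (tnth t i + s) * (1 + h * G i t).
  by rewrite /interval_flow powRN1 ?ltW// /G /shift_inv; field; rewrite gt_eqF.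
have dphiE i : interval_flow_derivative s h (tnth t i) = 1 + h * A i t.
  by rewrite /interval_flow_derivative powRN2 ?ltW.
have phiV i j : interval_flow s h (tnth t i) - interval_flow s h (tnth t j) =
    (tnth t i - tnth t j) * (1 + h * V i j t).
  by rewrite /interval_flow !powRN1 ?ltW// /V /shift_inv; field; rewrite !gt_eqF.
have /andP[h0 h1] := h01.
have B0 i : 0 <= 1 + h * B i t.
  have /andP[t0 t1] := tc i; have /andP[u0 _] := u_bound i tc.
  apply: addr_ge0 => //; apply: mulr_ge0; first exact: ltW.
  by apply: mulr_ge0; [rewrite subr_ge0|exact: ltW].
have G0 i : 0 <= 1 + h * G i t.
  have /andP[t0 t1] := tc i; have /andP[u0 _] := u_bound i tc.
  apply: addr_ge0 => //; apply: mulr_ge0; first exact: ltW.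
  by rewrite mulr_ge0 ?sqr_ge0// mulr_ge0 ?subr_ge0// ltW.
have C0 i : 0 <= 1 + h * C i t.
  have /andP[t0 t1] := tc i; have /andP[u0 _] := u_bound i tc.
  have tu1 : tnth t i * u i t <= 1.
    by rewrite ler_pdivrMr// mul1r lerDl ltW.
  have tu0 : 0 <= tnth t i * u i t by rewrite mulr_ge0// ltW.
  have : h * (tnth t i * u i t) <= 1 * 1 by rewrite ler_pM// ltW.
  by rewrite /C mulrN; lra.
have V0 i j : 0 <= 1 + h * V i j t.
  have /andP[u0 _] := u_bound i tc; have /andP[v0 _] := u_bound j tc.
  have : 0 <= h * (s * (1 + s) * (u i t * u j t)).
    apply: mulr_ge0; first exact: ltW.
    by rewrite !mulr_ge0 ?ltW// addr_gt0.
  by rewrite /V mulrDr; lra.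
have A0 i : 0 <= 1 + h * A i t.
  by have := V0 i i; rewrite /V /A [in X in _ -> X]expr2.
pose ft := [tuple of map (interval_flow s h) t].
have -> : \prod_(i < m) (tnth ft i `^ (p - 1) * (1 - tnth ft i) `^ (q - 1)) =
    \prod_(i < m) ((tnth t i `^ (p - 1) * (1 - tnth t i) `^ (q - 1)) *
       ((1 + h * B i t) `^ (p - 1) * (1 + h * C i t) `^ (q - 1))).
  apply: eq_bigr => i _; have /andP[t0 t1] := tc i.
  by rewrite tnth_map phi1E phiE !powRM//; [ring|rewrite subr_ge0|exact: ltW].
have -> : \prod_(i < m) \prod_(j < m | (i < j)%N) `|tnth ft i - tnth ft j| `^ (2 * k) =
    \prod_(i < m) ((\prod_(j < m | (i < j)%N) `|tnth t i - tnth t j| `^ (2 * k)) *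
      \prod_(j < m | (i < j)%N) (1 + h * V i j t) `^ (2 * k)).
  apply: eq_bigr => i _; rewrite -big_split; apply: eq_bigr => j _ /=.
  by rewrite !tnth_map phiV normrM powRM// (ger0_norm (V0 i j)).
have -> : \prod_(i < m) (tnth ft i + s) `^ (- k) =
    \prod_(i < m) ((tnth t i + s) `^ (- k) * (1 + h * G i t) `^ (- k)).
  by apply: eq_bigr => i _; rewrite tnth_map phisE powRM// ltW.
have -> : \prod_(i < m) interval_flow_derivative s h (tnth t i) =
    \prod_(i < m) (1 + h * A i t) `^ 1.
  by apply: eq_bigr => i _; rewrite dphiE powRr1.
rewrite !big_split/=; ring.
Qed.

Let mcube := @measurable_cube R m.

Let flow_invariance h : 0 < h < 1 ->
  \int[lebesgue_tuple R m]_(t in cube m) (jacobi_kernel p q k t * shift_prod k s t * flow_ratio h t) =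
  \int[lebesgue_tuple R m]_(t in cube m) (jacobi_kernel p q k t * shift_prod k s t * 1).
Proof.
move=> h01; rewrite /Rintegral; congr fine.
rewrite integral_cube [RHS]integral_cube.
under [RHS]eq_integral do rewrite mulr1.
pose F t : \bar R := (jacobi_kernel p q k t * shift_prod k s t)%:E.
have mF : measurable_fun setT F.
  apply/measurable_EFinP; apply: measurable_funM; first exact: measurable_jacobi_kernel.
  exact: measurable_shift_prod.
have F0 t : (0 <= F t)%E by rewrite lee_fin mulr_ge0 ?jacobi_kernel_ge0 ?shift_prod_ge0.
pose w (t : RR) : R := interval_flow_derivative s h t * \1_(`]0%R, 1%R] : set R) t.
have mi : measurable_fun setT (\1_(`]0%R, 1%R] : set R) : RR -> R) by exact: measurable_indic.
have mw : measurable_fun setT w.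
  by apply: measurable_funM => //; exact: measurable_interval_flow_derivative.
have w0 (x : RR) : 0 <= w x.
  by rewrite mulr_ge0// ?indicE// ltW// interval_flow_derivative_gt0.
have i0 (t : RR) : 0 <= \1_(`]0%R, 1%R] : set R) t :> R by rewrite indicE.
have := lebesgue_tuple_change_of_variables (measurable_interval_flow s h) mw w0 mi i0
  (fun f mf f0 => interval_flow_change_of_variables s0 h01 mf f0) mF F0.
rewrite /F => <-; apply: eq_integral => t _.
have [tc|tc] := pselect (cube m t); last first.
  by rewrite /w big_split/= -!indic_cube indicE memNset//= !mulr0 !mule0.
by rewrite -EFinM -EFinM /w big_split/= -flow_pointwise// [in RHS]mulrA.
Qed.

(** Moving all variables by the flow does not change the integral of the kernel
    times [shift_prod]; the first-order term in [h] is therefore 0. *)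
Lemma loop_equation :
  s * (1 + s) * shifted_average p q k s (fun t : m.-tuple RR => power_sum2 s t + k * power_sum1 s t ^+ 2) +
  (- k * (1 + 2 * s) + (p - 1) * (1 + s) + (q - 1) * s) *
    shifted_average p q k s (fun t : m.-tuple RR => power_sum1 s t) +
  m%:R * (- 1 + k - (p - 1) - (q - 1) - k * (m%:R - 1)) * shifted_average p q k s (fun _ : m.-tuple RR => 1) = 0.
Proof.
have iW : (lebesgue_tuple R m).-integrable (cube m)
    (EFin \o (fun t => jacobi_kernel p q k t * shift_prod k s t)).
  have := @integrable_shift_prod R p q k m p1 q0 k0 s s0.
  by under eq_fun do rewrite mulr1.
have [C' [d [d0 H]]] := first_order_integral mcube iW first_order_flow measurable_flow_ratio
  (measurable_cst _) measurable_flow_log_derivative.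
pose X := \int[lebesgue_tuple R m]_(t in cube m)
  (jacobi_kernel p q k t * shift_prod k s t * flow_log_derivative t).
have X0 : X = 0.
  apply/eqP; rewrite -normr_le0 leNgt; apply/negP => Xgt0.
  pose h := Num.min (Num.min d (1 / 2)) (`|X| / (2 * (`|C'| + 1))).
  have C1 : 0 < 2 * (`|C'| + 1) by rewrite mulr_gt0// ltr_wpDl.
  have half0 : (0 : R) < 1 / 2 by lra.
  have h0 : 0 < h by rewrite /h !lt_min d0 half0 divr_gt0.
  have hd : h <= d by rewrite /h !ge_min lexx.
  have h1 : h < 1.
    by apply: (@le_lt_trans _ _ (1 / 2)); [rewrite /h !ge_min lexx orbT|lra].
  have hX : h * (2 * (`|C'| + 1)) <= `|X|.
    by rewrite -ler_pdivlMr// /h !ge_min lexx orbT.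
  have := H h; rewrite (gtr0_norm h0) => /(_ hd).
  rewrite flow_invariance ?h0// subrr sub0r normrN normrM gtr0_norm// expr2.
  rewrite mulrCA ler_pM2l// => XC.
  have Ch : C' * h <= `|C'| * h by rewrite ler_pM2r// ler_norm.
  have Ch0 : 0 <= `|C'| * h by rewrite mulr_ge0// ltW.
  have key (x y c c' : R) : 0 < y -> y * (2 * (c + 1)) <= x -> x <= c' * y ->
    c' * y <= c * y -> 0 <= c * y -> False by lra.
  exact: (key _ _ _ _ h0 hX XC Ch Ch0).
rewrite -X0 /X /shifted_average.
have i1 := @integrable_shift_prod R p q k m p1 q0 k0 s s0.
have i2 := @integrable_power_sum1 R p q k m p1 q0 k0 s s0.
have i3 := @integrable_power_sum2 R p q k m p1 q0 k0 s s0.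
rewrite -!RintegralZl//.
have zl (c : R) g : (lebesgue_tuple R m).-integrable (cube m) (EFin \o g) ->
   (lebesgue_tuple R m).-integrable (cube m) (EFin \o (fun t => c * g t)).
  by move=> ig; exact: (integrableZl mcube c ig).
rewrite -RintegralD//; [|exact: zl|exact: zl].
rewrite -RintegralD//; [|exact: (integrableD mcube (zl _ _ i3) (zl _ _ i2))|exact: zl].
apply: eq_Rintegral => t; rewrite inE => tc; rewrite flow_log_derivativeE//; ring.
Qed.

End loop_equation.

(** * Decaying solutions of the hypergeometric equation *)

Section wronskian.
Context {R : realType}.
Implicit Types (f g : R -> R) (s t x : R).

Lemma is_derive_ext f g s (l l' : R) : is_derive s (1 : R) f l -> f =1 g -> l = l' ->
  is_derive s (1 : R) g l'.
Proof. by move=> df /funext <- <-. Qed.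

Lemma derive0_constant f : (forall s, 0 < s -> is_derive s (1 : R) f 0) ->
  forall s t, 0 < s -> 0 < t -> f s = f t.
Proof.
move=> df; suff H s t : 0 < s -> s < t -> f s = f t.
  by move=> s t s0 t0; have [/H->|/H->|->] := ltgtP s t.
move=> s0 st.
have cf : {within `[s, t], continuous f}.
  apply: continuous_in_subspaceT => x; rewrite inE/= in_itv/= => /andP[sx _].
  by apply: is_derive1_continuous (df x _); lra.
have [x|x _] := @MVT R f (fun=> 0) s t st _ cf.
  by rewrite in_itv/= => /andP[sx _]; apply: df; lra.
by rewrite mul0r => /eqP; rewrite subr_eq0 => /eqP.
Qed.

Lemma powRB1 (r x : R) : 0 < x -> x `^ (r - 1) = x `^ r / x.
Proof. by move=> x0; rewrite powRB ?powRr1 ?ltW//; apply/implyP => _; rewrite gt_eqF. Qed.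

Lemma powRDp (r r' x : R) : 0 < x -> x `^ (r + r') = x `^ r * x `^ r'.
Proof. by move=> x0; rewrite powRD//; apply/implyP => _; rewrite gt_eqF. Qed.

Lemma powR_decay e x : 0 < e -> 0 < x -> exists2 s : R, 1 <= s & s `^ (- e) < x.
Proof.
move=> e0 x0; exists (1 + x `^ (- e^-1)); first by rewrite lerDl powR_ge0.
have xe : 0 < x `^ (- e^-1) by exact: powR_gt0.
rewrite powRN -[ltRHS]invrK ltf_pV2 ?posrE ?invr_gt0 ?powR_gt0//; last by rewrite ltr_wpDr// powR_ge0.
have : (x `^ (- e^-1)) `^ e < (1 + x `^ (- e^-1)) `^ e.
  by apply: gt0_ltr_powR; rewrite ?nnegrE ?addr_ge0 ?powR_ge0// ltrDr.
by rewrite -powRrM mulNr mulVf ?gt_eqF// powR_inv1// ltW.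
Qed.

Lemma powR1D_le e s : 1 <= s -> (1 + s) `^ e <= (2 `^ e + 1) * s `^ e.
Proof.
move=> s1; have s0 : 0 < s by lra.
rewrite mulrDl mul1r; have [e0|e0] := leP 0 e.
  rewrite ler_wpDr ?powR_ge0// -powRM//; last exact: ltW.
  by apply: ge0_ler_powR; rewrite ?nnegrE//; lra.
rewrite ler_wpDl ?mulr_ge0 ?powR_ge0//.
have [r rE] : exists r, e = - r by exists (- e); rewrite opprK.
rewrite rE !powRN lef_pV2 ?posrE ?powR_gt0//; last lra.
by apply: ge0_ler_powR; rewrite ?nnegrE//; lra.
Qed.

(** By Abel's formula the Wronskian of two solutions is a constant multiple of
    [s `^ - k * (1 + s) `^ (q - 1 - k)]. If both solutions are at most of order
    [s `^ - mu] at infinity, and their derivatives at most [s `^ (- mu - 1)], the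
    Wronskian is of smaller order than this function, so the constant is 0. *)
Lemma decaying_solutions_proportional (k q kap mu C : R) f f1 f2 g g1 g2 :
  0 < q + 2 * mu - 2 * k ->
  (forall s, 0 < s -> is_derive s (1 : R) f (f1 s)) ->
  (forall s, 0 < s -> is_derive s (1 : R) f1 (f2 s)) ->
  (forall s, 0 < s -> is_derive s (1 : R) g (g1 s)) ->
  (forall s, 0 < s -> is_derive s (1 : R) g1 (g2 s)) ->
  (forall s, 0 < s -> s * (1 + s) * f2 s =
     (- k * (1 + 2 * s) + (q - 1) * s) * f1 s - kap * f s) ->
  (forall s, 0 < s -> s * (1 + s) * g2 s =
     (- k * (1 + 2 * s) + (q - 1) * s) * g1 s - kap * g s) ->
  (forall s, 0 < s -> `|f s| <= C * s `^ (- mu)) ->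
  (forall s, 0 < s -> `|f1 s| <= C * s `^ (- mu) / s) ->
  (forall s, 0 < s -> `|g s| <= C * s `^ (- mu)) ->
  (forall s, 0 < s -> `|g1 s| <= C * s `^ (- mu) / s) ->
  (forall s, 0 < s -> 0 < g s) ->
  forall s t, 0 < s -> 0 < t -> f s / g s = f t / g t.
Proof.
move=> mu0 df df1 dg dg1 Ef Eg bf bf1 bg bg1 g0.
pose W s := f s * g1 s - f1 s * g s.
pose e := k + 1 - q.
pose Phi s := W s * (s `^ k * (1 + s) `^ e).
have dW s : 0 < s -> is_derive s (1 : R) W (f s * g2 s - f2 s * g s).
  move=> s0; apply: is_derive_ext (is_deriveB (is_deriveM (df _ s0) (dg1 _ s0)) (is_deriveM (df1 _ s0) (dg _ s0))) _ _.
    by [].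
  by rewrite /GRing.scale/=; ring.
have dP s : 0 < s -> is_derive s (1 : R) (fun s => s `^ k * (1 + s) `^ e)
    (s `^ k * (1 + s) `^ e * (k / s + e / (1 + s))).
  move=> s0; have s1 : 0 < 1 + s by lra.
  have d1 : is_derive s (1 : R) (fun s : R => 1 + s) 1.
    by apply: is_derive_eq; ring.
  have d2 := @is_derive1_comp _ (fun x : R => x `^ e) _ s _ _ (@is_derive1_powR R e _ s1) d1.
  apply: is_derive_ext (is_deriveM (@is_derive1_powR R k s s0) d2) _ _ => //.
  rewrite /GRing.scale/= (powRB1 k s0) (powRB1 e s1).
  by field; rewrite !gt_eqF.
have dPhi s : 0 < s -> is_derive s (1 : R) Phi 0.
  move=> s0; apply: is_derive_ext (is_deriveM (dW _ s0) (dP _ s0)) _ _ => //.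
  have s1 : 0 < 1 + s by lra.
  have f2E : f2 s = ((- k * (1 + 2 * s) + (q - 1) * s) * f1 s - kap * f s) / (s * (1 + s)).
    by rewrite -Ef//; field; rewrite !gt_eqF.
  have g2E : g2 s = ((- k * (1 + 2 * s) + (q - 1) * s) * g1 s - kap * g s) / (s * (1 + s)).
    by rewrite -Eg//; field; rewrite !gt_eqF.
  rewrite /GRing.scale/= /W f2E g2E /e; field.
  by rewrite !gt_eqF.
have Phi_const := derive0_constant dPhi.
have C0 : 0 <= C.
  have := bf 1 ltr01; rewrite powR1 mulr1; exact: le_trans.
have Phi_bound s : 1 <= s ->
    `|Phi s| <= (2 * C ^+ 2 * (2 `^ e + 1)) * s `^ (- (q + 2 * mu - 2 * k)).
  move=> s1; have s0 : 0 < s by lra.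
  have Wb : `|W s| <= 2 * C ^+ 2 * (s `^ (- mu) * s `^ (- mu) / s).
    have h1 : `|f s * g1 s| <= C * s `^ (- mu) * (C * s `^ (- mu) / s).
      by rewrite normrM ler_pM// ?bf ?bg1.
    have h2 : `|f1 s * g s| <= C * s `^ (- mu) / s * (C * s `^ (- mu)).
      by rewrite normrM ler_pM// ?bf1 ?bg.
    apply: le_trans (ler_normB _ _) _.
    by rewrite [leRHS](_ : _ = C * s `^ (- mu) * (C * s `^ (- mu) / s) + C * s `^ (- mu) / s * (C * s `^ (- mu))); [exact: lerD|ring].
  rewrite /Phi normrM [`|_ * _ `^ _|]ger0_norm ?mulr_ge0 ?powR_ge0//.
  have := ler_pM (normr_ge0 _) (mulr_ge0 (powR_ge0 _ _) (powR_ge0 _ _)) Wb (ler_wpM2l (powR_ge0 s k) (powR1D_le e s1)).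
  move=> /le_trans; apply.
  rewrite (_ : - (q + 2 * mu - 2 * k) = - mu + (- mu) + (-1) + k + e); last by rewrite /e; ring.
  rewrite (powRDp _ e s0) (powRDp _ k s0) (powRDp _ (-1) s0) (powRDp _ (- mu) s0).
  rewrite (powR_inv1 (ltW s0)).
  by rewrite le_eqVlt; apply/orP; left; apply/eqP; ring.
have Phi0 s : 0 < s -> Phi s = 0.
  move=> s0; apply/eqP; rewrite -normr_le0 leNgt; apply/negP => Ps0.
  have K0 : 0 < 2 * C ^+ 2 * (2 `^ e + 1) + 1.
    by rewrite ltr_wpDl// !mulr_ge0 ?sqr_ge0// addr_ge0// powR_ge0.
  have [t t1 tb] := powR_decay mu0 (divr_gt0 Ps0 K0).
  have t0 : 0 < t by lra.
  have := Phi_bound t t1; rewrite (Phi_const t s t0 s0) => H.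
  move: tb; rewrite ltr_pdivlMr// => tb.
  by have := powR_ge0 t (- (q + 2 * mu - 2 * k)); move: H tb; move: (_ `^ _) => z; lra.
have W0 s : 0 < s -> W s = 0.
  move=> s0; have /eqP := Phi0 s s0; rewrite /Phi mulf_eq0 => /orP[/eqP//|].
  by rewrite mulf_eq0 !gt_eqF// powR_gt0//; lra.
apply: (derive0_constant (f := fun s => f s / g s)) => s s0.
have gs0 : g s != 0 by rewrite gt_eqF// g0.
apply: is_derive_ext (is_deriveM (df _ s0) (is_deriveV gs0 (dg _ s0))) _ _ => //.
rewrite /GRing.scale/=.
have WE : f s * g1 s = f1 s * g s by apply/eqP; rewrite -subr_eq0; apply/eqP; exact: W0.
have -> : f s * (- g s ^- 2 * g1 s) + (g s)^-1 * f1 s = - (f s * g1 s - f1 s * g s) / (g s) ^+ 2.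
  by field.
by rewrite WE subrr oppr0 mul0r.
Qed.

End wronskian.

(** * Reduction to a one-dimensional average *)

Section proportionality.
Context {R : realType}.
Local Notation RR := (measurableTypeR R).
Local Notation lambda := (@lebesgue_measure R).

Lemma integral_cube1 (F : 1.-tuple RR -> \bar R) :
  measurable_fun setT F -> (forall t, 0 <= F t)%E ->
  (\int[lebesgue_tuple R 1]_(t in cube 1) F t =
   \int[lambda]_(x in `]0%R, 1%R]) F [tuple x])%E.
Proof.
move=> mF F0; rewrite integral_cube integral_lebesgue_tupleS; last 2 first.
- apply: emeasurable_funM => //; apply/measurable_EFinP.
  by apply: measurable_prod_tnth; exact: measurable_indic.
- by move=> t; rewrite mule_ge0// lee_fin prodr_ge0// => i _; rewrite indicE.
rewrite [RHS]integral_mkcond; apply: eq_integral => x _.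
rewrite integral_lebesgue_tuple0; last 2 first.
- apply: emeasurable_funM.
    by apply: (measurableT_comp mF); exact: measurable_cons_tuple.
  apply/measurable_EFinP.
  by apply: (measurableT_comp (measurable_prod_tnth (measurable_indic _))) => //; exact: measurable_cons_tuple.
- by move=> t; rewrite mule_ge0// lee_fin prodr_ge0// => i _; rewrite indicE.
rewrite big_ord1 tnth0 patchE indicE.
have -> : [tuple of x :: [tuple]] = [tuple x] by exact: val_inj.
by case: (_ \in _); rewrite ?mule1 ?mule0.
Qed.

Lemma shifted_average1 (p q k s : R) :
  shifted_average p q k s (fun _ : 1.-tuple RR => 1) =
  \int[lambda]_(x in `]0%R, 1%R]) (x `^ (p - 1) * (1 - x) `^ (q - 1) * (x + s) `^ (- k)).
Proof.
rewrite /shifted_average /Rintegral; congr fine.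
rewrite integral_cube1; last 2 first.
- apply/measurable_EFinP; apply: measurable_funM; first exact: measurable_jacobi_kernel.
  under eq_fun do rewrite mulr1.
  exact: measurable_shift_prod.
- move=> t; rewrite lee_fin mulr1.
  by apply: mulr_ge0; [exact: jacobi_kernel_ge0|exact: shift_prod_ge0].
apply: eq_integral => x _; rewrite /jacobi_kernel /shift_prod !big_ord1 !tnth0.
by rewrite big_pred0 ?mulr1// => i; rewrite [i]ord1.
Qed.

(** A nonnegative function with integral 0 vanishes almost everywhere. *)
Lemma integral_itv01_gt0 (f : RR -> R) : @measurable_fun _ _ RR R `]0%R, 1%R]%classic f ->
  (forall x, 0 < x < 1 -> 0 < f x) -> (forall x, 0 <= f x) ->
  (0 < \int[lambda]_(x in `]0%R, 1%R]) (f x)%:E)%E.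
Proof.
move=> mf fgt0 f0; rewrite lt0e integral_ge0 ?andbT; last by move=> x _; rewrite lee_fin.
apply/eqP => I0.
have I0' : (\int[lambda]_(x in `]0%R, 1%R]) `|(f x)%:E| = 0)%E.
  by rewrite -I0; apply: eq_integral => x _; rewrite gee0_abs// lee_fin.
have mI : measurable (`]0%R, 1%R]%classic : set RR) by exact: measurable_itv.
have mEf : measurable_fun (`]0%R, 1%R]%classic : set RR) (EFin \o f) by exact/measurable_EFinP.
have [N [mN N0 NE]] := (ae_eq_integral_abs lambda mI mEf).1 I0'.
have : (lambda `]0%R, 1%R[ <= lambda N)%E.
  apply: le_measure; rewrite ?inE//.
  move=> x /=; rewrite in_itv/= => x01; apply/NE => /=.
  rewrite in_itv/= => H; have x01' : 0 < x <= 1 by lra.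
  have [fx0] := H x01'.
  by have := fgt0 x x01; rewrite fx0 ltxx.
by rewrite N0 lebesgue_measure_itv/= lte_fin ltr01 sube0 lee_fin ler10.
Qed.

Lemma shifted_average_gt0 (p q k s : R) : 1 <= p -> 0 < q -> 0 <= k -> 0 < s ->
  0 < shifted_average p q k s (fun _ : 1.-tuple RR => 1).
Proof.
move=> p1 q0 k0 s0; rewrite shifted_average1 /Rintegral fine_gt0//.
pose f (x : RR) : R := x `^ (p - 1) * (1 - x) `^ (q - 1) * (x + s) `^ (- k).
have mf : measurable_fun setT f.
  apply: measurable_funM; first apply: measurable_funM.
  - exact: measurable_powR.
  - by apply: (measurableT_comp (measurable_powR _)); exact: measurable_funB.
  - by apply: (measurableT_comp (measurable_powR _)); exact: measurable_funD.
have f0 x : 0 <= f x by rewrite /f !mulr_ge0 ?powR_ge0.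
rewrite integral_itv01_gt0//=; last 2 first.
- by apply: (measurable_funS measurableT).
- by move=> x /andP[x0 x1]; rewrite !mulr_gt0 ?powR_gt0 ?subr_gt0// addr_gt0.
have i1 := @integrable_shift_prod R p q k 1 p1 q0 k0 s s0.
have := integrable_fin_num (@measurable_cube R 1) i1.
rewrite -ge0_fin_numE; last by apply: integral_ge0 => x _; rewrite lee_fin; exact: f0.
rewrite integral_cube1; last 2 first.
- apply/measurable_EFinP; apply: measurable_funM; first exact: measurable_jacobi_kernel.
  under eq_fun do rewrite mulr1.
  exact: measurable_shift_prod.
- move=> t /=; rewrite lee_fin mulr1.
  by apply: mulr_ge0; [exact: jacobi_kernel_ge0|exact: shift_prod_ge0].
congr (_ \is a fin_num); apply: eq_integral => x _.
rewrite /= /jacobi_kernel /shift_prod !big_ord1 !tnth0 mulr1.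
by rewrite big_pred0 ?mulr1// => i; rewrite [i]ord1.
Qed.

(** The decay at infinity required of the solutions: [shift_prod] is at most
    [s `^ - (m k)] and each [shift_inv] at most [1 / s]. *)
Lemma shifted_average_bound (p q k s : R) m : 1 <= p -> 0 < q -> 0 <= k -> 0 < s ->
  0 <= shifted_average p q k s (fun _ : m.-tuple RR => 1) <=
    (\int[lebesgue_tuple R m]_(t in cube m) jacobi_kernel p q k t) * s `^ (- (m%:R * k)) /\
  0 <= shifted_average p q k s (fun t : m.-tuple RR => power_sum1 s t) <=
    m%:R / s * shifted_average p q k s (fun _ : m.-tuple RR => 1).
Proof.
move=> p1 q0 k0 s0; have mc := @measurable_cube R m.
have i1 := @integrable_shift_prod R p q k m p1 q0 k0 s s0.
have i2 := @integrable_power_sum1 R p q k m p1 q0 k0 s s0.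
have iW := integrable_jacobi_kernel m p1 q0 k0.
split.
  rewrite Rintegral_ge0/=; last first.
    move=> t _; rewrite mulr1.
    by apply: mulr_ge0; [exact: jacobi_kernel_ge0|exact: shift_prod_ge0].
  rewrite -RintegralZr//; apply: le_Rintegral => //.
    exact: (integrableZr mc _ iW).
  move=> t tc; rewrite mulr1 ler_wpM2l ?jacobi_kernel_ge0//.
  apply: le_trans (shift_prod_le k0 s0 tc) _.
  by rewrite -powR_mulrn ?powR_ge0// -powRrM mulNr mulrC.
rewrite Rintegral_ge0/=; last first.
  move=> t tc; have /andP[a b] := power_sum1_bound s0 tc.
  apply: mulr_ge0; first exact: jacobi_kernel_ge0.
  by apply: mulr_ge0 => //; exact: shift_prod_ge0.
rewrite -RintegralZl//; apply: le_Rintegral => //.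
  exact: (integrableZl mc _ i1).
move=> t tc; have /andP[a b] := power_sum1_bound s0 tc.
rewrite mulr1 [leRHS]mulrCA ler_wpM2l ?jacobi_kernel_ge0//.
by rewrite mulrC ler_wpM2r ?shift_prod_ge0.
Qed.

(** Both averages solve the equation of [loop_equation] with the same
    coefficients: replacing [(m, p, q, k)] by
    [(1, 1 + k (m - 1), q + k (m - 1), m k)] leaves these unchanged when [p = 1].
    Both averages decay like [s `^ - (m k)]. *)
Lemma shifted_average_proportional (q k : R) m : (0 < m)%N -> 0 < q -> 0 <= k ->
  exists C : R, forall s, 0 < s ->
    shifted_average 1 q k s (fun _ : m.-tuple RR => 1) =
    C * shifted_average (1 + k * (m%:R - 1)) (q + k * (m%:R - 1)) (m%:R * k) s (fun _ : 1.-tuple RR => 1).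
Proof.
move=> m0 q0 k0.
have m1 : 0 <= m%:R - 1 :> R by rewrite subr_ge0 ler1n.
have km : 0 <= k * (m%:R - 1) by rewrite mulr_ge0.
set p' := 1 + _; set q' := q + _; set k' := m%:R * k.
have p'1 : 1 <= p' by rewrite /p' lerDl.
have q'0 : 0 < q' by rewrite /q' ltr_wpDr.
have k'0 : 0 <= k' by rewrite /k' mulr_ge0.
pose J s := shifted_average 1 q k s (fun _ : m.-tuple RR => 1).
pose J1 s := shifted_average 1 q k s (fun t : m.-tuple RR => power_sum1 s t).
pose J2 s := shifted_average 1 q k s (fun t : m.-tuple RR => power_sum2 s t + k * power_sum1 s t ^+ 2).
pose H s := shifted_average p' q' k' s (fun _ : 1.-tuple RR => 1).
pose H1 s := shifted_average p' q' k' s (fun t : 1.-tuple RR => power_sum1 s t).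
pose H2 s := shifted_average p' q' k' s (fun t : 1.-tuple RR => power_sum2 s t + k' * power_sum1 s t ^+ 2).
pose I1 := \int[lebesgue_tuple R m]_(t in cube m) jacobi_kernel 1 q k t.
pose I2 := \int[lebesgue_tuple R 1]_(t in cube 1) jacobi_kernel p' q' k' t.
have I10 : 0 <= I1 by apply: Rintegral_ge0 => t _; exact: jacobi_kernel_ge0.
have I20 : 0 <= I2 by apply: Rintegral_ge0 => t _; exact: jacobi_kernel_ge0.
pose C := (1 + k') * (I1 + I2).
have CI1 : 0 <= k' * I1 by rewrite mulr_ge0.
have CI2 : 0 <= k' * I2 by rewrite mulr_ge0.
have CE : C = I1 + I2 + k' * I1 + k' * I2 by rewrite /C; ring.
have C1 : I1 <= C by rewrite CE; move: CI1 CI2; lra.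
have C2 : k' * I1 <= C by rewrite CE; move: CI1 CI2; lra.
have C3 : I2 <= C by rewrite CE; move: CI1 CI2; lra.
have C4 : k' * I2 <= C by rewrite CE; move: CI1 CI2; lra.
have Hgt0 s : 0 < s -> 0 < H s by move=> s0; exact: shifted_average_gt0.
have prop := @decaying_solutions_proportional R k q (m%:R * k * (2 * k - q - m%:R * k)) k' C
  J (fun s => - k * J1 s) (fun s => k * J2 s) H (fun s => - k' * H1 s) (fun s => k' * H2 s).
exists (J 1 / H 1) => s s0.
rewrite -(prop _ _ _ _ _ _ _ _ _ _ _ _ s 1)//.
- by rewrite divfK// gt_eqF// Hgt0.
- have : 0 <= 2 * (k * (m%:R - 1)) by rewrite mulr_ge0.
  by rewrite /k'; lra.
- move=> {}s {}s0; exact: is_derive_shifted_average.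
- move=> {}s {}s0; apply: is_derive_ext (is_deriveZ (- k) (is_derive_shifted_average_power_sum1 m (lexx 1) q0 k0 s0)) _ _ => //.
  by rewrite /GRing.scale/= mulrNN.
- move=> {}s {}s0; exact: is_derive_shifted_average.
- move=> {}s {}s0; apply: is_derive_ext (is_deriveZ (- k') (is_derive_shifted_average_power_sum1 1 p'1 q'0 k'0 s0)) _ _ => //.
  by rewrite /GRing.scale/= mulrNN.
- move=> {}s {}s0; have := loop_equation m (lexx 1) q0 k0 s0.
  rewrite -/(J s) -/(J1 s) -/(J2 s) => /eqP.
  rewrite -addrA addr_eq0 => /eqP E; rewrite mulrCA E; ring.
- move=> {}s {}s0; have := loop_equation 1 p'1 q'0 k'0 s0.
  rewrite -/(H s) -/(H1 s) -/(H2 s) => /eqP.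
  rewrite -addrA addr_eq0 => /eqP E; rewrite mulrCA E /p' /q' /k'; ring.
- move=> {}s {}s0; have [/andP[a b] _] := shifted_average_bound m (lexx 1) q0 k0 s0.
  rewrite ger0_norm//; apply: le_trans b _; rewrite ler_wpM2r ?powR_ge0// -/I1.
- move=> {}s {}s0; have [/andP[a b] /andP[c d]] := shifted_average_bound m (lexx 1) q0 k0 s0.
  rewrite normrM normrN (ger0_norm k0) (ger0_norm c).
  apply: le_trans (ler_wpM2l k0 d) _; rewrite mulrA mulrA [k * _]mulrC -/k' mulrAC ler_wpM2r ?invr_ge0 ?(ltW s0)//.
  apply: le_trans (ler_wpM2l k'0 b) _; rewrite mulrA ler_wpM2r ?powR_ge0//.
- move=> {}s {}s0; have [/andP[a b] _] := shifted_average_bound 1 p'1 q'0 k'0 s0.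
  rewrite ger0_norm//; apply: le_trans b _; rewrite mul1r ler_wpM2r ?powR_ge0// -/I2.
- move=> {}s {}s0; have [/andP[a b] /andP[c d]] := shifted_average_bound 1 p'1 q'0 k'0 s0.
  rewrite normrM normrN (ger0_norm k'0) (ger0_norm c).
  apply: le_trans (ler_wpM2l k'0 d) _; rewrite div1r mulrCA mulrC ler_wpM2r ?invr_ge0 ?(ltW s0)//.
  apply: le_trans (ler_wpM2l k'0 b) _; rewrite mul1r mulrA ler_wpM2r ?powR_ge0//.
Qed.

End proportionality.

(** * Tail of the smallest eigenvalue as an average *)

Section survival.
Context {R : realType}.
Local Notation RR := (measurableTypeR R).
Local Notation lambda := (@lebesgue_measure R).

Lemma smallest_eigenvalue_gtP m (l : m.-tuple RR) x : (0 < m)%N ->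
  x < smallest_eigenvalue l <-> forall i, x < tnth l i.
Proof.
case: m l => // m l _; rewrite /smallest_eigenvalue big_tuple.
have -> : head 0 l = tnth l ord0 by rewrite (tnth_nth 0) nth0.
split=> [/bigmin_gtP[_ H] i|H]; first exact: H.
by apply/bigmin_gtP; split.
Qed.

Lemma measurable_smallest_eigenvalue_gt m (x : R) :
  measurable [set l : m.-tuple RR | x < smallest_eigenvalue l].
Proof.
have := @measurable_smallest_eigenvalue R m.
move=> /(_ measurableT `]x, +oo[%classic (measurable_itv _)); rewrite setTI.
by congr measurable; apply/seteqP; split => l /=; rewrite in_itv/= andbT.
Qed.

Lemma jacobi_weightE (beta b : R) m : 0 < beta ->
  @jacobi_weight R beta (2 / beta - 2) b m =
  @jacobi_kernel R (1 - beta / 2) (beta / 2 * (b + 1)) (beta / 2) m.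
Proof.
move=> beta0; apply/funext => t; rewrite /jacobi_weight /jacobi_kernel.
have -> : beta / 2 * (2 / beta - 2 + 1) - 1 = 1 - beta / 2 - 1.
  by field; rewrite gt_eqF.
by have -> : 2 * (beta / 2) = beta by field.
Qed.

Lemma prod_powR (I : Type) (r : seq I) (P : pred I) (y : R) (e : I -> R) : 0 < y ->
  \prod_(i <- r | P i) y `^ e i = y `^ (\sum_(i <- r | P i) e i).
Proof.
move=> y0; elim/big_rec2: _ => [|i x z Pi ->]; first by rewrite powRr0.
by rewrite powRDp.
Qed.

(** The affine map from the unit interval onto the eigenvalues above [x] turns
    the singular factor [\prod_i l_i `^ - k] into a product shifted by
    [x / (1 - x)]; all other factors are homogeneous and yield the power of
    [1 - x]. The weight of the new variable at 0 has exponent 0, that is [p = 1]. *)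
Lemma jacobi_kernel_affine (k q x : R) m (t : m.-tuple RR) : 0 <= x < 1 -> cube m t ->
  jacobi_kernel (1 - k) q k [tuple of map (fun t => x + (1 - x) * t) t] * (1 - x) ^+ m =
  (1 - x) `^ (m%:R * (q - k + k * (m%:R - 1))) *
  (jacobi_kernel 1 q k t * shift_prod k (x / (1 - x)) t).
Proof.
move=> /andP[x0 x1] tc; have y0 : 0 < 1 - x by rewrite subr_gt0.
rewrite /jacobi_kernel /shift_prod; set ft := [tuple of _].
have -> : \prod_(i < m) (tnth ft i `^ (1 - k - 1) * (1 - tnth ft i) `^ (q - 1)) =
    \prod_(i < m) ((1 - x) `^ (q - k - 1) *
      ((tnth t i `^ (1 - 1) * (1 - tnth t i) `^ (q - 1)) * (tnth t i + x / (1 - x)) `^ (- k))).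
  apply: eq_bigr => i _; rewrite tnth_map; have /andP[t0 t1] := tc i.
  have -> : 1 - (x + (1 - x) * tnth t i) = (1 - x) * (1 - tnth t i) by ring.
  have -> : x + (1 - x) * tnth t i = (1 - x) * (tnth t i + x / (1 - x)).
    by field; rewrite gt_eqF.
  rewrite !powRM ?(ltW y0) ?subr_ge0//; last first.
    by rewrite addr_ge0 ?(ltW t0)// divr_ge0// ltW.
  have -> : 1 - k - 1 = - k by ring.
  have -> : q - k - 1 = - k + (q - 1) by ring.
  rewrite (powRDp (- k) (q - 1) y0) subrr powRr0; ring.
have -> : \prod_(i < m) \prod_(j < m | (i < j)%N) `|tnth ft i - tnth ft j| `^ (2 * k) =
    \prod_(i < m) ((\prod_(j < m | (i < j)%N) (1 - x) `^ (2 * k)) *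
     \prod_(j < m | (i < j)%N) `|tnth t i - tnth t j| `^ (2 * k)).
  apply: eq_bigr => i _; rewrite -big_split; apply: eq_bigr => j _ /=.
  rewrite !tnth_map.
  have -> : x + (1 - x) * tnth t i - (x + (1 - x) * tnth t j) = (1 - x) * (tnth t i - tnth t j) by ring.
  by rewrite normrM (ger0_norm (ltW y0)) powRM// ltW.
rewrite !big_split/= prodr_const card_ord.
have -> : \prod_(i < m) \prod_(j < m | (i < j)%N) (1 - x) `^ (2 * k) = (1 - x) `^ (m%:R * (k * (m%:R - 1))).
  under eq_bigr do rewrite prod_powR//.
  rewrite prod_powR//; congr (_ `^ _).
  have H := @sum_symmetric R m (fun _ _ => k) (fun _ _ => erefl).
  have E1 : \sum_(i < m) k = m%:R * k by rewrite sumr_const card_ord mulr_natl.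
  have E2 : \sum_(i < m) \sum_(j < m) k = m%:R * (m%:R * k).
    by rewrite E1 sumr_const card_ord [RHS]mulr_natl.
  rewrite E2 E1 in H.
  have -> : \sum_(i < m) \sum_(j < m | (i < j)%N) 2 * k = 2 * \sum_(i < m) \sum_(j < m | (i < j)%N) k.
    by rewrite mulr_sumr; apply: eq_bigr => i _; rewrite mulr_sumr.
  by rewrite -[LHS](addKr (m%:R * k)) -H; ring.
have -> : m%:R * (q - k + k * (m%:R - 1)) = m%:R * (q - k - 1) + m%:R + m%:R * (k * (m%:R - 1)) by ring.
rewrite (powRDp _ (m%:R * (k * (m%:R - 1))) y0) (powRDp _ m%:R y0) powR_mulrn ?(ltW y0)//.
rewrite [m%:R * (q - k - 1)]mulrC (powRrM _ (q - k - 1)) powR_mulrn ?powR_ge0//; ring.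
Qed.

Lemma affine_change_of_variables (x : R) (f : RR -> \bar R) : 0 <= x < 1 ->
  measurable_fun setT f -> (forall y, 0 <= f y)%E ->
  (\int[lambda]_t (f (x + (1 - x) * t)%R * ((1 - x) * \1_(`]0%R, 1%R] : set R) t)%:E) =
   \int[lambda]_y (f y * (\1_(`]x, 1%R] : set R) y)%:E))%E.
Proof.
move=> /andP[x0 x1] mf f0.
have m1 : @measurable_fun _ _ RR RR setT (fun t => x + (1 - x) * t).
  by apply: measurable_funD => //; exact: measurable_funM.
have := @change_of_variables R (fun t => x + (1 - x) * t) (fun=> 1 - x) 0 1 ltr01 _ _ _ m1 (measurable_cst _) f mf f0.
rewrite mulr0 addr0 mulr1 addrCA subrr addr0; apply.
- by move=> t _; apply: is_derive_eq; rewrite /GRing.scale/=; ring.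
- by move=> t _; rewrite subr_gt0.
- by apply: continuous_subspaceT => t; exact: cvg_cst.
Qed.

(** The event is that all eigenvalues exceed [x]. *)
Lemma jacobi_survival (k q c x : R) m (mu : probability (m.-tuple RR) R) :
  (0 < m)%N -> 0 <= k -> 0 < q -> 0 < c ->
  has_density (lebesgue_tuple R m) mu [set l | forall i, 0 <= tnth l i <= 1]
    (fun l => c * jacobi_kernel (1 - k) q k l) ->
  0 < x < 1 ->
  mu [set l | x < smallest_eigenvalue l] =
  (c * ((1 - x) `^ (m%:R * (q - k + k * (m%:R - 1))) *
     shifted_average 1 q k (x / (1 - x)) (fun _ : m.-tuple RR => 1)))%:E.
Proof.
move=> m0 k0 q0 c0 [mD _ _ muE] /andP[x0 x1].
have x01 : 0 <= x < 1 by rewrite ltW.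
have y0 : 0 < 1 - x by rewrite subr_gt0.
have mA := @measurable_smallest_eigenvalue_gt m x.
rewrite muE//.
pose F (l : m.-tuple RR) : \bar R := (c * jacobi_kernel (1 - k) q k l)%:E.
have mF : measurable_fun setT F.
  by apply/measurable_EFinP; apply: measurable_funM => //; exact: measurable_jacobi_kernel.
have F0 l : (0 <= F l)%E by rewrite lee_fin mulr_ge0 ?(ltW c0)// jacobi_kernel_ge0.
pose v (t : RR) : R := \1_(`]x, 1%R] : set R) t.
transitivity (\int[lebesgue_tuple R m]_l (F l * (\prod_(i < m) v (tnth l i))%:E))%E.
  rewrite integral_mkcond; apply: eq_integral => l _.
  rewrite patchE; have [|] := boolP (l \in _); rewrite ?inE ?notin_setE => H.
    rewrite big1 ?mule1// => i _; rewrite /v indicE mem_set//= in_itv/=.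
    case: H => H /= /(smallest_eigenvalue_gtP _ _ m0) H'.
    by rewrite H'; have /andP[_ ->] := H i.
  suff [i Hi] : exists i, ~ (x < tnth l i <= 1).
    by rewrite (bigD1 i)//= /v indicE memNset ?mul0r ?mule0//= in_itv.
  apply/existsNP => H'; apply: H; split => /=.
    by move=> i; have /andP[xi ->] := H' i; rewrite andbT ltW// (lt_trans x0).
  by apply/smallest_eigenvalue_gtP => // i; have /andP[] := H' i.
pose w (t : RR) : R := (1 - x) * \1_(`]0%R, 1%R] : set R) t.
have mphi : @measurable_fun _ _ RR RR setT (fun t => x + (1 - x) * t).
  by apply: measurable_funD => //; exact: measurable_funM.
have mw : measurable_fun setT w by apply: measurable_funM => //; exact: measurable_indic.
have w0 (t : RR) : 0 <= w t by rewrite mulr_ge0 ?(ltW y0)// indicE.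
have mv : measurable_fun setT v by exact: measurable_indic.
have v0 (t : RR) : 0 <= v t by rewrite /v indicE.
rewrite -(lebesgue_tuple_change_of_variables mphi mw w0 mv v0 (fun f mf f0 => affine_change_of_variables x01 mf f0) mF F0).
have s0 : 0 < x / (1 - x) by rewrite divr_gt0.
have i1 := @integrable_shift_prod R 1 q k m (lexx 1) q0 k0 _ s0.
have mc := @measurable_cube R m.
rewrite mulrA -RintegralZl// /Rintegral fineK; last first.
  by apply: integrable_fin_num => //; exact: (integrableZl mc _ i1).
rewrite integral_cube; apply: eq_integral => t _.
rewrite /w big_split/= -indic_cube prodr_const card_ord.
have [tc|tc] := pselect (cube m t); last first.
  by rewrite indicE memNset// !mulr0 !mule0.
rewrite /F -EFinM -EFinM; congr EFin.
have K := jacobi_kernel_affine k q x01 tc.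
move: K; move: (jacobi_kernel (1 - k) _ _ _) ((1 - x) ^+ m) => u z K.
by rewrite (_ : c * u * (z * _) = c * (u * z) * \1_(cube m) t); [rewrite K|]; ring.
Qed.

(** The density vanishes as soon as one eigenvalue is 0, by the
    convention [0 `^ - k = 0]; this fixes the total mass in the limit [x -> 0]. *)
Lemma jacobi_smallest_gt0 (k q c : R) m (mu : probability (m.-tuple RR) R) :
  (0 < m)%N -> 0 < k ->
  has_density (lebesgue_tuple R m) mu [set l | forall i, 0 <= tnth l i <= 1]
    (fun l => c * jacobi_kernel (1 - k) q k l) ->
  mu [set l | 0 < smallest_eigenvalue l] = 1%E.
Proof.
move=> m0 k0 [mD _ _ muE].
have mA := @measurable_smallest_eigenvalue_gt m 0.
rewrite -[RHS](probability_setT mu) !muE// setIT.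
rewrite integral_mkcondr; apply: eq_integral => l; rewrite inE/= => lD.
rewrite patchE; have [//|] := boolP (l \in _); rewrite notin_setE => H.
have [i Hi] : exists i, ~ (0 < tnth l i).
  by apply/existsNP => H'; apply: H; apply/smallest_eigenvalue_gtP.
have li0 : tnth l i = 0.
  by apply/eqP; rewrite eq_le; have /andP[-> _] := lD i; rewrite andbT leNgt; apply/negP.
rewrite /jacobi_kernel (bigD1 i)//= li0 powR0 ?mul0r ?mulr0//.
by rewrite addrAC subrr sub0r oppr_eq0 gt_eqF.
Qed.

End survival.

(** * Elimination of the normalizing constant *)

Section survival_ratio.
Context {R : realType}.
Local Notation RR := (measurableTypeR R).
Local Notation lambda := (@lebesgue_measure R).

(** The one-point average of the previous part, with the powers of [w] grouped so
    that the last factor is at most 1 and decreases in [s]. *)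
Definition tilted_beta (k N kap s : R) (w : RR) : R :=
  w `^ (- k) * (1 - w) `^ (N - 1) * (w / (w + s)) `^ kap.

Definition tilted_beta_integral (k N kap s : R) : \bar R :=
  (\int[lambda]_(w in `]0%R, 1%R]) (tilted_beta k N kap s w)%:E)%E.

Lemma tilted_beta_ge0 k N kap s w : 0 <= tilted_beta k N kap s w.
Proof. by rewrite !mulr_ge0 ?powR_ge0. Qed.

Lemma measurable_tilted_beta k N kap s : 0 <= s ->
  @measurable_fun _ _ RR R `]0%R, +oo[%classic (tilted_beta k N kap s).
Proof.
move=> s0.
apply: (@eq_measurable_fun _ _ _ _ _ (fun w : RR => w `^ (- k) * (1 - w) `^ (N - 1) * (w * (w + s) `^ (-1)) `^ kap)).
  move=> w; rewrite inE/= in_itv/= andbT => w0.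
  by rewrite /tilted_beta powR_inv1// addr_ge0// ltW.
apply: (measurable_funS measurableT) => //.
apply: measurable_funM; first apply: measurable_funM.
- exact: measurable_powR.
- by apply: (measurableT_comp (measurable_powR _)); exact: measurable_funB.
- apply: (measurableT_comp (measurable_powR _)); apply: measurable_funM => //.
  by apply: (measurableT_comp (measurable_powR _)); exact: measurable_funD.
Qed.

Let measurable_tilted_beta01 k N kap s : 0 <= s ->
  @measurable_fun _ _ RR R `]0%R, 1%R]%classic (tilted_beta k N kap s).
Proof.
move=> s0; apply: (measurable_funS _ _ (measurable_tilted_beta k N kap s0)).
  exact: measurable_itv.
by move=> w /=; rewrite !in_itv/= andbT => /andP[].
Qed.

Lemma tilted_beta_anti k N kap s s' w : 0 <= kap -> 0 < w -> 0 <= s -> s <= s' ->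
  tilted_beta k N kap s' w <= tilted_beta k N kap s w.
Proof.
move=> kap0 w0 s0 ss'; rewrite /tilted_beta ler_wpM2l ?mulr_ge0 ?powR_ge0//.
have ws : 0 < w + s by rewrite ltr_wpDr.
have ws' : 0 < w + s' by rewrite ltr_wpDr// (le_trans s0).
apply: ge0_ler_powR => //; rewrite ?nnegrE ?divr_ge0 ?(ltW w0) ?(ltW ws) ?(ltW ws')//.
by rewrite ler_pM2l// lef_pV2 ?posrE// lerD2l.
Qed.

Lemma shifted_average1_tilted (q k s : R) m : (0 < m)%N -> 0 < s ->
  shifted_average (1 + k * (m%:R - 1)) (q + k * (m%:R - 1)) (m%:R * k) s
    (fun _ : 1.-tuple RR => 1) =
  fine (tilted_beta_integral k (q + k * (m%:R - 1)) (m%:R * k) s).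
Proof.
move=> m0 s0; rewrite shifted_average1 /Rintegral /tilted_beta_integral; congr fine.
apply: eq_integral => w; rewrite inE/= in_itv/= => /andP[w0 w1].
have ws : 0 < w + s by rewrite addr_gt0.
congr EFin; rewrite /tilted_beta powRM ?invr_ge0 ?(ltW w0) ?(ltW ws)//.
have -> : (w + s)^-1 `^ (m%:R * k) = (w + s) `^ (- (m%:R * k)).
  by rewrite -powR_inv1 ?(ltW ws)// -powRrM mulN1r.
have -> : 1 + k * (m%:R - 1) - 1 = - k + m%:R * k by ring.
by rewrite (powRDp (- k) (m%:R * k) w0); ring.
Qed.

Lemma cvg_powR1B (x : nat -> R) (e : R) : x @ \oo --> 0 ->
  (1 - x n) `^ e @[n --> \oo] --> (1 : R).
Proof.
move=> x0; have h1 : (1 - x n) @[n --> \oo] --> (1 : R).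
  by rewrite -[X in _ --> X]subr0; apply: cvgB => //; exact: cvg_cst.
have h2 := is_derive1_continuous (@is_derive1_powR R e _ ltr01).
by have := cvg_comp _ _ h1 h2; rewrite powR1.
Qed.

(** The law of the smallest eigenvalue: the unknown normalizing constant is
    eliminated by letting [x] decrease to 0. *)
Lemma jacobi_survival_ratio (k q c : R) m (mu : probability (m.-tuple RR) R) :
  (0 < m)%N -> 0 < k -> 0 < q -> 0 < c ->
  has_density (lebesgue_tuple R m) mu [set l | forall i, 0 <= tnth l i <= 1]
    (fun l => c * jacobi_kernel (1 - k) q k l) ->
  let N := q + k * (m%:R - 1) in
  0 < fine (tilted_beta_integral k N (m%:R * k) 0) /\
  forall x, 0 < x < 1 ->
  mu [set l | x < smallest_eigenvalue l] =
  ((1 - x) `^ (m%:R * (N - k)) *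
     (fine (tilted_beta_integral k N (m%:R * k) (x / (1 - x))) /
      fine (tilted_beta_integral k N (m%:R * k) 0)))%:E.
Proof.
move=> m0 k0 q0 c0 dens N.
have [C CE] := @shifted_average_proportional R q k m m0 q0 (ltW k0).
pose I s := tilted_beta_integral k N (m%:R * k) s.
have mk0 : 0 <= m%:R * k by rewrite mulr_ge0// ltW.
have muE x : 0 < x < 1 -> mu [set l | x < smallest_eigenvalue l] =
    ((1 - x) `^ (m%:R * (N - k)) * (c * C * fine (I (x / (1 - x)))))%:E.
  move=> x01; rewrite (jacobi_survival m0 (ltW k0) q0 c0 dens x01); congr EFin.
  have /andP[x0 x1] := x01.
  have s0 : 0 < x / (1 - x) by rewrite divr_gt0 ?subr_gt0.
  rewrite CE// shifted_average1_tilted// /N.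
  have -> : q - k + k * (m%:R - 1) = q + k * (m%:R - 1) - k by ring.
  by rewrite /I /N; ring.
pose x n : R := n.+2%:R^-1.
have x01 n : 0 < x n < 1.
  by rewrite /x invr_gt0 ltr0n/= invf_lt1 ?ltr0n// ltr1n.
have x_decr n n' : (n <= n')%N -> x n' <= x n.
  by move=> nn; rewrite /x lef_pV2 ?posrE ?ltr0n// ler_nat.
have cvx : x @ \oo --> (0 : R) by have := @cvg_harmonic R; rewrite -cvg_shiftS.
have cvmu : mu [set l | x n < smallest_eigenvalue l] @[n --> \oo] --> 1%:E.
  have <- := jacobi_smallest_gt0 m0 k0 dens.
  have mS := @measurable_smallest_eigenvalue_gt R m.
  have -> : [set l : m.-tuple RR | 0 < smallest_eigenvalue l] =
      \bigcup_n [set l : m.-tuple RR | x n < smallest_eigenvalue l].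
    apply/seteqP; split => l /=.
      move=> l0; move/cvgrPdist_lt : cvx => /(_ _ l0)[n _ Hn]; exists n => //=.
      have := Hn n (leqnn n); rewrite sub0r normrN ger0_norm//.
      by have /andP[/ltW] := x01 n.
    by move=> [n _] /=; apply: lt_trans; have /andP[] := x01 n.
  apply: nondecreasing_cvg_mu => //; first exact: bigcup_measurable.
  apply/nondecreasing_seqP => n; apply/subsetPset => l /=.
  by apply: le_lt_trans; exact: x_decr.
pose s n := x n / (1 - x n).
have s0 n : 0 < s n by have /andP[a b] := x01 n; rewrite divr_gt0// subr_gt0.
have s_decr n n' : (n <= n')%N -> s n' <= s n.
  move=> /x_decr h; have /andP[a b] := x01 n; have /andP[a' b'] := x01 n'.
  rewrite /s ler_pM ?(ltW a') ?invr_ge0 ?subr_ge0 ?(ltW b')//.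
  by rewrite lef_pV2 ?posrE ?subr_gt0// lerD2l lerN2.
have cvs : s @ \oo --> (0 : R).
  rewrite -(mul0r (1 - 0)^-1); apply: cvgM => //.
  apply: cvgV; first by rewrite subr0 oner_neq0.
  by apply: cvgB => //; exact: cvg_cst.
have mI01 : measurable (`]0%R, 1%R]%classic : set RR) by exact: measurable_itv.
have cvI : I (s n) @[n --> \oo] --> I 0.
  have -> : I 0 = (\int[lambda]_(w in `]0%R, 1%R])
      (fun w : RR => limn (fun n => (tilted_beta k N (m%:R * k) (s n) w)%:E)) w)%E.
    apply: eq_integral => w; rewrite inE/= in_itv/= => /andP[w0 w1].
    apply/esym/cvg_lim => //; apply: cvg_EFin; first exact: nearW.
    rewrite /tilted_beta addr0 divff ?gt_eqF// powR1.
    apply: cvgM; first exact: cvg_cst.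
    have h1 : w / (w + s n) @[n --> \oo] --> (1 : R).
      have h : (w + s n)^-1 @[n --> \oo] --> w^-1.
        apply: cvgV; first by rewrite gt_eqF.
        by rewrite -[X in _ --> X]addr0; apply: cvgD => //; exact: cvg_cst.
      by rewrite -(divff (lt0r_neq0 w0)); apply: cvgM => //; exact: cvg_cst.
    have h2 := is_derive1_continuous (@is_derive1_powR R (m%:R * k) _ ltr01).
    by have := cvg_comp _ _ h1 h2; rewrite powR1.
  apply: (@cvg_monotone_convergence _ _ _ lambda `]0%R, 1%R]%classic mI01
    (fun n w => (tilted_beta k N (m%:R * k) (s n) w)%:E)) => //.
  - by move=> n; apply/measurable_EFinP; apply: measurable_tilted_beta01; exact: ltW.
  - by move=> n w _; rewrite lee_fin tilted_beta_ge0.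
  - move=> w /=; rewrite in_itv/= => /andP[w0 w1] n n' nn; rewrite lee_fin.
    by apply: tilted_beta_anti => //; [exact: ltW|exact: s_decr].
have I_ge0 y : (0 <= I y)%E by apply: integral_ge0 => w _; rewrite lee_fin tilted_beta_ge0.
have cvr : c * C * fine (I (s n)) @[n --> \oo] --> (1 : R).
  have h1 : (1 - x n) `^ (m%:R * (N - k)) * (c * C * fine (I (s n))) @[n --> \oo] --> (1 : R).
    by move: cvmu; under eq_fun do rewrite muE//; move=> /fine_cvgP[].
  have h2 := cvg_powR1B (m%:R * (N - k)) cvx.
  have h3 := cvgM (cvgV (oner_neq0 R) h2) h1.
  rewrite invr1 mulr1 in h3.
  suff -> : (fun n => c * C * fine (I (s n))) = (fun n => ((1 - x n) `^ (m%:R * (N - k)))^-1 *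
      ((1 - x n) `^ (m%:R * (N - k)) * (c * C * fine (I (s n))))) by exact: h3.
  apply/funext => n; rewrite mulKf// gt_eqF// powR_gt0// subr_gt0.
  by have /andP[] := x01 n.
have cC0 : 0 < c * C.
  rewrite ltNge; apply/negP => cC.
  have : 1 <= (0 : R).
    rewrite -(cvg_lim (@Rhausdorff R) cvr); apply: limr_le; first by apply: cvgP cvr.
    by apply: nearW => n; rewrite mulr_le0_ge0// fine_ge0.
  by rewrite ler10.
have cvI' : fine (I (s n)) @[n --> \oo] --> (c * C)^-1.
  have h := cvgM (@cvg_cst _ (c * C)^-1 _ \oo _) cvr.
  rewrite mulr1 in h.
  suff -> : (fun n => fine (I (s n))) = (fun n => (c * C)^-1 * (c * C * fine (I (s n)))) by exact: h.
  by apply/funext => n; rewrite mulKf// gt_eqF.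
have Ifin n : I (s n) \is a fin_num.
  have : 0 < fine (I (s n)).
    rewrite /I /N -shifted_average1_tilted//.
    have km : 0 <= k * (m%:R - 1) by rewrite mulr_ge0 ?(ltW k0)// subr_ge0 ler1n.
    by apply: shifted_average_gt0 => //; [rewrite lerDl|rewrite ltr_wpDr].
  by move: (I_ge0 (s n)); case: (I (s n)) => //=; rewrite ltxx.
have I0E : I 0 = (c * C)^-1%:E.
  apply: (cvg_unique _ cvI) => //.
  rewrite (_ : (fun n => I (s n)) = (fun n => (fine (I (s n)))%:E)).
    by apply: cvg_EFin => //; exact: nearW.
  by apply/funext => n; rewrite fineK.
split; first by rewrite -/(I 0) I0E /= invr_gt0.
move=> y y01; rewrite (muE y y01) -/(I 0) -/(I (y / (1 - y))) I0E /= invrK.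
by congr EFin; rewrite [c * C * _]mulrC.
Qed.

End survival_ratio.

(** * Gamma kernels *)

Section gamma_kernel.
Context {R : realType}.
Local Notation RR := (measurableTypeR R).
Local Notation lambda := (@lebesgue_measure R).

Lemma integral_powR01 (r : R) : 0 < r ->
  (\int[lambda]_(t in `]0%R, 1%R]) (t `^ (r - 1))%:E = r^-1%:E)%E.
Proof.
move=> r0.
have c0 : (fun n => n.+2%:R^-1 : R) @ \oo --> (0 : R) by have := @cvg_harmonic R; rewrite -cvg_shiftS.
have n2 n : 0 < (n.+2%:R^-1 : R) < 1.
  by rewrite invr_gt0 ltr0n/= invf_lt1 ?ltr0n// ltr1n.
have decr n : (n.+3%:R^-1 : R) <= n.+2%:R^-1 by rewrite lef_pV2 ?posrE ?ltr0n// ler_nat.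
have DE (x : R) : (`]0, 1]%classic : set R) x <-> exists n, n.+2%:R^-1 <= x <= 1.
  rewrite /= in_itv/=; split => [/andP[x0 x1]|[n]]; last first.
    by move: (n2 n); move: (_^-1) => z; lra.
  have [N _ HN] : \forall n \near \oo, (n.+2%:R^-1 : R) < x.
    by move/cvgrPdist_lt : c0 => /(_ _ x0); apply: filterS => n; rewrite sub0r normrN gtr0_norm// invr_gt0.
  by exists N; rewrite x1 andbT ltW// HN//=.
have dF (x : R) : (`]0, 1]%classic : set R) x ->
    is_derive x (1 : R) (fun t => r^-1 * t `^ r) (x `^ (r - 1)).
  rewrite /= in_itv/= => /andP[x0 _].
  apply: is_derive_ext (is_deriveZ r^-1 (@is_derive1_powR R r x x0)) _ _ => //.
  by rewrite /GRing.scale/= mulKf// gt_eqF.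
have cf (x : R) : (`]0, 1]%classic : set R) x -> {for x, continuous (fun t : R => t `^ (r - 1))}.
  rewrite /= in_itv/= => /andP[x0 _].
  exact: is_derive1_continuous (@is_derive1_powR R _ _ x0).
have ab n : (n.+2%:R^-1 : R) < 1 by have /andP[] := n2 n.
have cv : (fun n => r^-1 * 1 `^ r - r^-1 * n.+2%:R^-1 `^ r) @ \oo --> r^-1.
  rewrite [X in _ --> X](_ : _ = r^-1 * 1 `^ r - r^-1 * 0); last by rewrite powR1; ring.
  apply: cvgB; first exact: cvg_cst.
  apply: cvgM; first exact: cvg_cst.
  by apply: powR_cvg0_seq.
by have [_ ->] := @ge0_FTC_exhaust _ (fun t => t `^ (r - 1)) (fun t => r^-1 * t `^ r)
  (fun n => n.+2%:R^-1) (fun n => 1) `]0, 1]%classic r^-1 ab decr (fun n => lexx _) DE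
  (fun x _ => powR_ge0 _ _) dF cf cv.
Qed.

Lemma expR_Nscale_cvg0 (c y : R) : 0 < c -> expR (- (c * (y + n.+1%:R))) @[n --> \oo] --> (0 : R).
Proof.
move=> c0; apply/cvgrPdist_lt => e e0.
have H : (c * e)^-1 * n.+1%:R^-1 @[n --> \oo] --> (0 : R).
  rewrite -(mulr0 (c * e)^-1); apply: cvgM; first exact: cvg_cst.
  exact: cvg_harmonic.
have E0 : 0 < expR (- (c * y)) by exact: expR_gt0.
move/cvgrPdist_lt : H => /(_ (expR (- (c * y)))^-1); rewrite invr_gt0 => /(_ E0).
apply: filterS => n; rewrite !sub0r !normrN !gtr0_norm ?expR_gt0 ?mulr_gt0 ?invr_gt0 ?mulr_gt0//.
rewrite -invfM ltf_pV2 ?posrE ?mulr_gt0// => H.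
rewrite mulrDr opprD expRD expRN [X in _ * X]expRN.
rewrite ltr_pdivrMr ?expR_gt0//.
apply: (@lt_le_trans _ _ (e * (c * n.+1%:R))); first by rewrite mulrA [e * c]mulrC -expRN.
rewrite ler_wpM2l ?(ltW e0)//; apply: le_trans _ (expR_ge1Dx _); lra.
Qed.

Lemma integral_expR_tail (c y : R) : 0 < c ->
  (\int[lambda]_(t in `]y, +oo[) (expR (- (c * t)))%:E = (expR (- (c * y)) / c)%:E)%E.
Proof.
move=> c0.
have DE (x : R) : (`[y, +oo[%classic : set R) x <-> exists n, y <= x <= y + n.+1%:R.
  rewrite /= in_itv/= andbT; split=> [yx|[n /andP[//]]].
  exists (Num.truncn (x - y)); rewrite yx /= -lerBlDl ltW//.
  by rewrite truncnS_gt.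
have dE (x : R) : is_derive x (1 : R) (fun t => expR (- (c * t))) (- c * expR (- (c * x))).
  have h : is_derive x (1 : R) (fun t : R => - (c * t)) (- c).
    by apply: is_derive_eq; rewrite /GRing.scale/=; ring.
  apply: is_derive_ext (@is_derive1_comp _ expR _ x _ _ (is_derive_expR _) h) _ _ => //.
  by rewrite mulrC.
have dF (x : R) : is_derive x (1 : R) (fun t => - c^-1 * expR (- (c * t))) (expR (- (c * x))).
  apply: is_derive_ext (is_deriveZ (- c^-1) (dE x)) _ _ => //.
  by rewrite /GRing.scale/=; field; rewrite gt_eqF.
have cv : (fun n => - c^-1 * expR (- (c * (y + n.+1%:R))) - - c^-1 * expR (- (c * y))) @ \oo --> expR (- (c * y)) / c.
  rewrite [X in _ --> X](_ : _ = - c^-1 * 0 - - c^-1 * expR (- (c * y))); last by ring.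
  apply: cvgB; last exact: cvg_cst.
  by apply: cvgM; [exact: cvg_cst|exact: expR_Nscale_cvg0].
have [mf intE] := @ge0_FTC_exhaust R (fun t => expR (- (c * t))) (fun t => - c^-1 * expR (- (c * t)))
  (fun n => y) (fun n => y + n.+1%:R) `[y, +oo[%classic (expR (- (c * y)) / c)
  ltac:(by move=> n; rewrite ltrDl) (fun n => lexx _) ltac:(by move=> n; rewrite lerD2l ler_nat) DE
  (fun x _ => expR_ge0 _) (fun x _ => dF x) (fun x _ => is_derive1_continuous (dE x)) cv.
rewrite -intE integral_itv_obnd_cbnd//; apply/measurable_EFinP.
by apply: (measurable_funS _ _ mf); [exact: measurable_itv|move=> x /=; rewrite !in_itv/= !andbT => /ltW].
Qed.

Definition gamma_kernel (r c : R) (u : RR) : R := u `^ (r - 1) * expR (- (c * u)).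

Lemma measurable_gamma_kernel r c : measurable_fun setT (gamma_kernel r c).
Proof.
apply: measurable_funM; first exact: measurable_powR.
by apply: measurableT_comp => //; apply: measurableT_comp => //.
Qed.

Lemma gamma_kernel_ge0 r c u : 0 <= gamma_kernel r c u.
Proof. by rewrite mulr_ge0 ?powR_ge0 ?expR_ge0. Qed.

(** The logarithm is sublinear, so half of the exponential absorbs the power. *)
Lemma gamma_kernel_tail (r c : R) : 0 < c -> exists2 K : R, 0 <= K &
  forall u, 1 <= u -> gamma_kernel r c u <= K * expR (- (c / 2 * u)).
Proof.
move=> c0; pose a := `|r - 1| + 1; have a0 : 0 < a by rewrite ltr_wpDl.
pose eps := c / 2 / a; have eps0 : 0 < eps by rewrite !divr_gt0.
exists (expR (a * `|ln eps|)) => [|u u1]; first exact: expR_ge0.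
have u0 : 0 < u by lra.
rewrite /gamma_kernel /powR gt_eqF// -!expRD ler_expR.
have lnu : 0 <= ln u by exact: ln_ge0.
have h1 : (r - 1) * ln u <= a * ln u.
  by rewrite ler_wpM2r// /a; have := ler_norm (r - 1); lra.
have h2 : ln u <= eps * u - ln eps.
  by rewrite lerBrDl -lnM ?posrE// ltW// ln_sublinear// mulr_gt0.
have h3 : a * ln u <= a * (eps * u - ln eps) by rewrite ler_pM2l.
have h4 : a * (eps * u) = c / 2 * u by rewrite /eps; field; rewrite gt_eqF.
have h5 : a * (- ln eps) <= a * `|ln eps| by rewrite ler_pM2l// -normrN ler_norm.
move: h3; rewrite mulrDr h4 => h3.
rewrite (_ : - (c * u) = - (c / 2 * u) - (c / 2 * u)); last by field.
move: h1 h3 h5; set z := c / 2 * u; lra.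
Qed.

Let m0y : measurable (`]0%R, +oo[%classic : set RR). Proof. exact: measurable_itv. Qed.

Lemma integrable_gamma_kernel (r c : R) : 0 < r -> 0 < c ->
  lambda.-integrable `]0%R, +oo[%classic (EFin \o gamma_kernel r c).
Proof.
move=> r0 c0; have [K K0 HK] := gamma_kernel_tail r c0.
have mg D : measurable_fun D (EFin \o gamma_kernel r c).
  by apply/measurable_EFinP; apply: (measurable_funS measurableT) => //; exact: measurable_gamma_kernel.
apply/integrableP; split => //.
under eq_integral do rewrite /= ger0_norm ?gamma_kernel_ge0//.
have -> : `]0%R, +oo[%classic = `]0%R, 1%R] `|` `]1%R, +oo[%classic :> set RR.
  apply/seteqP; split => x /=; rewrite !in_itv/= !andbT.
    by move=> x0; rewrite x0/=; have [|] := leP x 1; [left|right].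
  by move=> [/andP[]//|]; apply: lt_trans.
have m01 : measurable (`]0%R, 1%R]%classic : set RR) by exact: measurable_itv.
have m1y : measurable (`]1%R, +oo[%classic : set RR) by exact: measurable_itv.
rewrite ge0_integral_setU//=; last 2 first.
- by move=> x _; rewrite lee_fin gamma_kernel_ge0.
- apply/disj_setPS => x /= []; rewrite !in_itv/= andbT; lra.
apply: lte_add_pinfty.
  apply: (@le_lt_trans _ _ (\int[lambda]_(t in `]0%R, 1%R]) (t `^ (r - 1))%:E)%E); last first.
    by rewrite integral_powR01// ltry.
  apply: ge0_le_integral => //.
  - by move=> x _; rewrite lee_fin gamma_kernel_ge0.
  - have mp : measurable_fun (`]0%R, 1%R]%classic : set RR) (fun x : RR => x `^ (r - 1)).
      by apply: (measurable_funS measurableT) => //; exact: measurable_powR.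
    exact: (measurable_EFinP _ _).2 mp.
  - move=> x /=; rewrite in_itv/= => /andP[x0 x1].
    rewrite lee_fin -[leRHS]mulr1 ler_wpM2l ?powR_ge0// -expR0 ler_expR oppr_le0.
    by rewrite mulr_ge0 ?ltW.
apply: (@le_lt_trans _ _ (\int[lambda]_(t in `]1%R, +oo[) (K%:E * (expR (- (c / 2 * t)))%:E))%E).
  have me : measurable_fun (`]1%R, +oo[%classic : set RR) (fun t : RR => (expR (- (c / 2 * t)))%:E).
    apply/measurable_EFinP; apply: (measurable_funS measurableT) => //.
    by apply: measurableT_comp => //; apply: measurableT_comp => //.
  apply: ge0_le_integral => //.
  - by move=> x _; rewrite lee_fin gamma_kernel_ge0.
  - exact: measurable_funeM.
  - by move=> x /=; rewrite in_itv/= andbT => x1; rewrite -EFinM lee_fin HK// ltW.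
rewrite ge0_integralZl_EFin//; last first.
  apply/measurable_EFinP; apply: (measurable_funS measurableT) => //.
  by apply: measurableT_comp => //; apply: measurableT_comp => //.
by rewrite integral_expR_tail ?divr_gt0// -EFinM ltry.
Qed.

End gamma_kernel.

(** * The scaling limit of the beta integrals *)

Section scaling_limit.
Context {R : realType}.
Local Notation RR := (measurableTypeR R).
Local Notation lambda := (@lebesgue_measure R).

(** Compare [e ln (1 + a)] with [e a]: the difference is at most
    [2 |e a| |a|]. *)
Lemma powR1D_cvg (a e : nat -> R) (L : R) : a @ \oo --> (0 : R) ->
  e n * a n @[n --> \oo] --> L -> (1 + a n) `^ (e n) @[n --> \oo] --> expR L.
Proof.
move=> a0 eaL.
have lnE : e n * ln (1 + a n) @[n --> \oo] --> L.
  have d0 : e n * ln (1 + a n) - e n * a n @[n --> \oo] --> (0 : R).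
    have b0 : 2 * (`|e n * a n| * `|a n|) @[n --> \oo] --> (0 : R).
      rewrite -(mulr0 2) -(mulr0 `|L|); apply: cvgM; first exact: cvg_cst.
      by apply: cvgM; [exact: cvg_norm|rewrite -(normr0 R); exact: cvg_norm].
    apply/norm_cvg0P; apply: (squeeze_cvgr _ (@cvg_cst _ 0 _ _ _) b0).
    have : \forall n \near \oo, `|a n| <= 1 / 2.
      move/cvgrPdist_le : a0 => /(_ (1 / 2) ltac:(lra)).
      by apply: filterS => n; rewrite sub0r normrN.
    apply: filterS => n an; rewrite normr_ge0/=.
    have := an; rewrite ler_norml => /andP[al au].
    have := @ln1D_ge R (a n) ltac:(lra); have := @le_ln1Dx R (a n) ltac:(lra) => h1 h2.
    rewrite -mulrBr normrM (_ : 2 * _ = `|e n| * (2 * a n ^+ 2)); last first.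
      by rewrite normrM -(real_normK (num_real (a n))); ring.
    by rewrite ler_wpM2l// ler_norml; have := sqr_ge0 (a n); lra.
  rewrite -(add0r L) (_ : (fun n => _) = (fun n => (e n * ln (1 + a n) - e n * a n) + e n * a n)).
    exact: cvgD d0 eaL.
  by apply/funext => n; rewrite subrK.
have := cvg_comp _ _ lnE (@continuous_expR R L).
move=> h; apply: cvg_trans h; apply: near_eq_cvg.
have : \forall n \near \oo, `|a n| <= 1 / 2.
  move/cvgrPdist_le : a0 => /(_ (1 / 2) ltac:(lra)).
  by apply: filterS => n; rewrite sub0r normrN.
apply: filterS => n; rewrite ler_norml => /andP[al au] /=.
by rewrite /powR gt_eqF//; lra.
Qed.

Lemma powRVN (x r : R) : 0 <= x -> x^-1 `^ r = x `^ (- r).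
Proof. by move=> x0; rewrite -powR_inv1// -powRrM mulN1r. Qed.

(** [tilted_beta] after the substitution [w = u / N], extended by 0 to the half line
    so that dominated convergence applies on a fixed domain. *)
Definition scaled_beta (k N kap s : R) (u : RR) : R :=
  \1_(`]0%R, N] : set R) u * (u `^ (- k) * (1 - u / N) `^ (N - 1) * (u / (u + N * s)) `^ kap).

Lemma scaled_beta_ge0 k N kap s u : 0 <= scaled_beta k N kap s u.
Proof. by rewrite /scaled_beta !mulr_ge0 ?powR_ge0// indicE. Qed.

Lemma measurable_scaled_beta (k N kap s : R) : 0 <= N -> 0 <= s ->
  measurable_fun (`]0%R, +oo[%classic : set RR) (scaled_beta k N kap s).
Proof.
move=> N0 s0.
apply: (@eq_measurable_fun _ _ _ _ _ (fun u : RR => \1_(`]0%R, N] : set R) u *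
  (u `^ (- k) * (1 - u / N) `^ (N - 1) * (u * (u + N * s) `^ (-1)) `^ kap))).
  move=> u; rewrite inE/= in_itv/= andbT => u0.
  by rewrite /scaled_beta powR_inv1// addr_ge0 ?mulr_ge0// ltW.
apply: (measurable_funS measurableT) => //.
apply: measurable_funM; first exact: measurable_indic.
apply: measurable_funM; first apply: measurable_funM.
- exact: measurable_powR.
- apply: (measurableT_comp (measurable_powR _)); apply: measurable_funB => //.
  exact: measurable_funM.
- apply: (measurableT_comp (measurable_powR _)); apply: measurable_funM => //.
  by apply: (measurableT_comp (measurable_powR _)); exact: measurable_funD.
Qed.

Lemma tilted_beta_integral_scaled (k N kap s : R) : 0 < N -> 0 <= s ->
  (tilted_beta_integral k N kap s = (N `^ (k - 1))%:E *
   \int[lambda]_(u in `]0%R, +oo[) (scaled_beta k N kap s u)%:E)%E.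
Proof.
move=> N0 s0; rewrite /tilted_beta_integral.
pose f := (EFin \o tilted_beta k N kap s) \_ (`]0%R, 1%R]%classic : set RR).
have m01 : measurable (`]0%R, 1%R]%classic : set RR) by exact: measurable_itv.
have mt : measurable_fun (`]0%R, 1%R]%classic : set RR) (tilted_beta k N kap s).
  apply: (measurable_funS _ _ (measurable_tilted_beta k N kap s0)).
    exact: measurable_itv.
  by move=> w /=; rewrite !in_itv/= andbT => /andP[].
have mf : measurable_fun setT f.
  by apply/(measurable_restrictT _ m01); exact/measurable_EFinP.
have f0 y : (0 <= f y)%E.
  by rewrite /f patchE; case: ifP => // _; rewrite lee_fin tilted_beta_ge0.
have mphi : @measurable_fun _ _ RR RR setT (fun u => u / N) by exact: measurable_funM.
have d1 (u : R) : 0 <= u <= N -> is_derive u (1 : R) (fun u => u / N) N^-1.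
  by move=> _; apply: is_derive_eq; rewrite /GRing.scale/=; ring.
have d2 (u : R) : 0 <= u <= N -> 0 < N^-1 by move=> _; rewrite invr_gt0.
have d3 : {within `[0, N], continuous (fun=> N^-1 : R)}.
  by apply: continuous_subspaceT => t; exact: cvg_cst.
have := @change_of_variables R (fun u => u / N) (fun=> N^-1) 0 N N0 d1 d2 d3 mphi (measurable_cst _) f mf f0.
rewrite mul0r divff ?gt_eqF// => cov.
transitivity (\int[lambda]_y (f y * (\1_(`]0%R, 1%R] : set R) y)%:E))%E.
  rewrite integral_mkcond; apply: eq_integral => w _.
  by rewrite /f patchE indicE; case: ifP; rewrite ?mule1 ?mule0.
rewrite -cov.
have sb0 u := scaled_beta_ge0 k N kap s u.
rewrite [X in (_ * X)%E]integral_mkcond -ge0_integralZl_EFin ?powR_ge0//.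
- apply: eq_integral => u _; rewrite patchE.
  have [|uN] := boolP (u \in (`]0%R, N]%classic : set R)); last first.
    rewrite indicE memNset ?mulr0 ?mule0//; last by rewrite -notin_setE.
    case: ifP => _; rewrite ?mule0// /scaled_beta indicE (negbTE uN) mul0r mule0//.
  rewrite inE/= in_itv/= => /andP[u0 uN].
  rewrite mem_set/=; last by rewrite in_itv/= u0.
  rewrite /scaled_beta indicE mem_set/=; last by rewrite in_itv/= u0.
  rewrite /f patchE mem_set/=; last by rewrite in_itv/= divr_gt0// ler_pdivrMr// mul1r.
  rewrite mulr1 mul1r -!EFinM /tilted_beta; congr EFin.
  have -> : u / N / (u / N + s) = u / (u + N * s).
    by field; rewrite !gt_eqF// ?ltr_wpDr ?mulr_ge0 ?divr_gt0// ltW.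
  have -> : (u / N) `^ (- k) = u `^ (- k) * N `^ k.
    rewrite powRM ?invr_ge0 ?(ltW u0) ?(ltW N0)//; congr (_ * _).
    by rewrite -powR_inv1 ?(ltW N0)// -powRrM mulrN mulN1r opprK.
  by rewrite (powRB1 k N0); ring.
- move=> u _; rewrite patchE; case: ifP => // _; by rewrite lee_fin.
- apply/(measurable_restrictT _ (measurable_itv _)).
  by apply/measurable_EFinP; apply: measurable_scaled_beta => //; exact: ltW.
Qed.

(** From [1 - x <= exp (- x)]: for [N >= 2] half of the exponential decay is left,
    uniformly in [N]. *)
Lemma scaled_beta_le (k N kap s u : R) : 2 <= N -> 0 <= s -> 0 <= kap -> 0 < u ->
  scaled_beta k N kap s u <= gamma_kernel (1 - k) (1 / 2) u.
Proof.
move=> N2 s0 kap0 u0; have N0 : 0 < N by lra.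
rewrite /scaled_beta indicE.
have [|_] := boolP (u \in (`]0%R, N]%classic : set R)); last first.
  by rewrite mul0r; exact: gamma_kernel_ge0.
rewrite inE/= in_itv/= => /andP[_ uN]; rewrite [leLHS]mul1r /gamma_kernel.
have -> : 1 - k - 1 = - k by ring.
rewrite -[leLHS]mulrA ler_wpM2l ?powR_ge0// -[leRHS]mulr1.
have uN1 : u / N <= 1 by rewrite ler_pdivrMr// mul1r.
apply: ler_pM; rewrite ?powR_ge0//.
- have h : 1 - u / N <= expR (- (u / N)) by exact: expR_ge1Dx.
  have h1 : (1 - u / N) `^ (N - 1) <= expR (- (u / N)) `^ (N - 1).
    by apply: ge0_ler_powR => //; rewrite ?nnegrE ?expR_ge0 ?subr_ge0//; lra.
  apply: (le_trans h1); rewrite -expRM ler_expR mulNr lerN2.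
  rewrite (_ : u / N * (N - 1) = u - u / N); last by field; rewrite gt_eqF.
  have : u / N <= u / 2 by rewrite ler_pM2l// lef_pV2 ?posrE.
  lra.
- apply: powR_le1 => //.
  have us : 0 < u + N * s by rewrite ltr_wpDr// mulr_ge0// ltW.
  by rewrite divr_ge0 ?(ltW u0) ?(ltW us)//= ler_pdivrMr// mul1r lerDl mulr_ge0// ltW.
Qed.

Lemma scaled_beta_cvg_pointwise (k L u : R) (N kap s : nat -> R) : 0 < u ->
  (forall n, 2 <= N n) -> N @ \oo --> +oo -> (forall n, 0 <= s n) ->
  N n * s n @[n --> \oo] --> (0 : R) -> kap n * (N n * s n) @[n --> \oo] --> L ->
  scaled_beta k (N n) (kap n) (s n) u @[n --> \oo] -->
  gamma_kernel (1 - k) 1 u * expR (- (L / u)).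
Proof.
move=> u0 N2 Ny s0 Ns0 kNs.
have N0 n : 0 < N n by have := N2 n; lra.
have Ni : (N n)^-1 @[n --> \oo] --> (0 : R).
  by apply/gtr0_cvgV0 => //; exact: nearW.
have uN : u / N n @[n --> \oo] --> (0 : R).
  by rewrite -(mulr0 u); apply: cvgM => //; exact: cvg_cst.
have h1 : (1 + (- (u / N n))) `^ (N n - 1) @[n --> \oo] --> expR (- u).
  apply: powR1D_cvg; first by rewrite -oppr0; exact: cvgN.
  rewrite (_ : (fun n => _) = (fun n => - u + u / N n)); last first.
    by apply/funext => n; field; rewrite gt_eqF.
  by rewrite -[X in _ --> X]addr0; apply: cvgD => //; exact: cvg_cst.
have h2 : (1 + (N n * s n / u)) `^ (- kap n) @[n --> \oo] --> expR (- (L / u)).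
  apply: powR1D_cvg.
    by rewrite -(mul0r u^-1); apply: cvgM => //; exact: cvg_cst.
  rewrite (_ : (fun n => _) = (fun n => - (kap n * (N n * s n) / u))); last first.
    by apply/funext => n; ring.
  by apply: cvgN; apply: cvgM => //; exact: cvg_cst.
have h3 : u `^ (- k) * (1 + (- (u / N n))) `^ (N n - 1) * (1 + (N n * s n / u)) `^ (- kap n)
    @[n --> \oo] --> u `^ (- k) * expR (- u) * expR (- (L / u)).
  by apply: cvgM => //; apply: cvgM => //; exact: cvg_cst.
have -> : gamma_kernel (1 - k) 1 u * expR (- (L / u)) = u `^ (- k) * expR (- u) * expR (- (L / u)).
  by rewrite /gamma_kernel mul1r; congr (_ `^ _ * _ * _); ring.
apply: cvg_trans h3; apply: near_eq_cvg.
move/cvgryPge : Ny => /(_ u); apply: filterS => n uNn /=.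
rewrite /scaled_beta indicE mem_set/= ?in_itv/= ?u0// mul1r; congr (_ * _).
rewrite (_ : u / (u + N n * s n) = (1 + N n * s n / u)^-1).
  by rewrite powRVN// ?addr_ge0 ?divr_ge0 ?mulr_ge0 ?(ltW u0) ?(ltW (N0 n)).
have x0 : 0 <= N n * s n by rewrite mulr_ge0// ltW.
by field; rewrite !gt_eqF// ltr_wpDr.
Qed.

(** [(1 - u / N) `^ (N - 1)] tends to [exp (- u)], and the tilt tends to
    [exp (- L / u)]: it is [(1 + N s / u) `^ - kap] with [kap N s -> L]. *)
Lemma scaled_beta_integral_cvg (k L : R) (N kap s : nat -> R) : k < 1 ->
  (forall n, 2 <= N n) -> N @ \oo --> +oo -> (forall n, 0 <= s n) ->
  (forall n, 0 <= kap n) ->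
  N n * s n @[n --> \oo] --> (0 : R) -> kap n * (N n * s n) @[n --> \oo] --> L ->
  (\int[lambda]_(u in `]0%R, +oo[) (scaled_beta k (N n) (kap n) (s n) u)%:E @[n --> \oo] -->
  \int[lambda]_(u in `]0%R, +oo[) (gamma_kernel (1 - k) 1 u * expR (- (L / u)))%:E)%E.
Proof.
move=> k1 N2 Ny s0 kap0 Ns0 kNs.
have m0y : measurable (`]0%R, +oo[%classic : set RR) by exact: measurable_itv.
have cvu (u : RR) : (`]0%R, +oo[%classic : set RR) u ->
    scaled_beta k (N n) (kap n) (s n) u @[n --> \oo] --> gamma_kernel (1 - k) 1 u * expR (- (L / u)).
  by rewrite /= in_itv/= andbT => u0; exact: scaled_beta_cvg_pointwise.
have msb n : measurable_fun (`]0%R, +oo[%classic : set RR) (scaled_beta k (N n) (kap n) (s n)).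
  by apply: measurable_scaled_beta => //; have := N2 n; lra.
pose F n (u : RR) := (scaled_beta k (N n) (kap n) (s n) u)%:E.
pose G (u : RR) := (gamma_kernel (1 - k) 1 u * expR (- (L / u)))%:E.
have mF n : measurable_fun (`]0%R, +oo[%classic : set RR) (F n) by exact/measurable_EFinP.
have mG : measurable_fun (`]0%R, +oo[%classic : set RR) G.
  by apply/measurable_EFinP; exact: (measurable_fun_cvg msb cvu).
have aFG : {ae lambda, forall u, (`]0%R, +oo[%classic : set RR) u -> F ^~ u @ \oo --> G u}.
  by apply: aeW => u uD; apply: cvg_EFin; [exact: nearW|exact: cvu].
have ig : lambda.-integrable `]0%R, +oo[%classic (EFin \o gamma_kernel (1 - k) (1 / 2)).
  by apply: integrable_gamma_kernel; lra.
have aFg : {ae lambda, forall u n, (`]0%R, +oo[%classic : set RR) u ->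
    (`|F n u| <= (EFin \o gamma_kernel (1 - k) (1 / 2)) u)%E}.
  apply: aeW => u n; rewrite /= in_itv/= andbT => u0.
  by rewrite lee_fin ger0_norm ?scaled_beta_ge0// scaled_beta_le.
by have [_ _] := dominated_convergence m0y mF mG aFG ig aFg.
Qed.

End scaling_limit.

(** * The Gamma function *)

Section half_line_derivative.
Context {R : realType}.
Local Notation RR := (measurableTypeR R).
Local Notation lambda := (@lebesgue_measure R).

(** Integration by parts without boundary terms, in the form in which it serves
    for Gamma and Bessel integrals: dominated convergence over the segments
    [[1/n, n]]. *)
Lemma integral_derivative_half_line (f F : R -> R) :
  (forall x : R, 0 < x -> is_derive x (1 : R) F (f x)) ->
  (forall x : R, 0 < x -> {for x, continuous f}) ->
  lambda.-integrable (`]0%R, +oo[%classic : set RR) (EFin \o f) ->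
  F n.+2%:R^-1 @[n --> \oo] --> (0 : R) -> F n.+2%:R @[n --> \oo] --> (0 : R) ->
  (\int[lambda]_(x in `]0%R, +oo[) (f x)%:E = 0)%E.
Proof.
move=> dF cf fint F0 Fy.
have n2 n : 0 < (n.+2%:R^-1 : R) < 1.
  by rewrite invr_gt0 ltr0n/= invf_lt1 ?ltr0n// ltr1n.
have n2' n : 1 < (n.+2%:R : R) by rewrite ltr1n.
pose I n : set RR := `[n.+2%:R^-1, n.+2%:R]%classic.
have m0y : measurable (`]0%R, +oo[%classic : set RR) by exact: measurable_itv.
have mI n : measurable (I n) by exact: measurable_itv.
have FTCn n : (\int[lambda]_(x in I n) (f x)%:E = (F n.+2%:R - F n.+2%:R^-1)%:E)%E.
  apply: FTC_segment.
  - have /andP[_ h] := n2 n; exact: lt_trans h (n2' n).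
  - move=> x /andP[xn _]; apply: dF; have /andP[h _] := n2 n; exact: lt_le_trans h xn.
  - move=> x /andP[xn _]; apply: cf; have /andP[h _] := n2 n; exact: lt_le_trans h xn.
pose g n := (EFin \o f) \_ (I n).
have mf := measurable_int lambda fint.
have mg n : measurable_fun (`]0%R, +oo[%classic : set RR) (g n).
  apply: (measurable_funS measurableT) => //.
  apply/(measurable_restrictT _ (mI n)).
  apply: (measurable_funS _ _ mf) => // x; rewrite /I/= !in_itv/= andbT => /andP[xn _].
  have /andP[h _] := n2 n; exact: lt_le_trans h xn.
have cv0 : (fun n => n.+2%:R^-1 : R) @ \oo --> (0 : R) by have := @cvg_harmonic R; rewrite -cvg_shiftS.
have agf : {ae lambda, forall x, (`]0%R, +oo[%classic : set RR) x -> g ^~ x @ \oo --> (EFin \o f) x}.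
  apply: aeW => x; rewrite /= in_itv/= andbT => x0.
  apply: cvg_near_cst.
  have h1 : \forall n \near \oo, (n.+2%:R^-1 : R) < x.
    by move/cvgrPdist_lt : cv0 => /(_ _ x0); apply: filterS => n; rewrite sub0r normrN gtr0_norm// invr_gt0.
  have h2 : \forall n \near \oo, x <= n.+2%:R.
    near=> n; apply: (@le_trans _ _ n%:R); last by rewrite ler_nat ltnW.
    near: n; exact: nbhs_infty_ger.
  near=> n; rewrite /g patchE mem_set// /I/= in_itv/=; apply/andP; split.
    by apply/ltW; near: n.
  by near: n.
have ig : lambda.-integrable (`]0%R, +oo[%classic : set RR) (abse \o (EFin \o f)).
  exact: integrable_abse.
have agb : {ae lambda, forall x n, (`]0%R, +oo[%classic : set RR) x -> (`|g n x| <= (abse \o (EFin \o f)) x)%E}.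
  apply: aeW => x n _; rewrite /g patchE; case: ifP => // _.
  by rewrite abse0 abse_ge0.
have [_ _ cvI] := dominated_convergence m0y mg mf agf ig agb.
apply: (cvg_unique _ cvI) => //.
rewrite (_ : (fun n => _) = (fun n => (F n.+2%:R - F n.+2%:R^-1)%:E)); last first.
  apply/funext => n; rewrite -FTCn -integral_mkcondr; congr (integral _ _ _).
  apply/seteqP; split => x /=; first by case.
  by rewrite /I/= !in_itv/= => /andP[xn ->]; rewrite xn andbT; split => //; have /andP[h _] := n2 n; exact: lt_le_trans h xn.
suff : (F n.+2%:R - F n.+2%:R^-1)%:E @[n --> \oo] --> (0 - 0 : R)%:E by rewrite subr0.
by apply: cvg_EFin; [exact: nearW|exact: cvgB].
Unshelve. all: by end_near. Qed.

End half_line_derivative.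

Section Gamma_function.
Context {R : realType}.
Local Notation RR := (measurableTypeR R).
Local Notation lambda := (@lebesgue_measure R).

Lemma GammaE (s : R) : 0 < s ->
  (\int[lambda]_(t in `]0%R, +oo[) (gamma_kernel s 1 t)%:E = (Gamma s)%:E)%E.
Proof.
move=> s0; have fi := integrable_gamma_kernel s0 ltr01.
have m0y : measurable (`]0%R, +oo[%classic : set RR) by exact: measurable_itv.
rewrite /Gamma /Rintegral -(fineK (integrable_fin_num m0y fi)); congr (fine _)%:E.
by apply: eq_integral => t _; rewrite /= /gamma_kernel mul1r.
Qed.

Lemma Gamma_gt0 (s : R) : 0 < s -> 0 < Gamma s.
Proof.
move=> s0; rewrite -lte_fin -GammaE//.
apply: (@lt_le_trans _ _ (\int[lambda]_(t in `]0%R, 1%R]) (gamma_kernel s 1 t)%:E)%E).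
  have m01 : measurable (`]0%R, 1%R]%classic : set RR) by exact: measurable_itv.
  apply: integral_itv01_gt0.
  - by apply: (measurable_funS measurableT) => //; exact: measurable_gamma_kernel.
  - by move=> x /andP[x0 _]; rewrite mulr_gt0 ?powR_gt0 ?expR_gt0.
  - by move=> x; exact: gamma_kernel_ge0.
apply: ge0_subset_integral => //.
- by apply: (measurable_funS measurableT) => //; apply/(@measurable_EFinP _ RR); exact: measurable_gamma_kernel.
- by move=> x _; rewrite lee_fin gamma_kernel_ge0.
- by move=> x /=; rewrite !in_itv/= andbT => /andP[].
Qed.

Lemma is_derive_powR_expRN (s x : R) : 0 < x ->
  is_derive x (1 : R) (fun t => t `^ s * expR (- t))
    (s * (x `^ (s - 1) * expR (- x)) - x `^ s * expR (- x)).
Proof.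
move=> x0.
have h : is_derive x (1 : R) (fun t : R => - t) (-1) by apply: is_derive_eq.
have h2 := @is_derive1_comp _ expR _ x _ _ (is_derive_expR _) h.
apply: is_derive_ext (is_deriveM (@is_derive1_powR R s _ x0) h2) _ _ => //.
by rewrite /GRing.scale/=; ring.
Qed.

Lemma cvg_powR_expRN (s : R) : 0 < s -> n.+2%:R `^ s * expR (- n.+2%:R) @[n --> \oo] --> (0 : R).
Proof.
move=> s0; have [K K0 HK] := @gamma_kernel_tail R (s + 1) 1 ltr01.
have h : K * expR (- (1 / 2 * (1 + n.+1%:R))) @[n --> \oo] --> (0 : R).
  rewrite -(mulr0 K); apply: cvgM; first exact: cvg_cst.
  by apply: expR_Nscale_cvg0; lra.
apply: (squeeze_cvgr _ (@cvg_cst _ 0 _ _ _) h); apply: nearW => n.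
rewrite mulr_ge0 ?powR_ge0 ?expR_ge0//= -[n.+2%:R]natr1 [n.+1%:R + 1]addrC.
have := HK (1 + n.+1%:R); rewrite /gamma_kernel mul1r addrK; apply.
by rewrite lerDl.
Qed.

Lemma GammaS (s : R) : 0 < s -> Gamma (s + 1) = s * Gamma s.
Proof.
move=> s0; have s1 : 0 < s + 1 by lra.
have m0y : measurable (`]0%R, +oo[%classic : set RR) by exact: measurable_itv.
have i1 := integrable_gamma_kernel s0 (@ltr01 R).
have i2 := integrable_gamma_kernel s1 (@ltr01 R).
pose f (t : R) := s * (t `^ (s - 1) * expR (- t)) - t `^ s * expR (- t).
have fE : EFin \o f = (fun t => s%:E * (EFin \o gamma_kernel s 1) t - (EFin \o gamma_kernel (s + 1) 1) t)%E.
  by apply/funext => t; rewrite /= /f /gamma_kernel mul1r addrK.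
have i1' : lambda.-integrable (`]0%R, +oo[%classic : set RR) (fun t => s%:E * (EFin \o gamma_kernel s 1) t)%E.
  exact: integrableZl.
have intf : (\int[lambda]_(t in `]0%R, +oo[) (f t)%:E = 0)%E.
  apply: (@integral_derivative_half_line R f (fun t => t `^ s * expR (- t))).
  - by move=> x x0; exact: is_derive_powR_expRN.
  - move=> x x0.
    have c1 r : {for x, continuous (fun t : R => t `^ r * expR (- t))}.
      exact: is_derive1_continuous (is_derive_powR_expRN r x0).
    by apply: continuousB => //; apply: continuousM => //; exact: cst_continuous.
  - by rewrite fE; exact: integrableB.
  - have h1 : n.+2%:R^-1 `^ s @[n --> \oo] --> (0 : R).
      by apply: powR_cvg0_seq => //; have := @cvg_harmonic R; rewrite -cvg_shiftS.
    apply: (squeeze_cvgr _ (@cvg_cst _ 0 _ _ _) h1); apply: nearW => n.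
    rewrite mulr_ge0 ?powR_ge0 ?expR_ge0//= -[leRHS]mulr1 ler_wpM2l ?powR_ge0//.
  - exact: cvg_powR_expRN.
move: intf; rewrite (_ : (fun t => (f t)%:E) = EFin \o f)// fE integralB//.
rewrite integralZl// !GammaE// -EFinM -EFinB => -[] /eqP.
by rewrite subr_eq0 eq_sym => /eqP.
Qed.

(** Bernoulli's inequality for an exponent between 0 and 1: write [1] as the
    barycentre of tangent lines of the exponential. *)
Lemma powR_tangent (x y : R) : 0 < x < 1 -> 0 < y -> y `^ x <= 1 + x * (y - 1).
Proof.
move=> /andP[x0 x1] y0; have [v vE] : exists v, y = expR v by exists (ln y); rewrite lnK.
rewrite vE -expRM -(ler_pM2r (expR_gt0 (- (v * x)))) -expRD subrr expR0.
have -> : (1 + x * (expR v - 1)) * expR (- (v * x)) = (1 - x) * expR (- (v * x)) + x * expR (v - v * x).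
  by rewrite expRD; ring.
have h1 := expR_ge1Dx (- (v * x)); have h2 := expR_ge1Dx (v - v * x).
have h3 : (1 - x) * (1 - v * x) <= (1 - x) * expR (- (v * x)) by rewrite ler_wpM2l//; lra.
have h4 : x * (1 + (v - v * x)) <= x * expR (v - v * x) by rewrite ler_wpM2l//; lra.
have : (1 - x) * (1 - v * x) + x * (1 + (v - v * x)) = 1 by ring.
by lra.
Qed.

(** Log-convexity of Gamma in the only form used: integrate the tangent line
    of [t `^ x] at the mean [s] of the Gamma density. *)
Lemma Gamma_shift_le (s x : R) : 0 < s -> 0 < x < 1 -> Gamma (s + x) <= s `^ x * Gamma s.
Proof.
move=> s0 x01; have /andP[x0 x1] := x01.
have sx : 0 < s + x by lra.
have s1 : 0 < s + 1 by lra.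
have m0y : measurable (`]0%R, +oo[%classic : set RR) by exact: measurable_itv.
have i1 := integrable_gamma_kernel s0 (@ltr01 R).
have i2 := integrable_gamma_kernel s1 (@ltr01 R).
have i3 := integrable_gamma_kernel sx (@ltr01 R).
have i1' : lambda.-integrable (`]0%R, +oo[%classic : set RR) (fun t => (s `^ x * (1 - x))%:E * (EFin \o gamma_kernel s 1) t)%E.
  exact: integrableZl.
have i2' : lambda.-integrable (`]0%R, +oo[%classic : set RR) (fun t => (s `^ x * x / s)%:E * (EFin \o gamma_kernel (s + 1) 1) t)%E.
  exact: integrableZl.
have H : (\int[lambda]_(t in `]0%R, +oo[) (gamma_kernel (s + x) 1 t)%:E <=
    \int[lambda]_(t in `]0%R, +oo[) ((s `^ x * (1 - x))%:E * (EFin \o gamma_kernel s 1) t +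
      (s `^ x * x / s)%:E * (EFin \o gamma_kernel (s + 1) 1) t))%E.
  apply: le_integral => //; first exact: integrableD.
  move=> t; rewrite inE/= in_itv/= andbT => t0.
  rewrite -!EFinM -EFinD lee_fin /gamma_kernel mul1r.
  have -> : s + x - 1 = (s - 1) + x by ring.
  have -> : s + 1 - 1 = (s - 1) + 1 by ring.
  rewrite (powRDp (s - 1) x t0) (powRDp (s - 1) 1 t0) powRr1 ?(ltW t0)//.
  have ts : 0 < t / s by rewrite divr_gt0.
  have tx : t `^ x <= s `^ x * (1 + x * (t / s - 1)).
    have {1}-> : t = s * (t / s) by rewrite mulrC divfK// gt_eqF.
    by rewrite powRM ?(ltW s0) ?(ltW ts)// ler_wpM2l ?powR_ge0// powR_tangent.
  have K : 0 <= t `^ (s - 1) * expR (- t) by rewrite mulr_ge0 ?powR_ge0 ?expR_ge0.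
  have := ler_wpM2l K tx.
  by congr (_ <= _); field=> //; rewrite gt_eqF.
move: H; rewrite integralD// !integralZl// !GammaE// -!EFinM -EFinD lee_fin GammaS//.
move/le_trans; apply; rewrite le_eqVlt; apply/orP; left; apply/eqP.
by field; rewrite gt_eqF.
Qed.

End Gamma_function.

(** * The reflection formula *)

Section reflection.
Context {R : realType}.
Local Notation RR := (measurableTypeR R).
Local Notation lambda := (@lebesgue_measure R).
Local Notation Iseg := (`[0%R, pi / 2]%classic : set RR).

(** At [x = 0] these are Wallis' integrals; the recurrence in [n] contains
    the factor [n^2 - x^2] of Euler's sine product. *)
Definition cos_moment (x : R) (n : nat) : R :=
  \int[lambda]_(t in Iseg) (cos (2 * x * t) * cos t ^+ n.*2).

Lemma is_derive_cos_linear (a t : R) :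
  is_derive t (1 : R) (fun t => cos (a * t)) (- (a * sin (a * t))).
Proof.
have h : is_derive t (1 : R) (fun t : R => a * t) a by apply: is_derive_eq; rewrite /GRing.scale/=; ring.
have h2 := @is_derive1_comp _ (@cos R) _ t _ _ (is_derive_cos _) h.
by apply: is_derive_ext h2 _ _ => //; ring.
Qed.

Lemma is_derive_sin_linear (a t : R) :
  is_derive t (1 : R) (fun t => sin (a * t)) (a * cos (a * t)).
Proof.
have h : is_derive t (1 : R) (fun t : R => a * t) a by apply: is_derive_eq; rewrite /GRing.scale/=; ring.
have h2 := @is_derive1_comp _ (@sin R) _ t _ _ (is_derive_sin _) h.
by apply: is_derive_ext h2 _ _ => //; ring.
Qed.

Lemma is_derive_cosX n (t : R) :
  is_derive t (1 : R) (fun t => cos t ^+ n) (- (n%:R * cos t ^+ n.-1 * sin t)).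
Proof.
apply: is_derive_ext (@is_deriveX R R (@cos R) n t 1 _ (is_derive_cos t)) _ _.
  by move=> y; rewrite exprfctE.
by rewrite /GRing.scale/=; ring.
Qed.

Lemma continuous_cos_moment (x : R) n (t : R) :
  {for t, continuous (fun t : R => cos (2 * x * t) * cos t ^+ n)}.
Proof.
apply: continuousM.
  exact: is_derive1_continuous (is_derive_cos_linear _ _).
exact: is_derive1_continuous (is_derive_cosX _ _).
Qed.

Let mI : measurable Iseg. Proof. exact: measurable_itv. Qed.

Lemma integrable_cos_moment (x : R) n :
  lambda.-integrable Iseg (EFin \o (fun t : R => cos (2 * x * t) * cos t ^+ n)).
Proof.
apply: continuous_compact_integrable; first exact: segment_compact.
apply: continuous_in_subspaceT => t _; exact: continuous_cos_moment.
Qed.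

(** The primitive [x sin(2xt) c^(2n) - n cos(2xt) c^(2n-1) s], with [c] and
    [s] the cosine and sine of [t], vanishes at both ends. *)
Lemma cos_moment_rec x n :
  2 * (n.+1%:R ^+ 2 - x ^+ 2) * cos_moment x n.+1 =
  n.+1%:R * (2 * n.+1%:R - 1) * cos_moment x n.
Proof.
have i1 := integrable_cos_moment x n.+1.*2.
have i0 := integrable_cos_moment x n.*2.
pose N : R := n.+1%:R.
pose f (t : R) := 2 * (x ^+ 2 - N ^+ 2) * (cos (2 * x * t) * cos t ^+ n.+1.*2) +
   N * (2 * N - 1) * (cos (2 * x * t) * cos t ^+ n.*2).
pose F (t : R) := x * (sin (2 * x * t) * cos t ^+ n.+1.*2) -
   N * (cos (2 * x * t) * cos t ^+ n.*2.+1 * sin t).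
have h : (\int[lambda]_(t in Iseg) (f t)%:E = (F (pi / 2) - F 0)%:E)%E.
  apply: FTC_segment.
  - by rewrite divr_gt0 ?pi_gt0.
  - move=> t _.
    have d1 := is_deriveM (is_derive_sin_linear (2 * x) t) (is_derive_cosX n.+1.*2 t).
    have d2 := is_deriveM (is_deriveM (is_derive_cos_linear (2 * x) t) (is_derive_cosX n.*2.+1 t)) (is_derive_sin t).
    have d3 := is_deriveB (is_deriveZ x d1) (is_deriveZ N d2).
    apply: is_derive_ext d3 _ _ => //.
    rewrite /f /GRing.scale/= doubleS mulrfctE/= !exprS !expr0 !mulr1.
    have s2 : sin t * sin t = 1 - cos t * cos t by have := cos2Dsin2 t; lra.
    have NE : n.*2.+2%:R = 2 * N :> R by rewrite -doubleS -mul2n natrM.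
    have NE1 : n.*2.+1%:R = 2 * N - 1 :> R by rewrite -NE -[in RHS]natr1; ring.
    rewrite NE NE1; move: (cos t ^+ n.*2) => C; move: (cos (2 * x * t)) (sin (2 * x * t)) => u v.
    transitivity (2 * x ^+ 2 * u * (cos t * (cos t * C)) - N * u * (cos t * C) * cos t +
      N * (2 * N - 1) * u * C * (sin t * sin t)); first by ring.
    by rewrite s2; ring.
  - move=> t _; apply: continuousD; apply: continuousM; try exact: cst_continuous.
      exact: continuous_cos_moment.
    exact: continuous_cos_moment.
have F0 : F 0 = 0 by rewrite /F mulr0 !sin0; ring.
have Fp : F (pi / 2) = 0 by rewrite /F doubleS !exprS cos_pihalf; ring.
have : \int[lambda]_(t in Iseg) f t = 0 by rewrite /Rintegral h F0 Fp subr0.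
have i1' : lambda.-integrable Iseg (EFin \o (fun t : R => 2 * (x ^+ 2 - N ^+ 2) * (cos (2 * x * t) * cos t ^+ n.+1.*2))).
  by apply: (@eq_integrable _ RR R lambda Iseg mI (fun t => (2 * (x ^+ 2 - N ^+ 2))%:E * (cos (2 * x * t) * cos t ^+ n.+1.*2)%:E)%E) => //; exact: integrableZl.
have i0' : lambda.-integrable Iseg (EFin \o (fun t : R => N * (2 * N - 1) * (cos (2 * x * t) * cos t ^+ n.*2))).
  by apply: (@eq_integrable _ RR R lambda Iseg mI (fun t => (N * (2 * N - 1))%:E * (cos (2 * x * t) * cos t ^+ n.*2)%:E)%E) => //; exact: integrableZl.
rewrite RintegralD// !RintegralZl// -/(cos_moment x n.+1) -/(cos_moment x n) -/N.
move=> e; apply/eqP; rewrite -subr_eq0 -oppr_eq0 -e; apply/eqP; ring.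
Qed.

Lemma cos_moment00 : cos_moment 0 0 = pi / 2.
Proof.
rewrite /cos_moment /Rintegral (eq_integral (fun t => 1%:E)); last first.
  by move=> t _; rewrite mulr0 mul0r cos0 expr0 mulr1.
rewrite (FTC_segment (f := cst 1) (F := id)) ?subr0//.
- by rewrite divr_gt0 ?pi_gt0.
- by move=> t _; exact: cst_continuous.
Qed.

Lemma cos_moment_0 x : 0 < x -> cos_moment x 0 = sin (pi * x) / (2 * x).
Proof.
move=> x0; have x0' : x != 0 by rewrite gt_eqF.
rewrite /cos_moment /Rintegral (_ : (fun t => _) = (fun t : RR => (cos (2 * x * t))%:E)); last first.
  by apply/funext => t; rewrite expr0 mulr1.
have -> : (\int[lambda]_(t in Iseg) (cos (2 * x * t))%:E =
    ((2 * x)^-1 * sin (2 * x * (pi / 2)) - (2 * x)^-1 * sin (2 * x * 0))%:E)%E.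
  apply: (@FTC_segment R _ (fun t : R => (2 * x)^-1 * sin (2 * x * t))).
  - by rewrite divr_gt0 ?pi_gt0.
  - move=> t _; apply: is_derive_ext (is_deriveZ (2 * x)^-1 (is_derive_sin_linear (2 * x) t)) _ _ => //.
    by rewrite /GRing.scale/=; field.
  - move=> t _; exact: is_derive1_continuous (is_derive_cos_linear _ _).
rewrite /= mulr0 sin0 mulr0 subr0.
have -> : 2 * x * (pi / 2) = pi * x by field.
by rewrite mulrC.
Qed.

Lemma cos_moment_gt0 n : 0 < cos_moment 0 n.
Proof.
elim: n => [|n IHn]; first by rewrite cos_moment00 divr_gt0 ?pi_gt0.
have := cos_moment_rec 0 n; rewrite expr0n subr0 => e.
have h : 0 < n.+1%:R * (2 * n.+1%:R - 1) * cos_moment 0 n.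
  by rewrite mulr_gt0// mulr_gt0//.
by move: h; rewrite -e pmulr_rgt0// mulr_gt0// exprn_gt0.
Qed.

Lemma le_cos_moment x n : cos_moment x n <= cos_moment 0 n.
Proof.
apply: le_Rintegral => //; [exact: integrable_cos_moment..|].
move=> t; rewrite /= in_itv/= => /andP[t0 tp].
rewrite mulr0 mul0r cos0 ler_wpM2r ?cos_le1// exprn_ge0// cos_ge0_pihalf//.
by rewrite tp andbT; lra.
Qed.

(** [1 - cos (2xt) = 2 sin (xt) ^ 2 <= 2 sin t ^ 2] bounds the loss by the
    next moment. *)
Lemma cos_moment_ge x n : 0 <= x <= 1 ->
  n%:R / n.+1%:R * cos_moment 0 n <= cos_moment x n.
Proof.
move=> /andP[x0 x1].
have i1 := integrable_cos_moment x n.*2.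
have i0 := integrable_cos_moment 0 n.*2.
have i2 := integrable_cos_moment 0 n.+1.*2.
have i2' : lambda.-integrable Iseg (EFin \o (fun t : R => 2 * (cos (2 * 0 * t) * cos t ^+ n.+1.*2))).
  by apply: (@eq_integrable _ RR R lambda Iseg mI (fun t => 2%:E * (cos (2 * 0 * t) * cos t ^+ n.+1.*2)%:E)%E) => //; exact: integrableZl.
have i3 : lambda.-integrable Iseg (EFin \o (fun t : R => 2 * (cos (2 * 0 * t) * cos t ^+ n.+1.*2) - cos (2 * 0 * t) * cos t ^+ n.*2)).
  by apply: (@eq_integrable _ RR R lambda Iseg mI (fun t => (2 * (cos (2 * 0 * t) * cos t ^+ n.+1.*2))%:E - (cos (2 * 0 * t) * cos t ^+ n.*2)%:E)%E) => //; exact: integrableB.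
have H : \int[lambda]_(t in Iseg) (2 * (cos (2 * 0 * t) * cos t ^+ n.+1.*2) - cos (2 * 0 * t) * cos t ^+ n.*2) <= cos_moment x n.
  apply: le_Rintegral => // t; rewrite /= in_itv/= => /andP[t0 tp].
  rewrite mulr0 mul0r cos0 !mul1r doubleS !exprS.
  have c0 : 0 <= cos t by rewrite cos_ge0_pihalf// tp andbT; lra.
  have C0 : 0 <= cos t ^+ n.*2 by rewrite exprn_ge0.
  have xt0 : 0 <= x * t by rewrite mulr_ge0.
  have xt : x * t <= t by rewrite -[leRHS]mul1r ler_wpM2r.
  have s1 : sin (x * t) <= sin t.
    rewrite le_eqVlt; have [->|ne] := eqVneq (x * t) t; first by rewrite eqxx.
    rewrite ltr_sin ?in_itv/=; last 2 first.
    - by apply/andP; split; lra.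
    - by apply/andP; split; lra.
    by rewrite lt_neqAle ne xt orbT.
  have s0 : 0 <= sin (x * t) by rewrite sin_ge0_pi// xt0/=; have := pi_gt0 R; lra.
  have s2 : sin (x * t) * sin (x * t) <= sin t * sin t by rewrite ler_pM.
  have e1 := cos2Dsin2 t; have e2 := cos2Dsin2 (x * t).
  have -> : cos (2 * x * t) = 2 * cos (x * t) ^+ 2 - 1.
    by rewrite -[2 * x * t]mulrA mulr_natl cos_mulr2n mulr_natl.
  have : (2 * (cos t * cos t) - 1) * cos t ^+ n.*2 <= (2 * cos (x * t) ^+ 2 - 1) * cos t ^+ n.*2.
    by rewrite ler_wpM2r//; move: e1 e2 s2; rewrite !expr2; lra.
  by congr (_ <= _); ring.
apply: le_trans H; rewrite RintegralB// RintegralZl// -/(cos_moment 0 n.+1) -/(cos_moment 0 n).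
have := cos_moment_rec 0 n; rewrite expr0n subr0 => e.
have N0 : n.+1%:R != 0 :> R by [].
have -> : 2 * cos_moment 0 n.+1 = (2 * n.+1%:R - 1) / n.+1%:R * cos_moment 0 n.
  apply: (mulfI N0); apply: (mulfI N0).
  transitivity (2 * n.+1%:R ^+ 2 * cos_moment 0 n.+1); first by ring.
  by rewrite e; field.
by rewrite le_eqVlt; apply/orP; left; apply/eqP; rewrite -!natr1; field; rewrite natr1.
Qed.

Lemma cos_moment_ge0 x n : 0 < x < 1 -> 0 <= cos_moment x n.
Proof.
move=> /andP[x0 x1]; apply: (le_trans _ (@cos_moment_ge x n _)); last by rewrite !ltW.
by rewrite mulr_ge0 ?divr_ge0// ltW ?cos_moment_gt0.
Qed.

Lemma Gamma1 : Gamma (1 : R) = 1.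
Proof.
have [] : (Gamma (1 : R))%:E = 1%:E :> \bar R => //.
rewrite -GammaE// -[RHS](_ : (expR (- (1 * 0)) / 1)%:E = _); last by rewrite mulr0 oppr0 expR0 divr1.
rewrite -integral_expR_tail//; apply: eq_integral => t _.
by rewrite /gamma_kernel subrr powRr0 mul1r mul1r.
Qed.

Let ratio (x : R) n := Gamma (n.+1%:R + x) * Gamma (n.+1%:R - x) * cos_moment x n.

(** The factors gained by Gamma and lost by the moments cancel. *)
Lemma Gamma_cos_moment_rec x n : 0 <= x < 1 ->
  ratio x n.+1 = n.+1%:R * (2 * n.+1%:R - 1) / 2 * ratio x n.
Proof.
move=> /andP[x0 x1]; rewrite /ratio.
have n1 : 1 <= n.+1%:R :> R by rewrite ler1n.
have -> : n.+2%:R + x = n.+1%:R + x + 1 by rewrite -[n.+2%:R]natr1; ring.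
have -> : n.+2%:R - x = n.+1%:R - x + 1 by rewrite -[n.+2%:R]natr1; ring.
rewrite !GammaS; [|lra..].
move: (cos_moment_rec x n) (Gamma (n.+1%:R + x)) (Gamma (n.+1%:R - x)) => e G1 G2.
transitivity (G1 * G2 / 2 * (2 * (n.+1%:R ^+ 2 - x ^+ 2) * cos_moment x n.+1)); first by field.
by rewrite e; field.
Qed.

Lemma archimedean_le0 (z K : R) : (forall n, n.+1%:R * z <= K) -> z <= 0.
Proof.
move=> H; rewrite leNgt; apply/negP => z0.
have K0 : 0 <= K by apply: le_trans (H 0%N); rewrite mul1r ltW.
have := H (Num.bound (K / z)); rewrite -ler_pdivlMr//.
have := archi_boundP (divr_ge0 K0 (ltW z0)); rewrite -natr1; lra.
Qed.

(** Shift [s + 1] by [x] and [s] by [1 - x]. *)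
Lemma Gamma_pair_le (s x : R) : 0 < s -> 0 < x < 1 ->
  Gamma (s + 1 + x) * Gamma (s + 1 - x) <= (s + 1) / s * (Gamma (s + 1) * Gamma (s + 1)).
Proof.
move=> s0 x01; have /andP[x0 x1] := x01; have s1 : 0 < s + 1 by lra.
have g0 (r : R) : 0 < r -> 0 <= Gamma r by move=> r0; rewrite ltW// Gamma_gt0.
have pw : (s + 1) `^ x * s `^ (1 - x) <= s + 1.
  rewrite -[leRHS]powRr1 ?(ltW s1)// [X in _ <= _ `^ X](_ : (1 : R) = x + (1 - x)); last by ring.
  rewrite (powRDp x (1 - x) s1) ler_wpM2l ?powR_ge0//.
  by apply: ge0_ler_powR; rewrite ?nnegrE; lra.
have s1x : 0 < s + 1 - x by lra.
have s1x' : 0 < s + 1 + x by lra.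
have x1' : 0 < 1 - x < 1 by lra.
have up1 := Gamma_shift_le s1 x01.
have up2 := Gamma_shift_le s0 x1'; rewrite addrA in up2.
apply: (le_trans (ler_pM (g0 _ s1x') (g0 _ s1x) up1 up2)).
have h := ler_wpM2r (mulr_ge0 (g0 _ s1) (g0 _ s0)) pw.
move: h; rewrite GammaS//; move: (Gamma s) (_ `^ x) (_ `^ (1 - x)) => G p r h.
have -> : (s + 1) / s * (s * G * (s * G)) = (s + 1) * (s * G * G) by field; rewrite gt_eqF.
by apply: le_trans h; rewrite le_eqVlt; apply/orP; left; apply/eqP; ring.
Qed.

(** Shift [s + x] by [1 - x] and [s - x] by [x], in both cases to reach the value at
    [x = 0]. *)
Lemma Gamma_pair_ge (s x : R) : 1 <= s -> 0 < x < 1 ->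
  s * (Gamma s * Gamma s) <= (s + 1) * (Gamma (s + x) * Gamma (s - x)).
Proof.
move=> s1 x01; have /andP[x0 x1] := x01; have s0 : 0 < s by lra.
have sp : 0 < s + x by lra.
have sm : 0 < s - x by lra.
have g0 (r : R) : 0 < r -> 0 <= Gamma r by move=> r0; rewrite ltW// Gamma_gt0.
have s10 : 0 < s + 1 by lra.
have x1' : 0 < 1 - x < 1 by lra.
have pw : (s + x) `^ (1 - x) * (s - x) `^ x <= s + 1.
  rewrite -[leRHS]powRr1 ?(ltW s10)// [X in _ <= _ `^ X](_ : (1 : R) = (1 - x) + x); last by ring.
  rewrite (powRDp (1 - x) x s10); apply: ler_pM; rewrite ?powR_ge0//.
    by apply: ge0_ler_powR; rewrite ?nnegrE; lra.
  by apply: ge0_ler_powR; rewrite ?nnegrE; lra.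
have up1 : s * Gamma s <= (s + x) `^ (1 - x) * Gamma (s + x).
  rewrite -GammaS// (_ : s + 1 = s + x + (1 - x)); last by ring.
  exact: Gamma_shift_le.
have up2 : Gamma s <= (s - x) `^ x * Gamma (s - x).
  by have := Gamma_shift_le sm x01; rewrite subrK.
have h := ler_pM (mulr_ge0 (ltW s0) (g0 _ s0)) (g0 _ s0) up1 up2.
rewrite mulrA; apply: (le_trans h).
have := ler_wpM2r (mulr_ge0 (g0 _ sp) (g0 _ sm)) pw; apply: le_trans.
by rewrite le_eqVlt; apply/orP; left; apply/eqP; rewrite mulrACA.
Qed.

(** The ratio of the pair of Gamma factors to its value at [x = 0] and the
    ratio of the moments have a constant product, and both tend to 1. *)
Lemma Gamma_reflection (x : R) : 0 < x < 1 ->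
  Gamma (1 + x) * Gamma (1 - x) * sin (pi * x) = pi * x.
Proof.
move=> x01; have /andP[x0 x1] := x01.
have key (N q : R) : N <= (N + 1 + 1) * q -> q <= 1 -> (N + 1) * (1 - q) <= 2 by nra.
have prop n : ratio x n * ratio 0 0%N = ratio 0 n * ratio x 0%N.
  elim: n => [|n IHn]; first by rewrite mulrC.
  by rewrite !Gamma_cos_moment_rec ?lexx ?ltr01 ?(ltW x0)// -[LHS]mulrA IHn; ring.
pose g n := Gamma (n.+1%:R : R) * Gamma (n.+1%:R).
have n0 n : 0 < n.+1%:R :> R by [].
have g0 n : 0 < g n by rewrite mulr_gt0 ?Gamma_gt0.
have G0 n : 0 < g n * cos_moment 0 n by rewrite mulr_gt0 ?cos_moment_gt0.
have r0 n : ratio 0 n = g n * cos_moment 0 n by rewrite /ratio addr0 subr0.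
pose r := ratio x 0%N / ratio 0 0%N.
have rE n : ratio x n = r * (g n * cos_moment 0 n).
  by rewrite /r mulrAC; apply/eqP; rewrite eq_sym -r0 -(mulrC (ratio 0 n)) -prop mulfK// r0 gt_eqF.
have r_le1 : r <= 1.
  rewrite -subr_le0; apply: (@archimedean_le0 _ 1) => n.
  rewrite mulrC -ler_pdivlMr// mul1r lerBlDl.
  rewrite -(ler_pM2r (G0 n.+1)) -rE mulrA.
  have h := Gamma_pair_le (n0 n) x01; rewrite natr1 in h.
  have sx : 0 < n.+2%:R - x by rewrite subr_gt0 (lt_le_trans x1)// ler1n.
  have p0 := mulr_ge0 (ltW (Gamma_gt0 (addr_gt0 (n0 n.+1) x0))) (ltW (Gamma_gt0 sx)).
  have e : n.+2%:R / n.+1%:R = 1 + n.+1%:R^-1 :> R.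
    by rewrite -[n.+2%:R]natr1 mulrDl divff ?mul1r// gt_eqF.
  rewrite -/(g n.+1) e in h.
  exact: (ler_pM p0 (cos_moment_ge0 n.+1 x01) h (le_cos_moment x n.+1)).
have r1 : r = 1.
  apply/eqP; rewrite eq_le r_le1/= -subr_le0.
  apply: (@archimedean_le0 _ 2) => n.
  have n1 : 1 <= n.+1%:R :> R by rewrite ler1n.
  have x01' : 0 <= x <= 1 by rewrite !ltW.
  have h := Gamma_pair_ge n1 x01; have c := cos_moment_ge n x01'.
  have m0 : 0 <= n%:R / n.+1%:R * cos_moment 0 n.
    by rewrite mulr_ge0 ?divr_ge0// ltW ?cos_moment_gt0.
  have := ler_pM (mulr_ge0 (ltW (n0 n)) (ltW (g0 n))) m0 h c.
  rewrite -[X in _ <= X]mulrA -/(ratio x n) rE.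
  have -> : n.+1%:R * g n * (n%:R / n.+1%:R * cos_moment 0 n) = n%:R * (g n * cos_moment 0 n).
    by move: (g n) (cos_moment 0 n) => G C; field; rewrite gt_eqF.
  rewrite [leRHS]mulrA (ler_pM2r (G0 n)) -(@natr1 R n) => b; exact: key.
have e : Gamma (1 + x) * Gamma (1 - x) * (sin (pi * x) / (2 * x)) = pi / 2.
  by have := rE 0%N; rewrite r1 mul1r /ratio /g cos_moment00 cos_moment_0// Gamma1 !mul1r.
have x0' : x != 0 by rewrite gt_eqF.
move: (pi : R) (Gamma (1 + x)) (Gamma (1 - x)) (sin (pi * x)) e => p G1 G2 S e.
have -> : G1 * G2 * S = 2 * x * (G1 * G2 * (S / (2 * x))) by field.
by rewrite e; field.
Qed.

End reflection.

(** * Integrals with an essential singularity at 0 *)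

Section bessel_kernel.
Context {R : realType}.
Local Notation RR := (measurableTypeR R).
Local Notation lambda := (@lebesgue_measure R).
Local Notation D := (`]0%R, +oo[%classic : set RR).

(** For [u > 0] the last factor is [exp (- c / u)]; the power makes it
    measurable in [u]. *)
Definition bessel_kernel (r c : R) (u : RR) : R :=
  gamma_kernel r 1 u * expR (- (c * u `^ (-1))).

Lemma bessel_kernel_ge0 r c u : 0 <= bessel_kernel r c u.
Proof. by rewrite mulr_ge0 ?gamma_kernel_ge0 ?expR_ge0. Qed.

Lemma measurable_bessel_kernel r c A : measurable_fun A (bessel_kernel r c).
Proof.
apply: (measurable_funS measurableT) => //.
apply: measurable_funM; first exact: measurable_gamma_kernel.
apply: measurableT_comp => //; apply: measurableT_comp => //.
by apply: measurable_funM => //; exact: measurable_powR.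
Qed.

Let mD : measurable D. Proof. exact: measurable_itv. Qed.

(** The factor [exp (- c / u)] absorbs any power of [u] at 0: in the variable
    [1 / u] this is the bound for Gamma kernels at infinity. *)
Lemma bessel_kernel_bound (r c : R) : 0 < c -> exists2 K : R, 0 <= K &
  forall u, 0 < u -> bessel_kernel r c u <= K * expR (- (1 / 2 * u)).
Proof.
move=> c0; have [K1 K10 HK1] := @gamma_kernel_tail R r 1 ltr01.
have [K2 K20 HK2] := @gamma_kernel_tail R (2 - r) c c0.
exists (K1 + K2) => [|u u0]; first by rewrite addr_ge0.
have uV : u `^ (-1) = u^-1 by rewrite powR_inv1// ltW.
have Vu : 0 < u^-1 by rewrite invr_gt0.
rewrite mulrDl; have [u1|u1] := leP 1 u.
  rewrite -[leLHS]addr0 lerD// ?mulr_ge0 ?expR_ge0//.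
  apply: (le_trans _ (HK1 _ u1)); rewrite -[leRHS]mulr1 ler_wpM2l ?gamma_kernel_ge0//.
  by rewrite -[leRHS]expR0 ler_expR oppr_le0 mulr_ge0 ?powR_ge0// ltW.
rewrite -[leLHS]add0r lerD// ?mulr_ge0 ?expR_ge0//.
have u1' : 1 <= u^-1 by rewrite invf_ge1// ltW.
rewrite /bessel_kernel /gamma_kernel uV mul1r.
have h : u `^ (r - 1) * expR (- (c * u^-1)) <= K2.
  have := HK2 _ u1'; rewrite /gamma_kernel (powRVN _ (ltW u0)) (_ : - (2 - r - 1) = r - 1); last by ring.
  move/le_trans; apply; rewrite -[leRHS]mulr1 ler_wpM2l//.
  by rewrite -[leRHS]expR0 ler_expR oppr_le0 !mulr_ge0// ?divr_ge0// ltW.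
rewrite mulrAC; apply: ler_pM => //; rewrite ?mulr_ge0 ?powR_ge0 ?expR_ge0//.
by rewrite ler_expR lerN2; lra.
Qed.

Lemma integrable_bessel_kernel r c : 0 < c ->
  lambda.-integrable D (EFin \o bessel_kernel r c).
Proof.
move=> c0; have [K K0 HK] := bessel_kernel_bound r c0.
have ig : lambda.-integrable D (EFin \o gamma_kernel 1 (1 / 2)).
  by apply: integrable_gamma_kernel; lra.
have ig' : lambda.-integrable D (fun u => K%:E * (EFin \o gamma_kernel 1 (1 / 2)) u)%E.
  exact: integrableZl.
apply: (le_integrable mD _ _ ig').
  by apply/measurable_EFinP; exact: measurable_bessel_kernel.
move=> u; rewrite /= in_itv/= andbT => u0.
have gn : 0 <= K * gamma_kernel 1 (1 / 2) u by apply: mulr_ge0 => //; exact: gamma_kernel_ge0.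
rewrite lee_fin (ger0_norm (bessel_kernel_ge0 _ _ _)) (ger0_norm gn).
by rewrite /gamma_kernel subrr powRr0 mul1r HK.
Qed.

(** Integration by parts against [u `^ s * exp (- u - c / u)]. *)
Lemma bessel_kernel_by_parts (s c : R) : 0 < c ->
  (\int[lambda]_(u in D) (bessel_kernel (1 + s) c u - s * bessel_kernel s c u)%:E =
   c%:E * \int[lambda]_(u in D) (bessel_kernel (s - 1) c u)%:E)%E.
Proof.
move=> c0.
have i1 := integrable_bessel_kernel (1 + s) c0.
have i2 := integrable_bessel_kernel s c0.
have i3 := integrable_bessel_kernel (s - 1) c0.
have i2' : lambda.-integrable D (fun u => s%:E * (EFin \o bessel_kernel s c) u)%E by exact: integrableZl.
have i3' : lambda.-integrable D (fun u => c%:E * (EFin \o bessel_kernel (s - 1) c) u)%E by exact: integrableZl.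
pose g (u : R) := bessel_kernel (1 + s) c u - s * bessel_kernel s c u.
have ig : lambda.-integrable D (EFin \o g).
  apply: (eq_integrable mD (EFin \o bessel_kernel (1 + s) c \- (fun u => s%:E * (EFin \o bessel_kernel s c) u))%E) => //.
  exact: integrableB.
pose f (u : R) := c * bessel_kernel (s - 1) c u - g u.
pose F (u : R) := bessel_kernel (1 + s) c u.
have dE r (u : R) : 0 < u -> is_derive u (1 : R) (bessel_kernel r c)
    ((r - 1) * bessel_kernel (r - 1) c u - bessel_kernel r c u + c * bessel_kernel (r - 2) c u).
  move=> u0.
  have d1 := @is_derive1_powR R (r - 1) _ u0.
  have d2 := @is_derive1_powR R (-1) _ u0.
  have d3 : is_derive u (1 : R) (fun t : R => - (1 * t)) (- 1) by apply: is_derive_eq; rewrite /GRing.scale/=; ring.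
  have d4 := @is_derive1_comp _ expR _ u _ _ (is_derive_expR _) d3.
  have d5 := @is_derive1_comp _ expR _ u _ _ (is_derive_expR _) (is_deriveN (is_deriveZ c d2)).
  apply: is_derive_ext (is_deriveM (is_deriveM d1 d4) d5) _ _ => //.
  rewrite /bessel_kernel /gamma_kernel mulrfctE /GRing.scale/=.
  have -> : r - 1 - 1 = (r - 2 - 1) + 1 by ring.
  have -> : r - 1 = (r - 2 - 1) + 2 by ring.
  have u00 : u != 0 by rewrite gt_eqF.
  have e1 := powRDp (r - 2 - 1) 1 u0; have e2 := powRDp (r - 2 - 1) 2 u0.
  have e3 : u `^ (-1) = u^-1 by rewrite powR_inv1// ltW.
  have e4 : u `^ (-1 - 1) = u^-1 * u^-1 by rewrite (powRDp (-1) (-1) u0) e3.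
  have e5 : u `^ 2 = u * u by rewrite -expr2 -powR_mulrn// ltW.
  have e6 : u `^ 1 = u by rewrite powRr1// ltW.
  have eX : (- (c \*: (@powR R)^~ (-1))) u = - (c * u `^ (-1)) by [].
  rewrite eX e1 e2 e3 e4 e5 e6; move: (expR _) (expR _) (u `^ _) => x y z.
  by field.
have df (u : R) : 0 < u -> is_derive u (1 : R) F (f u).
  move=> u0; apply: is_derive_ext (dE (1 + s) u u0) _ _ => //.
  rewrite /f /g (_ : 1 + s - 2 = s - 1); last by ring.
  by rewrite (_ : 1 + s - 1 = s); ring.
have cb r (u : R) : 0 < u -> {for u, continuous (bessel_kernel r c : R -> R)}.
  by move=> u0; exact: is_derive1_continuous (dE r u u0).
have fE : EFin \o f = (fun u => c%:E * (EFin \o bessel_kernel (s - 1) c) u - (EFin \o g) u)%E by [].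
have H : (\int[lambda]_(u in D) (f u)%:E = 0)%E.
  apply: (@integral_derivative_half_line R f F) => //.
  - move=> u u0; apply: continuousB; first by apply: continuousM; [exact: cst_continuous|exact: cb].
    apply: continuousB; first exact: cb.
    by apply: continuousM; [exact: cst_continuous|exact: cb].
  - by rewrite fE; exact: integrableB.
  - have [K K0 HK] := bessel_kernel_bound s c0.
    have h1 : K * n.+2%:R^-1 @[n --> \oo] --> (0 : R).
      by rewrite -(mulr0 K); apply: cvgM; [exact: cvg_cst|have := @cvg_harmonic R; rewrite -cvg_shiftS].
    apply: (squeeze_cvgr _ (@cvg_cst _ 0 _ _ _) h1); apply: nearW => n.
    rewrite bessel_kernel_ge0/=.
    have n0 : 0 < n.+2%:R^-1 :> R by [].
    have -> : F n.+2%:R^-1 = bessel_kernel s c n.+2%:R^-1 * n.+2%:R^-1.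
      rewrite /F /bessel_kernel /gamma_kernel (_ : 1 + s - 1 = s - 1 + 1); last by ring.
      by rewrite (powRDp (s - 1) 1 n0) powRr1 ?(ltW n0)//; ring.
    apply: ler_wpM2r; first exact: ltW.
    apply: (le_trans (HK _ n0)); rewrite -[leRHS]mulr1 ler_wpM2l//.
  - have [K K0 HK] := bessel_kernel_bound (1 + s) c0.
    have h : K * expR (- (1 / 2 * (1 + n.+1%:R))) @[n --> \oo] --> (0 : R).
      rewrite -(mulr0 K); apply: cvgM; first exact: cvg_cst.
      by apply: expR_Nscale_cvg0; lra.
    apply: (squeeze_cvgr _ (@cvg_cst _ 0 _ _ _) h); apply: nearW => n.
    by rewrite bessel_kernel_ge0/= -[n.+2%:R]natr1 [n.+1%:R + 1]addrC HK// addr_gt0.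
move: H; rewrite (_ : (fun t => (f t)%:E) = EFin \o f)// fE integralB// integralZl//.
have [m3 mg] : (\int[lambda]_(u in D) (EFin \o bessel_kernel (s - 1) c) u)%E \is a fin_num /\
    (\int[lambda]_(u in D) (EFin \o g) u)%E \is a fin_num.
  by split; exact: integrable_fin_num.
rewrite -/(EFin \o g) -(fineK m3) -(fineK mg) -EFinM -EFinB => -[] /eqP.
by rewrite subr_eq0 eq_sym => /eqP; exact: (congr1 EFin).
Qed.

End bessel_kernel.

Section exponential_substitution.
Context {R : realType}.
Local Notation RR := (measurableTypeR R).
Local Notation lambda := (@lebesgue_measure R).

Lemma integral_cst_indic (f : RR -> \bar R) (g : RR -> R) (A : set RR) :
  (\int[lambda]_t (f t * (g t * \1_A t)%:E) = \int[lambda]_(t in A) (f t * (g t)%:E))%E.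
Proof.
rewrite [RHS]integral_mkcond; apply: eq_integral => t _.
by rewrite patchE indicE; case: (t \in A); rewrite ?mulr1// mulr0 mule0.
Qed.

(** Exhaust the line by segments, where [change_of_variables] applies. *)
Lemma exponential_change_of_variables (s : R) (f : RR -> \bar R) : 0 < s ->
  measurable_fun setT f -> (forall y, 0 <= f y)%E ->
  (\int[lambda]_t (f (s * expR t)%R * (s * expR t)%:E) =
   \int[lambda]_(y in `]0%R, +oo[) f y)%E.
Proof.
move=> s0 mf f0.
pose phi (t : R) := s * expR t.
have dphi (t : R) : is_derive t (1 : R) phi (phi t).
  by apply: is_derive_ext (is_deriveZ s (is_derive_expR t)) _ _.
have phi0 t : 0 < phi t by rewrite mulr_gt0 ?expR_gt0.
have mphi : @measurable_fun _ _ RR RR setT phi.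
  by apply: measurable_funM => //; exact: measurable_expR.
pose a n : R := - n.+1%:R; pose b n : R := n.+1%:R.
have ab n : a n < b n by rewrite /a /b; have : 0 < n.+1%:R :> R by []; lra.
have E n : (\int[lambda]_(t in `]a n, b n]) (f (phi t) * (phi t)%:E) =
    \int[lambda]_(y in `]phi (a n), phi (b n)]) f y)%E.
  rewrite -(integral_cst_indic (fun t => f (phi t)) phi).
  rewrite (@change_of_variables R phi phi (a n) (b n) (ab n))//.
    rewrite [RHS]integral_mkcond; apply: eq_integral => t _.
    by rewrite patchE indicE; case: (t \in _); rewrite ?mule1// mule0.
  by apply: continuous_in_subspaceT => x _; exact: is_derive1_continuous (dphi x).
have mg : measurable_fun setT (fun t : RR => f (phi t) * (phi t)%:E)%E.
  apply: emeasurable_funM; last by apply/measurable_EFinP.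
  exact: (measurableT_comp mf mphi).
have g0 t : (0 <= f (phi t) * (phi t)%:E)%E by rewrite mule_ge0// lee_fin ltW.
have nd1 : nondecreasing_seq (fun n => `]a n, b n]%classic : set RR).
  apply/nondecreasing_seqP => n; apply/subsetPset => x /=; rewrite !in_itv/= /a /b.
  have : n.+1%:R <= n.+2%:R :> R by rewrite ler_nat.
  by lra.
have nd2 : nondecreasing_seq (fun n => `]phi (a n), phi (b n)]%classic : set RR).
  apply/nondecreasing_seqP => n; apply/subsetPset => x /=; rewrite !in_itv/= => /andP[h1 h2].
  have nn : n.+1%:R <= n.+2%:R :> R by rewrite ler_nat.
  apply/andP; split.
    by apply: le_lt_trans h1; rewrite /phi ler_pM2l// ler_expR lerN2.
  by apply: (le_trans h2); rewrite /phi ler_pM2l// ler_expR.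
have arch (x : R) : exists n, `|x| < n.+1%:R.
  by exists (Num.bound `|x|); apply: (lt_trans (archi_boundP (normr_ge0 _))); rewrite ltr_nat.
have U1 : \bigcup_n (`]a n, b n]%classic : set RR) = setT.
  apply/seteqP; split => x // _; have [n] := arch x.
  by rewrite ltr_norml => /andP[h1 h2]; exists n => //=; rewrite in_itv/= /a /b h1 ltW.
have U2 : \bigcup_n (`]phi (a n), phi (b n)]%classic : set RR) = `]0%R, +oo[%classic.
  apply/seteqP; split => x /=.
    by move=> [n _]; rewrite /= !in_itv/= andbT => /andP[h1 _]; exact: lt_trans (phi0 _) h1.
  rewrite in_itv/= andbT => x0; have [n] := arch (ln (x / s)).
  have xE : x = phi (ln (x / s)) by rewrite /phi lnK ?posrE ?divr_gt0// mulrC divfK// gt_eqF.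
  rewrite ltr_norml => /andP[h1 h2]; exists n => //=.
  rewrite in_itv/=; apply/andP; split.
    by rewrite [ltRHS]xE /phi ltr_pM2l// ltr_expR.
  by rewrite [leLHS]xE /phi ler_pM2l// ler_expR ltW.
have c1 := @ge0_nondecreasing_set_cvg_integral _ RR R (fun n => `]a n, b n]%classic : set RR) (fun t => f (phi t) * (phi t)%:E)%E lambda nd1.
have c2 := @ge0_nondecreasing_set_cvg_integral _ RR R (fun n => `]phi (a n), phi (b n)]%classic : set RR) f lambda nd2.
rewrite U1 in c1; rewrite U2 in c2.
have c1' := c1 (fun n => measurable_itv _) (fun n => measurable_funS measurableT (@subsetT _ _) mg) (fun n t _ => g0 t).
have c2' := c2 (fun n => measurable_itv _) (fun n => measurable_funS measurableT (@subsetT _ _) mf) (fun n t _ => f0 t).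
apply: (cvg_unique _ c1') => //.
by rewrite (_ : (fun n => _) = (fun n => \int[lambda]_(y in `]phi (a n), phi (b n)]) f y)%E)//; apply/funext.
Qed.

End exponential_substitution.

(** * The Bessel function in the limit density *)

Section bessel_function.
Context {R : realType}.
Local Notation RR := (measurableTypeR R).
Local Notation lambda := (@lebesgue_measure R).
Local Notation D := (`]0%R, +oo[%classic : set RR).
Local Notation D0 := (`[0%R, +oo[%classic : set RR).

Let mD : measurable D. Proof. exact: measurable_itv. Qed.
Let mD0 : measurable D0. Proof. exact: measurable_itv. Qed.

(** Folding the line at 0 turns [exp (- nu t)] into [2 cosh (nu t)]. *)
Lemma integral_line_symmetrize (g : R -> R) :
  continuous g -> (forall t, 0 <= g t) ->
  (\int[lambda]_t (g t)%:E = \int[lambda]_(t in D0) (g t + g (- t))%:E)%E.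
Proof.
move=> cg g0.
have mg : @measurable_fun _ _ RR R setT g by exact: continuous_measurable_fun.
have mgN : @measurable_fun _ _ RR R setT (fun t => g (- t)).
  by apply: (measurableT_comp mg).
have e : setT = `]-oo, 0%R]%classic `|` D :> set RR.
  apply/seteqP; split => // x _ /=; rewrite !in_itv/= andbT.
  by have [x0|x0] := leP x 0; [left|right].
rewrite e ge0_integral_setU//; last first.
- apply/disj_setPS => x [/=]; rewrite !in_itv/= andbT => h1 h2.
  by have := lt_le_trans h2 h1; rewrite ltxx.
- by move=> x _; rewrite lee_fin.
- by apply/measurable_EFinP; apply: (measurable_funS measurableT).
have -> : (\int[lambda]_(x in `]-oo, 0%R]) (g x)%:E = \int[lambda]_(x in D0) (g (- x))%:E)%E.
  have := @ge0_integration_by_substitutionNy R g 0; rewrite oppr0; apply.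
    by apply: continuous_subspaceT => x; exact: cg.
  by move=> x _.
rewrite integral_itv_obnd_cbnd; last first.
  by apply/measurable_EFinP; apply: (measurable_funS measurableT).
rewrite -ge0_integralD//.
- by apply: eq_integral => t _; rewrite -EFinD addrC.
- by move=> x _; rewrite lee_fin.
- by apply/measurable_EFinP; apply: (measurable_funS measurableT).
- by move=> x _; rewrite lee_fin.
- by apply/measurable_EFinP; apply: (measurable_funS measurableT).
Qed.

(** The substitution [u = s * exp t] turns the kernel into
    [exp (- 2 s cosh t) * exp (- nu t)]. *)
Lemma bessel_kernel_exp (nu s t : R) : 0 < s ->
  bessel_kernel (- nu) (s ^+ 2) (s * expR t) * (s * expR t) =
  s `^ (- nu) * (expR (- (2 * s) * cosh t) * expR (- (nu * t))).
Proof.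
move=> s0; have u0 : 0 < s * expR t by rewrite mulr_gt0 ?expR_gt0.
rewrite /bessel_kernel /gamma_kernel.
have e1 : (s * expR t) `^ (- nu - 1) * (s * expR t) = s `^ (- nu) * expR (- (nu * t)).
  rewrite -{2}[s * expR t]powRr1 ?(ltW u0)// -(powRDp (- nu - 1) 1 u0) subrK.
  by rewrite powRM ?(ltW s0) ?expR_ge0// -expRM mulrN [t * nu]mulrC.
have e2 : (s * expR t) `^ (-1) = s^-1 * expR (- t).
  by rewrite powR_inv1 ?(ltW u0)// invfM -expRN.
have e3 : expR (- (2 * s) * cosh t) = expR (- (1 * (s * expR t))) * expR (- (s ^+ 2 * (s * expR t) `^ (-1))).
  by rewrite -expRD e2 /cosh; congr expR; field; rewrite gt_eqF.
transitivity ((s * expR t) `^ (- nu - 1) * (s * expR t) * expR (- (1 * (s * expR t))) *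
  expR (- (s ^+ 2 * (s * expR t) `^ (-1)))); first by ring.
by rewrite e1 e3; ring.
Qed.

Lemma continuous_expR_comp (f : R -> R) (t : R) :
  {for t, continuous f} -> {for t, continuous (fun t => expR (f t))}.
Proof. by move=> cf; apply: (@continuous_comp _ _ _ f (@expR R)) => //; exact: continuous_expR. Qed.

Lemma continuous_scale (a t : R) : {for t, continuous (fun t : R => a * t)}.
Proof. by apply: continuousM => //; exact: cst_continuous. Qed.

Lemma continuous_cosh (t : R) : {for t, continuous (@cosh R)}.
Proof.
suff : {for t, continuous (fun t : R => (expR t + expR (- t)) / 2)} by [].
apply: continuousM; last exact: cst_continuous.
apply: continuousD; first exact: continuous_expR.
by apply: continuous_expR_comp; exact: continuousN.
Qed.

(** The substitution [u = s exp t] balances the two exponentials into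
    [exp (- 2 s cosh t)]. *)
Lemma integral_bessel_kernel (nu s : R) : 0 < s ->
  (\int[lambda]_(u in D) (bessel_kernel (- nu) (s ^+ 2) u)%:E =
   (2 * s `^ (- nu) * besselK nu (2 * s))%:E)%E.
Proof.
move=> s0; have s20 : 0 < s ^+ 2 by rewrite exprn_gt0.
have iE := integrable_fin_num mD (integrable_bessel_kernel (- nu) s20).
have mk := @measurable_bessel_kernel R (- nu) (s ^+ 2) setT.
have := exponential_change_of_variables s0 (f := EFin \o bessel_kernel (- nu) (s ^+ 2)).
move=> /(_ ltac:(exact/measurable_EFinP)) /(_ (fun y => bessel_kernel_ge0 _ _ _)) H.
pose g (t : R) := s `^ (- nu) * (expR (- (2 * s) * cosh t) * expR (- (nu * t))).
have cc (t : R) : {for t, continuous (fun t : R => expR (- (2 * s) * cosh t))}.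
  apply: continuous_expR_comp; apply: continuousM; first exact: cst_continuous.
  exact: continuous_cosh.
have cg : continuous g.
  suff cg t : {for t, continuous g} by move=> t; exact: cg.
  apply: continuousM; first exact: cst_continuous.
  apply: continuousM; first exact: cc.
  by apply: continuous_expR_comp; apply: continuousN; exact: continuous_scale.
have g0 t : 0 <= g t by rewrite !mulr_ge0 ?powR_ge0 ?expR_ge0.
pose h (t : R) := expR (- (2 * s) * cosh t) * cosh (nu * t).
have h0 t : 0 <= h t by rewrite mulr_ge0 ?expR_ge0// divr_ge0 ?addr_ge0 ?expR_ge0.
have mh : @measurable_fun _ _ RR R setT h.
  apply: continuous_measurable_fun; suff ch t : {for t, continuous h} by move=> t; exact: ch.
  apply: continuousM; first exact: cc.
  apply: (@continuous_comp _ _ _ (fun t : R => nu * t) (@cosh R)); first exact: continuous_scale.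
  exact: continuous_cosh.
have E : (\int[lambda]_(u in D) (bessel_kernel (- nu) (s ^+ 2) u)%:E =
    (2 * s `^ (- nu))%:E * \int[lambda]_(t in D0) (h t)%:E)%E.
  rewrite -ge0_integralZl//.
  - rewrite -H; transitivity (\int[lambda]_t (g t)%:E)%E.
      by apply: eq_integral => t _; rewrite /= -EFinM bessel_kernel_exp.
    rewrite integral_line_symmetrize//; apply: eq_integral => t _.
    rewrite -EFinM; congr EFin; rewrite /g /h /cosh !(mulrN nu) !opprK.
    by rewrite [expR (- t) + _]addrC; field.
  - by apply/measurable_EFinP; apply: (measurable_funS measurableT).
  - by move=> t _; rewrite lee_fin.
  - by rewrite lee_fin mulr_ge0 ?powR_ge0.
have c0 : 0 < 2 * s `^ (- nu) by rewrite mulr_gt0 ?powR_gt0.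
rewrite E /besselK /Rintegral [in RHS]EFinM fineK//.
move: iE; rewrite (_ : (\int[lambda]_(x in D) _ = (2 * s `^ (- nu))%:E * \int[lambda]_(t in D0) (h t)%:E)%E)//.
have : (0 <= \int[lambda]_(t in D0) (h t)%:E)%E by apply: integral_ge0 => t _; rewrite lee_fin.
by case: (integral _ _ _) => [r| |]//=; rewrite gt0_muley// lte_fin.
Qed.

(** The limit density as an integral over [u] of exponentials in [y]. Integration
    by parts merges the two Bessel kernels into [k * y] times one of index
    [1 + k], which is a Bessel function; the reflection formula turns
    [1 / Gamma (1 - k)] into the sine and [Gamma (1 + k)]. *)
Lemma limit_densityE (k y : R) : 0 < k < 1 -> 0 < y ->
  (\int[lambda]_(u in D) (expR (- y) / Gamma (1 - k) *
      (bessel_kernel (1 - k) (k * y) u + k * bessel_kernel (- k) (k * y) u))%:E =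
  (limit_density (2 * k) y)%:E)%E.
Proof.
move=> /andP[k0 k1] y0; have ky : 0 < k * y by rewrite mulr_gt0.
pose s := Num.sqrt (k * y); have s0 : 0 < s by rewrite sqrtr_gt0.
have s2 : s ^+ 2 = k * y by rewrite sqr_sqrtr// ltW.
have G0 : 0 < Gamma (1 - k) by rewrite Gamma_gt0// subr_gt0.
have e0 : (\int[lambda]_(u in D) (bessel_kernel (1 - k) (k * y) u + k * bessel_kernel (- k) (k * y) u)%:E =
    (k * y * (2 * s `^ (- (1 + k)) * besselK (1 + k) (2 * s)))%:E)%E.
  rewrite EFinM -integral_bessel_kernel// s2 opprD [- 1 - k]addrC -bessel_kernel_by_parts//.
  by apply: eq_integral => u _; rewrite mulNr opprK.
under eq_integral do rewrite EFinM.
rewrite ge0_integralZl//; last 3 first.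
- apply/measurable_EFinP; apply: measurable_funD; first exact: measurable_bessel_kernel.
  by apply: measurable_funM => //; exact: measurable_bessel_kernel.
- move=> u _; rewrite lee_fin; apply: addr_ge0; first exact: bessel_kernel_ge0.
  by apply: mulr_ge0; [exact: ltW|exact: bessel_kernel_ge0].
- by rewrite lee_fin divr_ge0 ?expR_ge0// ltW.
rewrite e0 -EFinM; congr EFin; rewrite /limit_density.
have -> : 2 * k / 2 = k by field.
have -> : 1 / 2 - 2 * k / 4 = (1 - k) / 2 by field.
have -> : Num.sqrt (2 * (2 * k) * y) = 2 * s.
  rewrite (_ : 2 * (2 * k) * y = 2 ^+ 2 * (k * y)); last by ring.
  by rewrite sqrtrM ?exprn_ge0// sqrtr_sqr ger0_norm.
have e1 : k * y * s `^ (- (1 + k)) = k `^ ((1 - k) / 2) * y `^ ((1 - k) / 2).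
  rewrite -powRM ?(ltW k0) ?(ltW y0)// -s2.
  have -> : s ^+ 2 = s `^ 2 by rewrite powR_mulrn// ltW.
  rewrite -(powRDp 2 (- (1 + k)) s0) -powRrM; congr (_ `^ _).
  by field.
have R0 := Gamma_reflection; have R1 := R0 R k ltac:(by rewrite k0 k1).
have s00 : sin (pi * k) != 0.
  apply/eqP => sp; move: R1; rewrite sp mulr0 => /esym/eqP; apply/negP.
  by rewrite gt_eqF// mulr_gt0 ?pi_gt0.
have p0 : pi != 0 :> R by rewrite gt_eqF ?pi_gt0.
have k00 : k != 0 by rewrite gt_eqF.
have G00 : Gamma (1 - k) != 0 by rewrite gt_eqF.
have e2 : (Gamma (1 - k))^-1 = Gamma (1 + k) * sin (k * pi) / (pi * k).
  apply: (mulfI G00); rewrite divff// mulrA [_ * (_ * _)]mulrA [Gamma (1 - k) * _]mulrC [k * pi]mulrC R1 divff//.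
  by rewrite mulf_neq0.
rewrite e2.
transitivity (expR (- y) * (Gamma (1 + k) * sin (k * pi) / (pi * k)) * (2 * (k * y * s `^ (- (1 + k))) * besselK (1 + k) (2 * s))).
  by rewrite !mulrA; congr (_ * _); ring.
by rewrite e1; move: (pi : R) p0 => p p0; field; rewrite k00 p0.
Qed.

End bessel_function.

(** * The limit law *)

Section unit_mass.
Context d (T : measurableType d) (R : realType).
Variables (mu : {measure set T -> \bar R}) (mu1 : mu setT = 1%E).

(** As for [density_measure], the proof is an argument so that the probability
    structure can be inferred from the term. *)
Definition unit_mass of mu setT = 1%E : set T -> \bar R := mu.

HB.instance Definition _ := isMeasure.Build _ _ _ (unit_mass mu1)
  (measure0 mu) (measure_ge0 mu) (@measure_semi_sigma_additive _ _ _ mu).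

HB.instance Definition _ := Measure_isProbability.Build _ _ _ (unit_mass mu1) mu1.

End unit_mass.

Section limit_law.
Context {R : realType}.
Local Notation RR := (measurableTypeR R).
Local Notation lambda := (@lebesgue_measure R).
Local Notation D := (`]0%R, +oo[%classic : set RR).
Local Notation tail y := (`]y%R, +oo[%classic : set RR).

Let mD : measurable D. Proof. exact: measurable_itv. Qed.

(** A joint function of [t] and [u] whose integral over [u] is the limit density. *)
Definition limit_kernel (k t : R) (u : RR) : R :=
  expR (- t) / Gamma (1 - k) *
  (bessel_kernel (1 - k) (k * t) u + k * bessel_kernel (- k) (k * t) u).

Lemma limit_kernel_ge0 (k t : R) u : 0 < k < 1 -> 0 <= limit_kernel k t u.
Proof.
move=> /andP[k0 k1]; apply: mulr_ge0.
  by rewrite divr_ge0 ?expR_ge0// ltW// Gamma_gt0// subr_gt0.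
apply: addr_ge0; first exact: bessel_kernel_ge0.
by apply: mulr_ge0; [exact: ltW|exact: bessel_kernel_ge0].
Qed.

Lemma measurable_limit_kernel (k : R) :
  measurable_fun setT (fun z : RR * RR => limit_kernel k z.1 z.2).
Proof.
have m1 : measurable_fun setT (fun z : RR * RR => z.1 : R) by exact: measurable_fst.
have m2 : measurable_fun setT (fun z : RR * RR => z.2 : R) by exact: measurable_snd.
have mb r : measurable_fun setT (fun z : RR * RR => bessel_kernel r (k * z.1) z.2).
  apply: measurable_funM.
    exact: (measurableT_comp (measurable_gamma_kernel r 1) measurable_snd).
  apply: measurableT_comp; first exact: measurable_expR.
  apply: measurableT_comp; first exact: oppr_measurable.
  apply: measurable_funM; first by apply: measurable_funM.
  exact: (measurableT_comp (@measurable_powR R (-1)) m2).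
apply: measurable_funM.
  apply: measurable_funM => //.
  apply: measurableT_comp; first exact: measurable_expR.
  by apply: measurableT_comp; first exact: oppr_measurable.
by apply: measurable_funD => //; apply: measurable_funM.
Qed.

(** In [t] the kernel is, up to a factor, the opposite of the derivative of
    [exp (- (1 + k / u) t)]. *)
Lemma limit_kernel_expR (k t u : R) : 0 < u ->
  limit_kernel k t u = gamma_kernel (1 - k) 1 u / Gamma (1 - k) *
    ((1 + k / u) * expR (- ((1 + k / u) * t))).
Proof.
move=> u0; rewrite /limit_kernel /bessel_kernel /gamma_kernel.
have -> : 1 - k - 1 = (- k - 1) + 1 by ring.
rewrite (powRDp (- k - 1) 1 u0) powRr1 ?(ltW u0)// powR_inv1 ?(ltW u0)//.
have -> : expR (- ((1 + k / u) * t)) = expR (- t) * expR (- (k * t * u^-1)).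
  by rewrite -expRD; congr expR; field; rewrite gt_eqF.
by move: (Gamma _)^-1 (expR _) (expR _) (expR _) (u `^ _) => G x y z w; field; rewrite gt_eqF.
Qed.

(** The tail of the limit law; at [y = 0] it is [Gamma (1 - k) / Gamma (1 - k)]. *)
Definition limit_tail (k y : R) : \bar R :=
  (\int[lambda]_(u in D) (expR (- y) / Gamma (1 - k) * bessel_kernel (1 - k) (k * y) u)%:E)%E.

(** Tonelli: integrating first in [t] over the tail replaces the factor
    [(1 + k / u) exp (- (1 + k / u) t)] by its primitive at [y]. *)
Lemma limit_kernel_tail (k y : R) : 0 < k < 1 ->
  measurable_fun setT (fun t : RR => \int[lambda]_u (limit_kernel k t u * (\1_(tail y) t * \1_D u))%:E)%E /\
  (\int[lambda]_t \int[lambda]_u (limit_kernel k t u * (\1_(tail y) t * \1_D u))%:E =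
   limit_tail k y)%E.
Proof.
move=> k01; have /andP[k0 k1] := k01.
have my : measurable (tail y) by exact: measurable_itv.
pose G (z : RR * RR) : \bar R := (limit_kernel k z.1 z.2 * (\1_(tail y) z.1 * \1_D z.2))%:E.
have mG : measurable_fun setT G.
  apply/measurable_EFinP; apply: measurable_funM; first exact: measurable_limit_kernel.
  apply: measurable_funM.
    apply: (@measurableT_comp _ _ _ _ RR _ (\1_(tail y) : RR -> R)); [exact: measurable_indic|exact: measurable_fst].
  apply: (@measurableT_comp _ _ _ _ RR _ (\1_D : RR -> R)); [exact: measurable_indic|exact: measurable_snd].
have G0 z : (0 <= G z)%E.
  by rewrite lee_fin mulr_ge0 ?limit_kernel_ge0// mulr_ge0// indicE.
split; first exact: (measurable_fun_fubini_tonelli_F (m2 := lambda) G mG G0).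
rewrite (fubini_tonelli (m1 := lambda) (m2 := lambda) G mG G0).
rewrite /limit_tail [RHS]integral_mkcond; apply: eq_integral => u _.
rewrite patchE; case: ifPn => uD; last first.
  rewrite (eq_integral (cst 0%E)) ?integral0// => t _.
  by rewrite /G/= [\1_D u]indicE (negbTE uD) !mulr0.
have u0 : 0 < u by move: uD; rewrite inE/= in_itv/= andbT.
have c0 : 0 < 1 + k / u by rewrite addr_gt0 ?divr_gt0.
have g0 : 0 <= gamma_kernel (1 - k) 1 u / Gamma (1 - k).
  by rewrite divr_ge0 ?gamma_kernel_ge0// ltW// Gamma_gt0// subr_gt0.
transitivity (\int[lambda]_(t in tail y) ((gamma_kernel (1 - k) 1 u / Gamma (1 - k) * (1 + k / u))%:E * (expR (- ((1 + k / u) * t)))%:E))%E.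
  rewrite [RHS]integral_mkcond; apply: eq_integral => t _.
  rewrite patchE /G/= !indicE uD mulr1; case: ifP => _; rewrite ?mulr0//.
  by rewrite mulr1 limit_kernel_expR// mulrA EFinM.
rewrite ge0_integralZl//.
- rewrite integral_expR_tail// -EFinM; congr EFin.
  rewrite /bessel_kernel powR_inv1 ?(ltW u0)//.
  have -> : expR (- ((1 + k / u) * y)) = expR (- y) * expR (- (k * y * u^-1)).
    by rewrite -expRD; congr expR; field; rewrite gt_eqF.
  move: c0 => /lt0r_neq0; move: (1 + k / u) => c c0.
  by move: (Gamma _)^-1 => g; field.
- apply/measurable_EFinP; apply: (measurable_funS measurableT) => //.
  apply: measurableT_comp; first exact: measurable_expR.
  apply: measurableT_comp; first exact: oppr_measurable.
  exact: measurable_funM.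
- by rewrite lee_fin mulr_ge0// ltW.
Qed.

Lemma limit_density_integral (k y t : R) : 0 < k < 1 -> 0 <= y ->
  (\int[lambda]_u (limit_kernel k t u * (\1_(tail y) t * \1_D u))%:E =
   (limit_density (2 * k) t * \1_(tail y) t)%:E)%E.
Proof.
move=> k01 y0; rewrite indicE; case: (boolP (t \in (tail y : set RR))) => ty; last first.
  by rewrite mulr0; apply: integral0_eq => u _; rewrite mul0r mulr0.
have t0 : 0 < t by move: ty; rewrite inE/= in_itv/= andbT; exact: le_lt_trans.
rewrite mulr1 -limit_densityE// [RHS]integral_mkcond; apply: eq_integral => u _.
by rewrite patchE indicE mul1r; case: (u \in D); rewrite ?mulr1// mulr0.
Qed.

Lemma measurable_limit_density (k : R) : 0 < k < 1 ->
  measurable_fun setT (fun t : RR => limit_density (2 * k) t * \1_D t).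
Proof.
move=> k01; apply/measurable_EFinP.
have [h _] := limit_kernel_tail 0 k01.
rewrite (_ : (EFin \o _) = (fun t : RR => \int[lambda]_u (limit_kernel k t u * (\1_D t * \1_D u))%:E)%E)//.
by apply/funext => t; rewrite /= limit_density_integral.
Qed.

Lemma limit_density_ge0 (k t : R) : 0 < k < 1 -> 0 <= limit_density (2 * k) t * \1_D t.
Proof.
move=> k01; rewrite -lee_fin -limit_density_integral//.
by apply: integral_ge0 => u _; rewrite lee_fin mulr_ge0 ?limit_kernel_ge0// mulr_ge0// indicE.
Qed.

Lemma limit_tail0 (k : R) : 0 < k < 1 -> limit_tail k 0 = 1%E.
Proof.
move=> /andP[k0 k1]; have k1' : 0 < 1 - k by rewrite subr_gt0.
have G0 := Gamma_gt0 k1'.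
rewrite /limit_tail; under eq_integral do rewrite EFinM.
rewrite ge0_integralZl//.
- transitivity ((expR (- 0) / Gamma (1 - k))%:E * (Gamma (1 - k))%:E)%E.
    congr (_ * _)%E; rewrite -(GammaE k1'); apply: eq_integral => u _.
    by rewrite /bessel_kernel mulr0 mul0r oppr0 expR0 mulr1.
  by rewrite -EFinM oppr0 expR0 mul1r mulVf// gt_eqF.
- by apply/measurable_EFinP; exact: measurable_bessel_kernel.
- by move=> u _; rewrite lee_fin bessel_kernel_ge0.
- by rewrite lee_fin divr_ge0 ?expR_ge0// ltW.
Qed.

Lemma limit_law (k : R) : 0 < k < 1 ->
  exists2 Q : probability RR R,
    has_density lambda Q D (limit_density (2 * k)) &
    forall y, 0 <= y -> Q (tail y) = limit_tail k y.
Proof.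
move=> k01.
have mw := measurable_limit_density k01; have w0 t := limit_density_ge0 t k01.
pose nu := density_measure lambda mw w0.
have nu_tail y : 0 <= y -> nu (tail y) = limit_tail k y.
  move=> y0; have [_ <-] := limit_kernel_tail y k01.
  rewrite /nu /density_measure integral_mkcond; apply: eq_integral => t _.
  rewrite limit_density_integral// patchE [in RHS]indicE; case: (boolP (t \in (tail y : set RR))) => ty; last by rewrite mulr0.
  rewrite mulr1 indicE mem_set ?mulr1//=.
  by move: ty; rewrite inE/= !in_itv/= !andbT; exact: le_lt_trans.
have nuD A : measurable A -> nu A = (\int[lambda]_(x in D `&` A) (limit_density (2 * k) x)%:E)%E.
  move=> mA; rewrite /nu /density_measure setIC integral_mkcondr; apply: eq_integral => t _.
  by rewrite patchE indicE; case: (t \in D); rewrite ?mulr1// mulr0.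
have nu1 : nu setT = 1%E.
  rewrite -(limit_tail0 k01) -nu_tail// nuD// nuD//.
  by rewrite setIT setIid.
exists (unit_mass nu1) => //; split => //.
- have e : {in D, (fun t : RR => limit_density (2 * k) t * \1_D t) =1 limit_density (2 * k)}.
    by move=> t tD; rewrite indicE tD mulr1.
  by apply: (eq_measurable_fun _ e); apply: (measurable_funS measurableT).
- move=> t tD; have := w0 t; rewrite indicE mem_set ?mulr1//.
Qed.

End limit_law.

(** * Convergence in distribution *)

Section survival_limit.
Context {R : realType}.
Local Notation RR := (measurableTypeR R).
Local Notation lambda := (@lebesgue_measure R).
Local Notation D := (`]0%R, +oo[%classic : set RR).

Let mD : measurable D. Proof. exact: measurable_itv. Qed.

Lemma cvgy_inv0 (u : nat -> R) : (forall n, 0 < u n) -> u @ \oo --> +oo ->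
  (u n)^-1 @[n --> \oo] --> (0 : R).
Proof. by move=> u0 uy; apply/gtr0_cvgV0 => //; exact: nearW. Qed.

Lemma limit_tailE (k y : R) : 0 < k < 1 -> 0 < y ->
  limit_tail k y = (expR (- y) *
    (fine (\int[lambda]_(u in D) (bessel_kernel (1 - k) (k * y) u)%:E) / Gamma (1 - k)))%:E.
Proof.
move=> /andP[k0 k1] y0; have ky : 0 < k * y by rewrite mulr_gt0.
have G0 : 0 < Gamma (1 - k) by rewrite Gamma_gt0// subr_gt0.
have i1 := integrable_fin_num mD (integrable_bessel_kernel (1 - k) ky).
rewrite /limit_tail; under eq_integral do rewrite EFinM.
rewrite ge0_integralZl//.
- by rewrite -(fineK i1) -EFinM; congr EFin; rewrite mulrAC mulrA.
- by apply/measurable_EFinP; exact: measurable_bessel_kernel.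
- by move=> u _; rewrite lee_fin bessel_kernel_ge0.
- by rewrite lee_fin divr_ge0 ?expR_ge0// ltW.
Qed.

(** With [x = y / (M N)], the power of [1 - x] tends to [exp (- y)]. In the scale
    [w = u / N] the shift is [N s], which tends to 0, while [kap N s] tends to
    [k y]; the powers of [N] cancel in the ratio. *)
Lemma survival_cvg (k y : R) (M N : nat -> R) : 0 < k < 1 -> 0 < y ->
  (forall n, 1 <= M n) -> (forall n, 2 <= N n) -> (forall n, y <= M n * N n / 2) ->
  M @ \oo --> +oo -> N @ \oo --> +oo ->
  let x n := y / (M n * N n) in
  ((1 - x n) `^ (M n * (N n - k)) *
    (fine (tilted_beta_integral k (N n) (M n * k) (x n / (1 - x n))) /
     fine (tilted_beta_integral k (N n) (M n * k) 0)))%:E @[n --> \oo] --> limit_tail k y.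
Proof.
move=> k01 y0 M1 N2 yMN My Ny x; have /andP[k0 k1] := k01.
have M0 n : 0 < M n by exact: lt_le_trans ltr01 (M1 n).
have N0 n : 0 < N n by exact: lt_le_trans (ltr0Sn _ 1) (N2 n).
have MN0 n : 0 < M n * N n by rewrite mulr_gt0.
have MV := cvgy_inv0 M0 My; have NV := cvgy_inv0 N0 Ny.
have xE n : x n = y * ((M n)^-1 * (N n)^-1) by rewrite /x invfM.
have x0 n : 0 <= x n by rewrite divr_ge0// ltW.
have x2 n : x n <= 1 / 2.
  by rewrite /x ler_pdivrMr//; have := yMN n; lra.
have xc : x n @[n --> \oo] --> (0 : R).
  rewrite (_ : (fun n => _) = (fun n => y * ((M n)^-1 * (N n)^-1))); last exact/funext.
  rewrite -[X in _ --> X](mulr0 y) -[X in _ --> y * X](mulr0 0).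
  by apply: cvgM; [exact: cvg_cst|exact: cvgM].
have x1c : (1 - x n)^-1 @[n --> \oo] --> (1 : R).
  rewrite -[X in _ --> X]invr1; apply: cvgV; first by rewrite oner_neq0.
  by rewrite -[X in _ --> X]subr0; apply: cvgB => //; exact: cvg_cst.
have x1 n : 1 - x n != 0 by rewrite gt_eqF//; have := x2 n; lra.
have powc : (1 - x n) `^ (M n * (N n - k)) @[n --> \oo] --> expR (- y).
  apply: (@powR1D_cvg R (fun n => - x n)).
    by rewrite -[X in _ --> X]oppr0; exact: cvgN.
  rewrite (_ : (fun n => _) = (fun n => - y + y * k * (N n)^-1)); last first.
    by apply/funext => n; rewrite /x; field; rewrite !gt_eqF.
  rewrite -[X in _ --> X]addr0 -[X in _ --> _ + X](mulr0 (y * k)).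
  by apply: cvgD; [exact: cvg_cst|apply: cvgM; [exact: cvg_cst|]].
pose s n := x n / (1 - x n).
have s0 n : 0 <= s n by rewrite divr_ge0//; have := x2 n; lra.
have Nsc : N n * s n @[n --> \oo] --> (0 : R).
  rewrite (_ : (fun n => _) = (fun n => y * (M n)^-1 * (1 - x n)^-1)); last first.
    by apply/funext => n; rewrite /s {1}/x; field; rewrite x1 !gt_eqF.
  rewrite (_ : 0 = y * 0 * 1 :> R); last by rewrite mulr0 mul0r.
  by apply: cvgM => //; apply: cvgM => //; exact: cvg_cst.
have kNsc : M n * k * (N n * s n) @[n --> \oo] --> k * y.
  rewrite (_ : (fun n => _) = (fun n => k * y * (1 - x n)^-1)); last first.
    by apply/funext => n; rewrite /s {1}/x; field; rewrite x1 !gt_eqF.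
  by rewrite -[X in _ --> X]mulr1; apply: cvgM => //; exact: cvg_cst.
have kap0 n : 0 <= M n * k by rewrite mulr_ge0// ltW.
have c1 := scaled_beta_integral_cvg k1 N2 Ny s0 kap0 Nsc kNsc.
have z1 : N n * (0 : R) @[n --> \oo] --> (0 : R).
  by rewrite (_ : (fun n => _) = cst 0); [exact: cvg_cst|apply/funext => n; rewrite mulr0].
have z2 : M n * k * (N n * (0 : R)) @[n --> \oo] --> (0 : R).
  by rewrite (_ : (fun n => _) = cst 0); [exact: cvg_cst|apply/funext => n; rewrite !mulr0].
have c0 := scaled_beta_integral_cvg (s := fun=> 0) k1 N2 Ny (fun=> lexx 0) kap0 z1 z2.
pose B := fine (\int[lambda]_(u in D) (bessel_kernel (1 - k) (k * y) u)%:E).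
have k1' : 0 < 1 - k by rewrite subr_gt0.
have G0 := Gamma_gt0 k1'.
have ky : 0 < k * y by rewrite mulr_gt0.
have L1 : (\int[lambda]_(u in `]0%R, +oo[) (gamma_kernel (1 - k) 1 u * expR (- (k * y / u)))%:E = B%:E)%E.
  have i1 := integrable_fin_num mD (integrable_bessel_kernel (1 - k) ky).
  rewrite /B (fineK i1).
  apply: eq_integral => u; rewrite inE/= in_itv/= andbT => u0.
  by rewrite /bessel_kernel powR_inv1// ltW.
have L0 : (\int[lambda]_(u in `]0%R, +oo[) (gamma_kernel (1 - k) 1 u * expR (- (0 / u)))%:E = (Gamma (1 - k))%:E)%E.
  rewrite -(GammaE k1'); apply: eq_integral => u _.
  by rewrite mul0r oppr0 expR0 mulr1.
rewrite L1 in c1; rewrite L0 in c0.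
have ratio n : fine (tilted_beta_integral k (N n) (M n * k) (s n)) / fine (tilted_beta_integral k (N n) (M n * k) 0) =
    fine (\int[lambda]_(u in `]0%R, +oo[) (scaled_beta k (N n) (M n * k) (s n) u)%:E)%E /
    fine (\int[lambda]_(u in `]0%R, +oo[) (scaled_beta k (N n) (M n * k) 0 u)%:E)%E.
  rewrite !tilted_beta_integral_scaled//.
  have fm (P : R) z : 0 < P -> fine (P%:E * z)%E = P * fine z.
    by move=> P0; case: z => [r| |]//=; rewrite ?gt0_muley ?gt0_muleNy ?lte_fin//= mulr0.
  have P0 : 0 < N n `^ (k - 1) by rewrite powR_gt0.
  by rewrite !(fm _ _ P0) -mulf_div (divff (lt0r_neq0 P0)) mul1r.
rewrite limit_tailE//; apply: cvg_EFin; first exact: nearW.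
rewrite (_ : fine \o _ = (fun n => (1 - x n) `^ (M n * (N n - k)) *
   (fine (\int[lambda]_(u in `]0%R, +oo[) (scaled_beta k (N n) (M n * k) (s n) u)%:E)%E /
    fine (\int[lambda]_(u in `]0%R, +oo[) (scaled_beta k (N n) (M n * k) 0 u)%:E)%E))); last first.
  by apply/funext => n /=; rewrite -ratio.
apply: cvgM => //; apply: cvgM; first exact: fine_cvg c1.
by apply: cvgV; [rewrite gt_eqF|exact: fine_cvg c0].
Qed.

End survival_limit.

Theorem theorem3p8 (R : realType) (beta : R) (beta0 : 0 < beta) (beta2 : beta < 2)
  (b : nat -> R) (b_gtN1 : forall m, (1 <= m)%N -> -1 < b m)
  (b_cvg : b m + m%:R @[m --> \oo] --> +oo)
  (d : nat -> measure_display) (T : forall m, measurableType (d m))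
  (P : forall m, probability (T m) R)
  (X : forall m, {RV (P m) >-> m.-tuple (measurableTypeR R)})
  (X_jacobi : forall m, (1 <= m)%N ->
    jacobi_ensemble beta (2 / beta - 2) (b m) (X m)) :
  exists2 Q : probability (measurableTypeR R) R,
    has_density lebesgue_measure Q `]0, +oo[ (limit_density beta) &
    cvg_in_distribution
      (fun m => ((beta * m%:R * (b m + m%:R) / 2) \o* (@smallest_eigenvalue R m \o X m))
        : {RV (P m) >-> R})
      Q.
Proof.
pose k := beta / 2; have k01 : 0 < k < 1 by rewrite /k; lra.
have /andP[k0 k1] := k01.
have betaE : 2 * k = beta by rewrite /k; field.
have [Q Qd Qtail] := limit_law k01; rewrite betaE in Qd.
exists Q => // y _.
pose N m := k * (b m + m%:R).
have N0 m : (1 <= m)%N -> 0 < N m.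
  move=> m1; rewrite mulr_gt0//; have := b_gtN1 m m1.
  have : 1 <= m%:R :> R by rewrite ler1n.
  by lra.
pose surv m (x : R) := distribution (P m) (X m) [set l | x < smallest_eigenvalue l].
have msurv m x := @measurable_smallest_eigenvalue_gt R m x.
have cdfE m : (1 <= m)%N -> cdf ((beta * m%:R * (b m + m%:R) / 2) \o* (@smallest_eigenvalue R m \o X m) : {RV (P m) >-> R}) y =
    (1 - surv m (y / (m%:R * N m))%R)%E.
  move=> m1; rewrite /surv -probability_setC; last exact: msurv.
  rewrite /cdf /distribution/= /pushforward; congr (P m _).
  have mN0 : 0 < m%:R * N m by rewrite mulr_gt0 ?N0// ltr0n.
  apply/seteqP; split => w /=; rewrite in_itv/= => h.
    apply/negP; rewrite -leNgt ler_pdivlMr//; apply: le_trans h.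
    by rewrite le_eqVlt; apply/orP; left; apply/eqP; rewrite /N /k; field.
  move/negP: h; rewrite -leNgt ler_pdivlMr//; apply: le_trans.
  by rewrite le_eqVlt; apply/orP; left; apply/eqP; rewrite /N /k; field.
have QE : Q `]-oo, y]%classic = (1 - Q `]y, +oo[%classic)%E.
  rewrite -probability_setC; last exact: measurable_itv.
  by congr (Q _); rewrite -setCitvr.
have surv0 : forall m, (1 <= m)%N -> surv m 0 = 1%E.
  move=> m m1; have [c c0] := X_jacobi m m1; rewrite jacobi_weightE//.
  exact: jacobi_smallest_gt0.
suff H : surv m (y / (m%:R * N m)) @[m --> \oo] --> Q `]y, +oo[%classic.
  rewrite QE; apply: (@cvg_trans _ ((1 - surv m (y / (m%:R * N m))%R)%E @[m --> \oo])).
    apply: near_eq_cvg; exists 1%N => // m /= m1; exact/esym/cdfE.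
  by apply: cvgeB => //; exact: cvg_cst.
have [y0|y0] := leP y 0.
  have -> : Q `]y, +oo[%classic = 1%E.
    apply/eqP; rewrite eq_le probability_le1/=; last exact: measurable_itv.
    rewrite -(limit_tail0 k01) -Qtail//; apply: le_measure; rewrite ?inE; [exact: measurable_itv..|].
    by move=> t /=; rewrite !in_itv/= !andbT; exact: le_lt_trans.
  apply: (@cvg_trans _ (1%E @[m --> \oo])); last exact: cvg_cst.
  apply: near_eq_cvg; exists 1%N => // m /= m1.
  apply/eqP; rewrite eq_le; apply/andP; split; last by rewrite /surv probability_le1//; exact: msurv.
  rewrite -(surv0 m m1); apply: le_measure; rewrite ?inE; [exact: msurv..|].
  move=> l /=; apply: le_lt_trans.
  by rewrite pmulr_lle0// invr_gt0 mulr_gt0 ?N0// ltr0n.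
rewrite Qtail ?(ltW y0)//.
have Ny : N m @[m --> \oo] --> +oo.
  apply/cvgryPge => A; near=> m; rewrite /N -ler_pdivrMl//.
  by near: m; exact: cvgry_ge.
have My : m%:R @[m --> \oo] --> (+oo : set_system R) by exact: cvgr_idn.
have [n0 _ H0] : \forall m \near \oo, (1 <= m)%N /\ 2 <= N m /\ 2 * y <= N m.
  near=> m; split; [|split]; near: m.
  - by exists 1%N.
  - exact: (cvgry_ge Ny).
  - exact: (cvgry_ge Ny).
have H n : (1 <= n + n0)%N /\ 2 <= N (n + n0)%N /\ 2 * y <= N (n + n0)%N by apply: H0; rewrite /= leq_addl.
rewrite -(cvg_shiftn n0).
have sc := @survival_cvg R k y (fun n => (n + n0)%:R) (fun n => N (n + n0)%N) k01 y0.
have M1 n : 1 <= (n + n0)%:R :> R by rewrite ler1n; have [] := H n.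
have N2 n : 2 <= N (n + n0)%N by have [_ []] := H n.
have yMN n : y <= (n + n0)%:R * N (n + n0)%N / 2.
  have [_ [_ h]] := H n; have h1 := ler_wpM2r (le_trans (ltW (ltr0Sn _ 1)) (N2 n)) (M1 n).
  by lra.
have My' : (n + n0)%:R @[n --> \oo] --> (+oo : set_system R) by move: My; rewrite -(cvg_shiftn n0).
have Ny' : N (n + n0)%N @[n --> \oo] --> +oo by move: Ny; rewrite -(cvg_shiftn n0).
apply: cvg_trans (sc M1 N2 yMN My' Ny').
apply: near_eq_cvg; apply: nearW => n /=.
have [m1 _] := H n; set m := (n + n0)%N in m1 *.
have [c c0] := X_jacobi m m1; rewrite jacobi_weightE// -/k => dens.
have q0 : 0 < k * (b m + 1) by rewrite mulr_gt0//; have := b_gtN1 m m1; lra.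
have := @jacobi_survival_ratio R k (k * (b m + 1)) c m _ m1 k0 q0 c0 dens => -[_ h].
rewrite /surv h.
  by have -> : k * (b m + 1) + k * (m%:R - 1) = N m by rewrite /N; ring.
have mN0 : 0 < m%:R * N m by rewrite mulr_gt0 ?N0// ltr0n.
rewrite divr_gt0//= ltr_pdivrMr// mul1r; have := yMN n; rewrite -/m; lra.
Unshelve. all: by end_near. Qed.
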